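(* Let $\alpha=\frac32$ or $\alpha=\frac12$. Suppose that $\sigma$ is sufficiently large, i.e. $\sigma\ge\sigma_0$ for some threshold $\sigma_0$. Let $v$ be a solution on $[0,T]$ of $$\partial_t v+W_\varepsilon(v)\,\partial_x v+\frac{i}{\varepsilon}|D|^\alpha v+\frac1\varepsilon\chi_\omega v=0,\qquad v(t=0)=v_0\in H^\sigma(\mathbb T).$$ Let $\mathcal E$ be the energy corresponding to $\alpha$, namely $$\mathcal E(t)=\sum_{k=0}^{2}\|(\varepsilon\partial_t)^k v(t)\|_{L^2}^2\ \text{ if }\alpha=\tfrac32,\qquad \mathcal E(t)=\sum_{k=0}^{4}\|(i|D|^{1/2}+\chi_\omega)^k v(t)\|_{L^2}^2\ \text{ if }\alpha=\tfrac12 .$$ Then $$\frac{d\mathcal E}{dt}\lesssim\mathcal E ,$$ with an implicit constant that is uniform in $\varepsilon$.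
   Context: $\mathbb T=\mathbb R/2\pi\mathbb Z$; $H^s=H^s(\mathbb T)$ are the $L^2$-based Sobolev spaces of complex-valued functions; $|D|^\alpha$ is the Fourier multiplier with symbol $|\xi|^\alpha$. $\chi_\omega\in C^\infty(\mathbb T)$ is a fixed non-negative cut-off function supported on an interval $\omega\subset[0,2\pi)$; it also denotes the operator of multiplication by $\chi_\omega$. $\varepsilon\in(0,1)$ is a small parameter. The map $W$ is fixed and satisfies: for some large integer $N$, $W$ is continuous from $H^{s-N}$ to $H^s$ with $\|W(U)\|_{H^s}\lesssim\|\langle D\rangle^{-N}U\|_{H^s}$ for all $s$; $W(U)$ is a real-valued function; $W(U)=W(U^* )$, where $U^*$ is the complex conjugate of $U$; $W$ scales linearly, $W(\lambda U)=\lambda W(U)$ for $\lambda\in\mathbb R$; and $\partial_tW(U)=W(\partial_tU)$ for time-dependent $U$. One sets $W_\varepsilon(v):=\varepsilon^{-1}W(\varepsilon v)$. Conventions. A solution on $[0,T]$ is $v\in C([0,T];H^\sigma)$ satisfying the equation in the sense of distributions. Solutions are a priori bounded, so that $\|W_\varepsilon(v)\|_{L^\infty}\lesssim1$ and $\|\partial_xW_\varepsilon(v)\|_{L^\infty}\lesssim1$ uniformly in $\varepsilon$. Accordingly, $\frac{d\mathcal E}{dt}\lesssim\mathcal E$ means: for every $M>0$ there is a constant $C$, depending only on $M$, $\sigma$, $W$, $\chi_\omega$ (not on $\varepsilon$, $t$, $T$ or $v$), such that $\frac{d\mathcal E}{dt}\le C\mathcal E$ on $(0,T)$ for every solution with $\sup_{[0,T]}\|v(t)\|_{H^\sigma}\le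 M$. The time derivative is taken classically where it exists and otherwise in the sense of distributions. *)

(* Defs.v *)
From HB Require Import structures.
From mathcomp Require Import all_boot all_order all_algebra.
From mathcomp Require Import complex.
From mathcomp Require Import all_classical all_reals all_analysis.

Set Implicit Arguments.
Unset Strict Implicit.
Unset Printing Implicit Defensive.

Import Order.TTheory GRing.Theory Num.Theory.
Import numFieldNormedType.Exports.

Local Open Scope classical_set_scope.
Local Open Scope complex_scope.
Local Open Scope ring_scope.

(* A periodic distribution on the torus R / 2 pi Z is represented by its      *)
(* family of Fourier coefficients                                             *)
(*    u n = (2 pi)^-1 * <u, e^(-inx)>,  i.e. u = \sum_n u n * e^(inx).        *)
(* The type contains all families; the genuine distributions are those of     *)
(* polynomial growth, i.e. the elements of the union over s of [Sobolev s].   *)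
(* Pointwise operations on functions (products) are NOT defined on the        *)
(* Fourier side: they go through [fun_of] and [coef] below.                   *)
Definition distr (R : realType) := int -> R[i].

Section distributions.
Variable R : realType.
Implicit Types (u w : distr R) (f g : R -> R[i]) (s : R) (n : int).

Definition expi (x : R) : R[i] := cos x +i* sin x.

Definition Cintegral (a b : R) f : R[i] :=
  Rintegral lebesgue_measure `[a, b] (fun x => complex.Re (f x)) +i*
  Rintegral lebesgue_measure `[a, b] (fun x => complex.Im (f x)).

Definition Cderive1 f (t : R) : R[i] :=
  derive1 (fun r => complex.Re (f r)) t +i*
  derive1 (fun r => complex.Im (f r)) t.

Definition coef f : distr R := fun n =>
  ((2 * pi)^-1)%:C * Cintegral 0 (2 * pi) (fun x => f x * expi (- (n%:~R * x))).

Definition fourier_sum u (x : R) (N : nat) : R[i] :=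
  \sum_(k < N.*2.+1) u (k%:Z - N%:Z) * expi ((k%:Z - N%:Z)%:~R * x).

(* The function with Fourier coefficients u; for u in H^s with s > 1/2 the    *)
(* series converges absolutely and this is the continuous representative.     *)
Definition fun_of u (x : R) : R[i] :=
  limn (fun N => complex.Re (fourier_sum u x N)) +i*
  limn (fun N => complex.Im (fourier_sum u x N)).

Definition prodd u w : distr R := coef (fun x => fun_of u x * fun_of w x).

Definition mulchi (chi : R -> R) u : distr R :=
  coef (fun x => (chi x)%:C * fun_of u x).

Definition scaled (a : R[i]) u : distr R := fun n => a * u n.

(* Fourier coefficients of the complex conjugate of u; u is real-valued when  *)
(* conjd u = u.                                                               *)
Definition conjd u : distr R := fun n => conjc (u (- n)).

Definition multiplier (m : int -> R[i]) u : distr R := fun n => m n * u n.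

Definition dx u : distr R := multiplier (fun n => 'i%C * (n%:~R)) u.

Definition absD (a : R) u : distr R :=
  multiplier (fun n => (`|n%:~R : R| `^ a)%:C) u.

Definition bracket n : R := Num.sqrt (1 + n%:~R ^+ 2).

Definition bracketD (a : R) u : distr R :=
  multiplier (fun n => (bracket n `^ a)%:C) u.

(* The factor 2 pi makes [Sobolev_norm 0] the norm of L^2([0, 2 pi], dx).     *)
Definition Sobolev_sqnorm s u : \bar R :=
  \esum_(n in [set: int])
    (2 * pi * bracket n `^ (2 * s) * ComplexField.Normc.normc (u n) ^+ 2)%:E.

Definition Sobolev s : set (distr R) := [set u | (Sobolev_sqnorm s u < +oo)%E].

Definition Sobolev_norm s u : R := Num.sqrt (fine (Sobolev_sqnorm s u)).

Definition L2norm u : R := Sobolev_norm 0 u.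

Definition Sobolev_is_derive s (U : R -> distr R) (t : R) (dU : distr R) : Prop :=
  [/\ \forall r \near t, Sobolev s (U r), Sobolev s dU &
      (fun h : R => Sobolev_norm s (scaled (h^-1)%:C (U (t + h) \- U t) \- dU))
        @ 0^' --> (0 : R)].

Definition Sobolev_continuous_on s (a b : R) (U : R -> distr R) : Prop :=
  (forall t, t \in `[a, b] -> Sobolev s (U t)) /\
  (forall t, t \in `[a, b] ->
     (fun r => Sobolev_norm s (U r \- U t)) @ within `[a, b] (nbhs t)
       --> (0 : R)).

(* The time derivative of a curve of distributions, taken weakly in x, i.e.   *)
(* coefficient by coefficient.                                                *)
Definition dt (U : R -> distr R) : R -> distr R :=
  fun t n => Cderive1 (fun r => U r n) t.

Definition smooth (f : R -> R) : Prop := forall k x, derivable (derive1n k f) x 1.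

Definition cutoff (omega : set R) (chi : R -> R) : Prop :=
  [/\ is_interval omega /\ omega `<=` `[0, 2 * pi[,
      smooth chi,
      forall x, chi (x + 2 * pi) = chi x,
      forall x, 0 <= chi x &
      forall x, x \in `[0, 2 * pi[ -> chi x != 0 -> omega x].

Record admissible_W (N : nat) (W : distr R -> distr R) : Prop := {
  W_Sobolev : forall s u, Sobolev (s - N%:R) u -> Sobolev s (W u) ;
  W_continuous : forall s u, Sobolev (s - N%:R) u ->
    forall e, 0 < e -> exists2 d, 0 < d &
      forall w, Sobolev (s - N%:R) w ->
        Sobolev_norm (s - N%:R) (w \- u) < d ->
        Sobolev_norm s (W w \- W u) < e ;
  W_bounded : forall s, exists K : R, forall u, Sobolev (s - N%:R) u ->
    Sobolev_norm s (W u) <= K * Sobolev_norm s (bracketD (- N%:R) u) ;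
  W_real : forall s u, Sobolev s u -> conjd (W u) = W u ;
  W_conj : forall s u, Sobolev s u -> W (conjd u) = W u ;
  W_scale : forall s u (a : R), Sobolev s u ->
    W (scaled a%:C u) = scaled a%:C (W u) ;
  W_dt : forall s (U : R -> distr R) t dU,
    Sobolev_is_derive (s - N%:R) U t dU ->
    Sobolev_is_derive s (fun r => W (U r)) t (W dU) }.

Definition Weps (W : distr R -> distr R) (eps : R) u : distr R :=
  scaled (eps^-1)%:C (W (scaled eps%:C u)).

Section equation.
Variables (W : distr R -> distr R) (chi : R -> R) (alpha : R).

Definition spatial_part (eps : R) u : distr R := fun n =>
  prodd (Weps W eps u) (dx u) n
  + 'i%C * (eps^-1)%:C * absD alpha u n
  + (eps^-1)%:C * mulchi chi u n.

Definition time_test_function (T : R) (theta : R -> R) : Prop :=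
  smooth theta /\
  exists a b, [/\ 0 < a, b < T &
    forall t, t \notin `[a, b] -> theta t = 0].

(* The equation is tested in the sense of distributions on ]0, T[ x torus     *)
(* against the functions theta(t) * e^(-inx), whose span is dense among test  *)
(* functions.                                                                 *)
Definition is_solution (sigma eps T : R) (v0 : distr R) (v : R -> distr R) :
    Prop :=
  [/\ Sobolev_continuous_on sigma 0 T v,
      Sobolev sigma v0, v 0 = v0 &
      forall theta, time_test_function T theta -> forall n,
        Cintegral 0 T (fun t =>
          (theta t)%:C * spatial_part eps (v t) n
          - (derive1 theta t)%:C * v t n) = 0].

Definition capillary_energy (eps : R) (v : R -> distr R) (t : R) : R :=
  \sum_(k < 3) L2norm (iter k (fun U r => scaled eps%:C (dt U r)) v t) ^+ 2.

Definition damped_op u : distr R := fun n =>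
  'i%C * absD (1 / 2) u n + mulchi chi u n.

Definition gravity_energy (v : R -> distr R) (t : R) : R :=
  \sum_(k < 5) L2norm (iter k damped_op (v t)) ^+ 2.

(* Only meant for alpha = 3/2 or alpha = 1/2.                                 *)
Definition energy (eps : R) (v : R -> distr R) : R -> R :=
  if alpha == 3 / 2 then capillary_energy eps v else gravity_energy v.

End equation.
End distributions.

(* Main.v *)
Require Import Defs.
From HB Require Import structures.
From mathcomp Require Import all_boot all_order all_algebra.
From mathcomp Require Import complex.
From mathcomp Require Import all_classical all_reals all_analysis.
From mathcomp Require Import zify ring lra.

Set Implicit Arguments.
Unset Strict Implicit.
Unset Printing Implicit Defensive.

Import Order.TTheory GRing.Theory Num.Theory.
Import numFieldNormedType.Exports.

Local Open Scope classical_set_scope.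
Local Open Scope ring_scope.

(* All estimates are made on Fourier coefficients. Since sigma is large and
   [v] is bounded in H^sigma, the coefficients of [v], and of the finitely many
   derivatives of [v] that occur, decay as fast as needed uniformly in eps.
   A product with one factor decaying in this way is bounded on H^s.

   The weak equation makes every coefficient of [v] continuously differentiable
   on ]0, T[, and in the fast time tau = t / eps it reads
   dv/dtau = - (eps S + L v), with S = W(v) dx v and L = i|D|^alpha + chi.
   The terms u_k of both energies satisfy du_k/dtau = - (eps S_k + L u_k), where
   Re <L u, u> >= 0, so d|u_k|^2/dt <= |u_k|^2 + |S_k|^2. As S_k is quadratic in
   [v], no commutator estimate is required:
   - alpha = 3/2, u_k = (d/dtau)^k v: S_k is a sum of products W(u_i) dx u_j, which
     the bound on dx u_j and the L^2 continuity of W control by the sum of the |u_i|;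
   - alpha = 1/2, u_k = L^k v: |S_k| = |L^k (W(v) dx v)| is bounded by the H^2 norm
     of W(v), hence of [v], which the ellipticity of L controls by the sum of the
     |L^j v| for j <= 4. *)

Local Open Scope complex_scope.

(** The obstacle is the factor 1/eps in front of an operator which, because of the cutoff, does not
    commute with d/dx: differentiating the equation in x would leave a commutator of size 1/eps.
    Fast-time derivatives and powers of L do commute with the linear part, so that the S_k are the
    only sources. In fast time a source carries a factor eps, and the return to t multiplies the
    derivative of the energy by 1/eps; the two cancel, and uniformity in eps comes from there. No
    eps is hidden in S, because linear scaling turns [Weps W eps v] into W(v). In each product one
    factor is absorbed into a constant depending on M and the other is kept in L^2 or H^2, which
    makes the right-hand side linear in the energy. Regularity is counted in integer powers of
    decay: L is charged two powers for either alpha, the transport term one, and the passage from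
    decay to a Sobolev norm one. The threshold 20 leaves room for these losses along four powers of
    L or three fast-time derivatives. *)

Local Notation normc := ComplexField.Normc.normc.

(** * Series indexed by the integers *)

Section partial_sums.
Variable V : zmodType.
Implicit Types (f g : int -> V) (N : nat).

(** The ranges are symmetric because [fun_of] is a limit of symmetric sums: [fourier_sum] is a
    [zpart] by conversion. *)
Definition zpart f N : V := \sum_(k < N.*2.+1) f (k%:Z - N%:Z).

Definition zrange N : seq int := [seq k%:Z - N%:Z | k <- iota 0 N.*2.+1].

Lemma zpartE f N : zpart f N = \sum_(n <- zrange N) f n.
Proof. by rewrite /zpart /zrange big_map -(big_mkord xpredT (fun k => f (k%:Z - N%:Z))) /index_iota subn0. Qed.

Lemma mem_zrange N n : (n \in zrange N) = (`|n| <= N)%N.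
Proof.
apply/mapP/idP => [[k]|nN]; first by rewrite mem_iota => /andP[_ kN] ->; lia.
exists (absz (n + N%:Z)); last by lia.
by rewrite mem_iota; lia.
Qed.

Lemma zrange_uniq N : uniq (zrange N).
Proof. by rewrite map_inj_uniq ?iota_uniq// => i j; lia. Qed.

Lemma zpart0 f : zpart f 0 = f 0.
Proof. by rewrite /zpart big_ord1. Qed.

Lemma zpartS f N : zpart f N.+1 = f (- N.+1%:Z) + zpart f N + f N.+1%:Z.
Proof.
rewrite /zpart doubleS big_ord_recl big_ord_recr /= addrA; congr (f _ + _ + f _).
- by lia.
- by apply: eq_bigr => i _; congr f; rewrite /bump/=; lia.
- by rewrite /bump/=; lia.
Qed.

Lemma zpartD f g N : zpart (fun n => f n + g n) N = zpart f N + zpart g N.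
Proof. by rewrite /zpart big_split. Qed.

Lemma zpart_opp f N : zpart (fun n => f (- n)) N = zpart f N.
Proof.
elim: N => [|N IH]; first by rewrite !zpart0 oppr0.
by rewrite !zpartS IH opprK addrC [f _ + zpart _ _]addrC addrA.
Qed.

End partial_sums.

Lemma cvg_le_near (R : realType) (T : Type) (F : set_system T)
    (FF : ProperFilter F) (f : T -> R) (l a : R) :
  f x @[x --> F] --> l -> (\forall x \near F, f x <= a) -> l <= a.
Proof.
move=> fl fa; rewrite -(cvg_lim _ fl)//; apply: limr_le => //; exact: cvgP fl.
Qed.

(** The two points come in either order, since the difference quotients to be bounded have
    increments of both signs. *)
Lemma MVT_diff (R : realType) (a b : R) (f df : R -> R) :
  (forall r, r \in `]a, b[ -> is_derive r 1 f (df r)) ->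
  forall x y, x \in `]a, b[ -> y \in `]a, b[ ->
  exists2 c, c \in `]a, b[ & f x - f y = df c * (x - y).
Proof.
move=> fdf.
have H x y : x \in `]a, b[ -> y \in `]a, b[ -> x <= y ->
  exists2 c, c \in `]a, b[ & f y - f x = df c * (y - x).
  rewrite !in_itv/= => /andP[ax xb] /andP[ay yb] xy.
  have sub r : x <= r -> r <= y -> r \in `]a, b[.
    by move=> xr ry; rewrite in_itv/=; apply/andP; split; lra.
  have fd r : r \in `]x, y[ -> is_derive r 1 f (df r).
    by rewrite in_itv/= => /andP[? ?]; apply/fdf/sub; exact: ltW.
  have fc : {within `[x, y], continuous f}.
    apply: derivable_within_continuous => r; rewrite in_itv/= => /andP[? ?].
    by have [] := fdf r (sub _ _ _).
  have [c] := MVT_segment xy fd fc.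
  by rewrite in_itv/= => /andP[? ?] ->; exists c => //; apply: sub.
move=> x y xab yab; have [xy|/ltW yx] := leP x y.
  by have [c cab E] := H _ _ xab yab xy; exists c => //; lra.
exact: H.
Qed.

Lemma near_dnbhs_shift (R : realType) (P : R -> Prop) (t : R) :
  (\forall r \near t, P r) -> \forall h \near 0^', P (t + h).
Proof.
move=> Pt; apply: cvg_within.
have c0 : (t + h) @[h --> (0 : R)] --> t.
  by rewrite -[X in _ --> X]addr0; apply: cvgD; [exact: cvg_cst|exact: cvg_id].
exact: (c0 _ Pt).
Qed.

Section series.
Variable R : realType.
Implicit Types (f g M : int -> R) (N : nat).

(** Absolute summability is encoded as a bound on the partial sums: every estimate yields one, and
    convergence follows from it. Statements about [zsum] rest on this predicate, since [limn] is
    total. *)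
Definition zsummable f := exists B : R, forall N, zpart (fun n => `|f n|) N <= B.

Definition zsum f : R := limn (zpart f).

Lemma le_zpart f g N : (forall n, f n <= g n) -> zpart f N <= zpart g N.
Proof. by move=> fg; apply: ler_sum. Qed.

Lemma zpart_ge0 f N : (forall n, 0 <= f n) -> 0 <= zpart f N.
Proof. by move=> f0; apply: sumr_ge0. Qed.

Lemma zpartZ a f N : zpart (fun n => a * f n) N = a * zpart f N.
Proof. by rewrite /zpart mulr_sumr. Qed.

Lemma zpart_mono f : (forall n, 0 <= f n) ->
  {homo zpart f : m n / (m <= n)%N >-> m <= n}.
Proof.
move=> f0; apply: homo_leq => //; first exact: le_trans.
by move=> m; rewrite zpartS addrAC lerDr addr_ge0.
Qed.

Lemma sub_le_zpart f (s : seq int) N : (forall n, 0 <= f n) -> uniq s ->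
  {subset s <= zrange N} -> \sum_(n <- s) f n <= zpart f N.
Proof.
move=> f0 us sN; rewrite zpartE.
rewrite [leLHS](perm_big [seq n <- zrange N | n \in s]).
  by rewrite big_filter [leRHS](bigID (mem s)) lerDl sumr_ge0.
apply: uniq_perm => //; first exact/filter_uniq/zrange_uniq.
move=> n; rewrite mem_filter; case: (boolP (n \in s)) => //= /sN ->//.
Qed.

Lemma zsummable_le f g : (forall n, `|f n| <= g n) -> zsummable g -> zsummable f.
Proof.
move=> fg [B gB]; exists B => N; apply: le_trans (gB N); apply: le_zpart => n.
by rewrite (le_trans (fg n)) ?ler_norm.
Qed.

Lemma zsummable_norm f : zsummable f -> zsummable (fun n => `|f n|).
Proof. by case=> B fB; exists B => N; under eq_fun do rewrite normr_id. Qed.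

Lemma zsummableD f g : zsummable f -> zsummable g -> zsummable (fun n => f n + g n).
Proof.
move=> [B fB] [C gC]; exists (B + C) => N; apply: le_trans (lerD (fB N) (gC N)).
by rewrite -zpartD; apply: le_zpart => n; exact: ler_normD.
Qed.

Lemma zsummableZ a f : zsummable f -> zsummable (fun n => a * f n).
Proof.
move=> [B fB]; exists (`|a| * B) => N.
under eq_fun do rewrite normrM.
by rewrite zpartZ ler_wpM2l.
Qed.

Lemma zsummableN f : zsummable f -> zsummable (fun n => - f n).
Proof. by move=> [B fB]; exists B => N; under eq_fun do rewrite normrN. Qed.

Lemma zsummable_cvg f : zsummable f -> cvgn (zpart f).
Proof.
have H g : (forall n, 0 <= g n) -> zsummable g -> cvgn (zpart g).
  move=> g0 [B gB]; apply: nondecreasing_is_cvgn; first exact: zpart_mono.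
  exists B => _ [N _ <-]; apply: le_trans (gB N); apply: le_zpart => n.
  exact: ler_norm.
move=> sf.
(* A difference of two nonnegative families, whose partial sums are monotone and bounded. *)
have -> : zpart f = (fun N => zpart (fun n => f n + `|f n|) N - zpart (fun n => `|f n|) N).
  by apply/funext => N; rewrite zpartD addrK.
apply: is_cvgB; apply: H => //; last exact: zsummable_norm.
- move=> n; have := ler_norm (- f n); rewrite normrN; lra.
- exact/zsummableD/zsummable_norm.
Qed.

Lemma zsumP f : zsummable f -> zpart f @ \oo --> zsum f.
Proof. exact: zsummable_cvg. Qed.

Lemma zsum_eq f l : zpart f @ \oo --> l -> zsum f = l.
Proof. exact: cvg_lim. Qed.

Lemma zpart_le_zsum f N : (forall n, 0 <= f n) -> zsummable f -> zpart f N <= zsum f.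
Proof.
by move=> f0 sf; apply: nondecreasing_cvgn_le; [exact: zpart_mono|exact: zsummable_cvg].
Qed.

Lemma zsum_le_bound f B : zsummable f -> (forall N, zpart f N <= B) -> zsum f <= B.
Proof. by move=> sf fB; apply: limr_le; [exact: zsummable_cvg|near=> N]. Unshelve. all: by end_near. Qed.

Lemma zsumD f g : zsummable f -> zsummable g ->
  zsum (fun n => f n + g n) = zsum f + zsum g.
Proof.
move=> sf sg; apply: zsum_eq; rewrite (_ : zpart _ = zpart f \+ zpart g).
  by apply: cvgD; exact: zsumP.
by apply/funext => N; rewrite zpartD.
Qed.

Lemma zsumZ a f : zsummable f -> zsum (fun n => a * f n) = a * zsum f.
Proof.
move=> sf; apply: zsum_eq; rewrite (_ : zpart _ = fun N => a * zpart f N).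
  by apply: cvgM; [exact: cvg_cst|exact: zsumP].
by apply/funext => N; rewrite zpartZ.
Qed.

Lemma zsumN f : zsummable f -> zsum (fun n => - f n) = - zsum f.
Proof. by move=> /(zsumZ (-1)); under eq_fun do rewrite mulN1r; rewrite mulN1r. Qed.

Lemma zsumB f g : zsummable f -> zsummable g ->
  zsum (fun n => f n - g n) = zsum f - zsum g.
Proof. by move=> sf sg; rewrite zsumD ?zsumN//; exact: zsummableN. Qed.

Lemma le_zsum f g : zsummable f -> zsummable g -> (forall n, f n <= g n) ->
  zsum f <= zsum g.
Proof.
move=> sf sg fg; apply: ler_lim; [exact: zsummable_cvg..|].
by apply: nearW => N; exact: le_zpart.
Qed.

Lemma zsum_ge0 f : zsummable f -> (forall n, 0 <= f n) -> 0 <= zsum f.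
Proof. by move=> sf f0; apply: le_trans (zpart_le_zsum 0 f0 sf); rewrite zpart_ge0. Qed.

Lemma term_le_zsum f n : (forall n, 0 <= f n) -> zsummable f -> f n <= zsum f.
Proof.
move=> f0 sf; apply: le_trans (zpart_le_zsum `|n|%N f0 sf).
have -> : f n = \sum_(k <- [:: n]) f k by rewrite big_seq1.
by apply: sub_le_zpart => // k; rewrite inE => /eqP ->; rewrite mem_zrange.
Qed.

Lemma ler_norm_zsum f : zsummable f -> `|zsum f| <= zsum (fun n => `|f n|).
Proof.
move=> sf; rewrite ler_norml -zsumN; last exact: zsummable_norm.
have [sN sn] := (zsummableN (zsummable_norm sf), zsummable_norm sf).
by apply/andP; split; apply: le_zsum => // n; [rewrite lerNl -normrN|]; exact: ler_norm.
Qed.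

(** An injection sends a range to finitely many distinct indices, which lie in a larger range. This
    handles the shifts k -> n - k, which do not preserve symmetric ranges. *)
Lemma zpart_inj_le f (h : int -> int) N : injective h -> (forall n, 0 <= f n) ->
  zsummable f -> zpart (fun n => f (h n)) N <= zsum f.
Proof.
move=> hi f0 sf; rewrite zpartE.
set s := map h (zrange N).
have -> : \sum_(n <- zrange N) f (h n) = \sum_(n <- s) f n by rewrite /s [RHS]big_map.
pose K := (\max_(n <- s) `|n|)%N.
apply: le_trans (zpart_le_zsum K f0 sf); apply: sub_le_zpart => //.
  by rewrite map_inj_uniq ?zrange_uniq.
by move=> n ns; rewrite mem_zrange; apply: (@leq_bigmax_seq _ _ _ (fun n : int => `|n|%N)).
Qed.

Lemma zsummable_inj f (h : int -> int) : injective h ->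
  zsummable f -> zsummable (fun n => f (h n)).
Proof.
move=> hi sf; exists (zsum (fun n => `|f n|)) => N.
exact: (@zpart_inj_le (fun n => `|f n|) h N hi _ (zsummable_norm sf)).
Qed.

Lemma zsum_inj_le f (h : int -> int) : injective h -> (forall n, 0 <= f n) ->
  zsummable f -> zsum (fun n => f (h n)) <= zsum f.
Proof.
move=> hi f0 sf; apply: zsum_le_bound; first exact: zsummable_inj.
by move=> N; apply: zpart_inj_le.
Qed.

Lemma zsum_tail f M N : zsummable M -> (forall n, `|f n| <= M n) ->
  `|zsum f - zpart f N| <= zsum M - zpart M N.
Proof.
move=> sM fM; have sf := zsummable_le fM sM.
have M0 n : 0 <= M n by exact: le_trans (fM n).
have H K : (N <= K)%N -> `|zpart f K - zpart f N| <= zsum M - zpart M N.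
  move=> NK; apply: (@le_trans _ _ (zpart M K - zpart M N)); last first.
    by rewrite lerD2r zpart_le_zsum.
  rewrite -(subnKC NK); elim: (K - N)%N => [|j IH].
    by rewrite addn0 !subrr normr0.
  rewrite addnS !zpartS.
  have := fM (- (N + j).+1%:Z); have := fM (N + j).+1%:Z.
  have := ler_normD (f (- (N + j).+1%:Z) + (zpart f (N + j) - zpart f N)) (f (N + j).+1%:Z).
  have := ler_normD (f (- (N + j).+1%:Z)) (zpart f (N + j) - zpart f N).
  rewrite !addrA [_ + f _ - zpart f N]addrAC.
  lra.
have cf : `|zpart f K - zpart f N| @[K --> \oo] --> `|zsum f - zpart f N|.
  by apply: cvg_norm; apply: cvgB; [exact: zsumP|exact: cvg_cst].
apply: (cvg_le_near _ cf).
by near=> K; apply: H; near: K; exists N.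
Unshelve. all: by end_near. Qed.

(** Tannery's theorem along any filter: cut where the tail of [M] is below e/4; both tails are then
    small and only a finite sum has to converge. The filter is general so as to cover continuity in
    time or space as well as difference quotients. *)
Lemma zsum_cvg_dominated (T : Type) (F : set_system T) (FF : ProperFilter F)
    (f : T -> int -> R) g M :
  zsummable M -> (\forall x \near F, forall n, `|f x n| <= M n) ->
  (forall n, f x n @[x --> F] --> g n) ->
  zsum (f x) @[x --> F] --> zsum g.
Proof.
move=> sM fM fg.
have gM n : `|g n| <= M n.
  apply: (cvg_le_near _ (cvg_norm (fg n))).
  by apply: filterS fM => x; apply.
apply/cvgrPdist_le => e e0.
have e4 : 0 < e / 4 by rewrite divr_gt0.
have /cvgrPdist_le/(_ _ e4)[N _ /(_ N (leqnn _))] := zsumP sM.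
have tail0 : 0 <= zsum M - zpart M N.
  by rewrite subr_ge0 zpart_le_zsum// => n; exact: le_trans (gM n).
rewrite (ger0_norm tail0) => tN.
have cN : zpart (f x) N @[x --> F] --> zpart g N.
  elim: N {tN tail0} => [|K IH].
    by rewrite zpart0; under eq_fun do rewrite zpart0; exact: fg.
  rewrite zpartS; under eq_fun do rewrite zpartS.
  by apply: cvgD; [apply: cvgD => //|]; exact: fg.
have /cvgrPdist_le/(_ _ e4) cN' := cN.
near=> x.
have h1 : `|zsum (f x) - zpart (f x) N| <= e / 4.
  by apply: le_trans tN; apply: zsum_tail => //; near: x.
have h2 : `|zsum g - zpart g N| <= e / 4 by apply: le_trans tN; apply: zsum_tail.
have h3 : `|zpart g N - zpart (f x) N| <= e / 4 by near: x.
move: h1 h2 h3; rewrite !ler_norml; lra.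
Unshelve. all: by end_near. Qed.

(** Dominated convergence for the difference quotients: by the mean value theorem each of them is a
    value of [df], hence at most [M n]. *)
Lemma is_derive_zsum (a b : R) (f df : R -> int -> R) M : zsummable M ->
  (forall r, r \in `]a, b[ -> zsummable (f r)) ->
  (forall r n, r \in `]a, b[ -> is_derive r 1 (f^~ n) (df r n)) ->
  (forall r n, r \in `]a, b[ -> `|df r n| <= M n) ->
  forall t, t \in `]a, b[ -> is_derive t 1 (fun r => zsum (f r)) (zsum (df t)).
Proof.
move=> sM sf fdf dfM t tab.
have nI := near_dnbhs_shift (near_in_itvoo tab).
have key : h^-1 *: (zsum (f (h *: 1 + t)) - zsum (f t)) @[h --> 0^'] --> zsum (df t).
  have : zsum (fun n => h^-1 *: (f (h *: 1 + t) n - f t n)) @[h --> 0^'] --> zsum (df t).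
    apply: (@zsum_cvg_dominated _ _ _ _ _ M sM); last first.
      by move=> n; have [] := fdf t n tab; move=> d <-; exact: d.
    near=> h.
    move=> n; rewrite [h *: 1]mulr1.
    have h0 : h != 0 by near: h; exact: nbhs_dnbhs_neq.
    have htab : h + t \in `]a, b[ by rewrite addrC; near: h.
    have [c cab] := MVT_diff (fun r rab => fdf r n rab) htab tab.
    rewrite addrK => ->.
    rewrite /GRing.scale/= [_ * h]mulrC.
    rewrite mulrA mulVf ?mul1r//; exact: dfM.
  apply: cvg_trans; apply: near_eq_cvg.
  near=> h.
  have htab : h + t \in `]a, b[ by rewrite addrC; near: h.
  rewrite [h *: 1]mulr1 /GRing.scale/= zsumZ ?zsumB//; [exact: sf..|].
  by apply: zsummableD; [|apply: zsummableN]; exact: sf.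
apply: DeriveDef; first exact: cvgP key.
exact: cvg_lim key.
Unshelve. all: by end_near. Qed.

Lemma esum_zsum f : (forall n, 0 <= f n) -> zsummable f ->
  (\esum_(n in [set: int]) (f n)%:E)%E = (zsum f)%:E.
Proof.
move=> f0 sf; apply/eqP; rewrite eq_le; apply/andP; split.
  apply: ge_ereal_sup => _ [A [fA _] <-].
  rewrite fsbig_finite//= sumEFin lee_fin.
  pose K := (\max_(n <- finmap.enum_fset (fset_set A)) `|n|)%N.
  apply: le_trans (zpart_le_zsum K f0 sf); apply: sub_le_zpart => //; first exact: finmap.fset_uniq.
  by move=> n ns; rewrite mem_zrange; apply: (@leq_bigmax_seq _ _ _ (fun n : int => `|n|%N)).
have H N : ((zpart f N)%:E <= \esum_(n in [set: int]) (f n)%:E)%E.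
  apply: esum_ge; exists [set` zrange N]; first by split => //; exact: finite_seq.
  by rewrite -fsbig_seq ?zrange_uniq// sumEFin zpartE.
move: H; case: (esum _ _) => [r| |] H.
- by rewrite lee_fin; apply: zsum_le_bound => // N; rewrite -lee_fin.
- by rewrite leey.
- by have := H 0%N.
Qed.

Lemma esum_lty_zsummable f : (forall n, 0 <= f n) ->
  (\esum_(n in [set: int]) (f n)%:E < +oo)%E -> zsummable f.
Proof.
move=> f0.
have H N : ((zpart f N)%:E <= \esum_(n in [set: int]) (f n)%:E)%E.
  apply: esum_ge; exists [set` zrange N]; first by split => //; exact: finite_seq.
  by rewrite -fsbig_seq ?zrange_uniq// sumEFin zpartE.
move: H; case: (esum _ _) => [r| |] H // _; last by have := H 0%N.
exists r => N; rewrite -lee_fin (_ : (fun n => `|f n|) = f) //.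
by apply/funext => n; rewrite ger0_norm.
Qed.

(* Cauchy-Schwarz for the measure [a]. *)
Lemma zsum_sqr_le (a c : int -> R) (A : R) : (forall n, 0 <= a n) -> 0 < A ->
  zsummable a -> zsum a <= A ->
  zsummable (fun n => a n * c n) -> zsummable (fun n => a n * c n ^+ 2) ->
  zsum (fun n => a n * c n) ^+ 2 <= A * zsum (fun n => a n * c n ^+ 2).
Proof.
move=> a0 A0 sa aA s1 s2; set D := zsum _; set Q := zsum _.
(* The minimiser of Q - 2 l D + l^2 A; the sum of [a n * (c n - l) ^+ 2] is nonnegative and at most
   this quantity. *)
pose l := D / A.
have : 0 <= zsum (fun n => a n * c n ^+ 2 - 2 * l * (a n * c n) + l ^+ 2 * a n).
  apply: zsum_ge0.
    by apply: zsummableD; [apply: zsummableD => //; apply: zsummableN|]; exact: zsummableZ.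
  move=> n; rewrite (_ : _ + _ = a n * (c n - l) ^+ 2); last by ring.
  by rewrite mulr_ge0 ?sqr_ge0.
rewrite zsumD ?zsumB ?zsumZ -/D -/Q//; [|by [exact: zsummableZ|apply: zsummableD => //; apply: zsummableN; exact: zsummableZ]..].
have lA : l * A = D by rewrite /l divfK ?gt_eqF.
rewrite -lA => H.
have l2 := sqr_ge0 l.
have : l ^+ 2 * zsum a <= l ^+ 2 * A by rewrite ler_wpM2l.
move: H; rewrite (_ : 2 * l * (l * A) = 2 * (l ^+ 2 * A)); last by ring.
rewrite (_ : (l * A) ^+ 2 = A * (l ^+ 2 * A)); last by ring.
by move=> ? ?; rewrite ler_pM2l//; lra.
Qed.

End series.

(** * Complex series, weights and decaying coefficient families *)

Section complex_modulus.
Variable R : realType.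
Implicit Types (z w : R[i]) (x : R).

Lemma normc_ge0 z : 0 <= normc z.
Proof. by case: z => a b; exact: sqrtr_ge0. Qed.

Lemma sqr_normcE z : normc z ^+ 2 = complex.Re z ^+ 2 + complex.Im z ^+ 2.
Proof. by case: z => a b /=; rewrite sqr_sqrtr// addr_ge0 ?sqr_ge0. Qed.

Lemma normr_Re_le z : `|complex.Re z| <= normc z.
Proof.
rewrite -(ler_pXn2r (n := 2)) ?nnegrE ?normc_ge0// sqr_normcE real_normK ?num_real//.
by rewrite lerDl sqr_ge0.
Qed.

Lemma normr_Im_le z : `|complex.Im z| <= normc z.
Proof.
rewrite -(ler_pXn2r (n := 2)) ?nnegrE ?normc_ge0// sqr_normcE real_normK ?num_real//.
by rewrite lerDr sqr_ge0.
Qed.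

Lemma normc_le_ReIm z : normc z <= `|complex.Re z| + `|complex.Im z|.
Proof.
rewrite -(ler_pXn2r (n := 2)) ?nnegrE ?normc_ge0 ?addr_ge0// sqr_normcE sqrrD.
rewrite !real_normK ?num_real// -[leRHS]addrA [X in _ <= _ + X]addrC addrA lerDl.
by rewrite mulrn_wge0 ?mulr_ge0.
Qed.

Lemma normcM z w : normc (z * w) = normc z * normc w.
Proof. exact: ComplexField.Normc.normcM. Qed.

Lemma normcD z w : normc (z + w) <= normc z + normc w.
Proof. exact: le_normcD. Qed.

Lemma normcN z : normc (- z) = normc z.
Proof. by case: z => a b /=; rewrite !sqrrN. Qed.

Lemma normc_real x : normc x%:C = `|x|.
Proof. by rewrite /= expr0n/= addr0 sqrtr_sqr. Qed.

Lemma normc_i : normc ('i%C : R[i]) = 1.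
Proof. by rewrite /= expr0n/= expr1n add0r sqrtr1. Qed.

Lemma intrC (n : int) : (n%:~R : R[i]) = (n%:~R : R)%:C.
Proof. by rewrite rmorph_int. Qed.

Lemma normc_conj z : normc (conjc z) = normc z.
Proof. by case: z => a b /=; rewrite sqrrN. Qed.

Lemma normc0 : normc (0 : R[i]) = 0.
Proof. exact: ComplexField.Normc.normc0. Qed.

Lemma ReM z w : complex.Re (z * w) =
  complex.Re z * complex.Re w - complex.Im z * complex.Im w.
Proof. by case: z w => [a b] [c d]. Qed.

Lemma ImM z w : complex.Im (z * w) =
  complex.Re z * complex.Im w + complex.Im z * complex.Re w.
Proof. by case: z w => [a b] [c d]. Qed.

Lemma ReD z w : complex.Re (z + w) = complex.Re z + complex.Re w.
Proof. by case: z w => [a b] [c d]. Qed.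

Lemma ImD z w : complex.Im (z + w) = complex.Im z + complex.Im w.
Proof. by case: z w => [a b] [c d]. Qed.

Lemma ReN z : complex.Re (- z) = - complex.Re z.
Proof. by case: z. Qed.

Lemma ImN z : complex.Im (- z) = - complex.Im z.
Proof. by case: z. Qed.

Lemma complexP z w : complex.Re z = complex.Re w -> complex.Im z = complex.Im w -> z = w.
Proof. by case: z w => [a b] [c d] /= -> ->. Qed.

End complex_modulus.

Section complex_series.
Variable R : realType.
Implicit Types (f g : int -> R[i]).

Definition csummable f := zsummable (fun n => normc (f n)).

Definition csum f : R[i] :=
  zsum (fun n => complex.Re (f n)) +i* zsum (fun n => complex.Im (f n)).

Lemma csummable_Re f : csummable f -> zsummable (fun n => complex.Re (f n)).
Proof. by apply: zsummable_le => n; exact: normr_Re_le. Qed.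

Lemma csummable_Im f : csummable f -> zsummable (fun n => complex.Im (f n)).
Proof. by apply: zsummable_le => n; exact: normr_Im_le. Qed.

Lemma csummable_le f (g : int -> R) :
  (forall n, normc (f n) <= g n) -> zsummable g -> csummable f.
Proof. by move=> fg; apply: zsummable_le => n; rewrite ger0_norm ?normc_ge0. Qed.

Lemma csummableZ a f : csummable f -> csummable (fun n => a * f n).
Proof.
move=> /(zsummableZ (normc a)); apply: csummable_le => n.
by rewrite normcM.
Qed.

(** The factor 2 comes from estimating the real and the imaginary parts separately; it reappears in
    [conv_const] and [wsq_conv_const]. *)
Lemma normc_csum f : csummable f -> normc (csum f) <= 2 * zsum (fun n => normc (f n)).
Proof.
move=> sf; apply: le_trans (normc_le_ReIm _) _ => /=.
have [sR sI] := (csummable_Re sf, csummable_Im sf).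
rewrite mulr_natl mulr2n; apply: lerD; (apply: le_trans (ler_norm_zsum _) _ => //);
  (apply: le_zsum => //; first exact: zsummable_norm) => n.
- exact: normr_Re_le.
- exact: normr_Im_le.
Qed.

Lemma csumD f g : csummable f -> csummable g ->
  csum (fun n => f n + g n) = csum f + csum g.
Proof.
move=> sf sg; apply: complexP; rewrite ?ReD ?ImD /csum /=.
  under eq_fun do rewrite ReD; rewrite zsumD//; exact: csummable_Re.
under eq_fun do rewrite ImD; rewrite zsumD//; exact: csummable_Im.
Qed.

Lemma csumZ a f : csummable f -> csum (fun n => a * f n) = a * csum f.
Proof.
move=> sf; have [sR sI] := (csummable_Re sf, csummable_Im sf).
apply: complexP; rewrite ?ReM ?ImM /csum /=.
  under eq_fun do rewrite ReM; rewrite zsumB ?zsumZ//; exact: zsummableZ.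
under eq_fun do rewrite ImM; rewrite zsumD ?zsumZ//; exact: zsummableZ.
Qed.

Lemma csum_opp f : csum (fun n => f (- n)) = csum f.
Proof.
have H (h : int -> R) : zsum (fun n => h (- n)) = zsum h.
  by rewrite /zsum; congr (limn _); apply/funext => N; exact: zpart_opp.
by rewrite /csum (H (fun n => complex.Re (f n))) (H (fun n => complex.Im (f n))).
Qed.

Lemma zpart_zsum (F : int -> int -> R) N : (forall n, zsummable (F n)) ->
  zpart (fun n => zsum (F n)) N = zsum (fun k => zpart (F^~ k) N)
  /\ zsummable (fun k => zpart (F^~ k) N).
Proof.
move=> sF; elim: N => [|N [IH sN]].
  have -> : (fun k => zpart (F^~ k) 0) = F 0 by apply/funext => k; rewrite zpart0.
  by rewrite zpart0.
have -> : (fun k => zpart (F^~ k) N.+1) =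
    (fun k => F (- N.+1%:Z) k + zpart (F^~ k) N + F N.+1%:Z k).
  by apply/funext => k; rewrite zpartS.
by rewrite zpartS IH; split; [rewrite !zsumD//|]; do ?apply: zsummableD.
Qed.

End complex_series.

(** * The weight <n> and the summability of <n>^-2 *)

Section bracket.
Variable R : realType.
Implicit Types (n m : int) (p q : nat).
Local Notation br := (@bracket R).

Lemma bracket_ge1 n : 1 <= br n.
Proof. by rewrite -[leLHS]sqrtr1 ler_wsqrtr// lerDl sqr_ge0. Qed.

Lemma bracket_gt0 n : 0 < br n.
Proof. by rewrite (lt_le_trans _ (bracket_ge1 n)). Qed.

Lemma bracketN n : br (- n) = br n.
Proof. by rewrite /bracket mulrNz sqrrN. Qed.

Lemma sqr_bracket n : br n ^+ 2 = 1 + n%:~R ^+ 2.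
Proof. by rewrite sqr_sqrtr// addr_ge0 ?sqr_ge0. Qed.

Lemma norm_le_bracket n : `|n%:~R : R| <= br n.
Proof.
rewrite -(ler_pXn2r (n := 2)) ?nnegrE ?(ltW (bracket_gt0 _))// sqr_bracket.
by rewrite real_normK ?num_real// lerDr.
Qed.

Lemma bracket_le1D n : br n <= 1 + `|n%:~R|.
Proof.
rewrite -(ler_pXn2r (n := 2)) ?nnegrE ?(ltW (bracket_gt0 _)) ?addr_ge0// sqr_bracket.
by rewrite sqrrD expr1n mul1r real_normK ?num_real// lerD2r lerDl mulrn_wge0.
Qed.

Lemma bracketD_le n m : br (n + m) <= br n + br m.
Proof.
have n0 := bracket_gt0 n; have m0 := bracket_gt0 m.
rewrite -(ler_pXn2r (n := 2)) ?nnegrE ?(ltW (bracket_gt0 _)) ?addr_ge0 ?ltW//.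
rewrite sqrrD !sqr_bracket intrD sqrrD.
have : n%:~R * m%:~R <= br n * br m.
  apply: le_trans (ler_norm _) _; rewrite normrM.
  by apply: ler_pM => //; exact: norm_le_bracket.
lra.
Qed.

(** Since both brackets are at least 1, their sum is at most twice their product. This
    multiplicative form is the source of Peetre's inequality in [conv_wsq]. *)
Lemma bracketD_leM n m : br (n + m) <= 2 * (br n * br m).
Proof.
apply: le_trans (bracketD_le n m) _.
have := bracket_ge1 n; have := bracket_ge1 m; nra.
Qed.

Lemma bracketX_ge1 p n : 1 <= br n ^+ p.
Proof. exact/exprn_ege1/bracket_ge1. Qed.

Lemma bracketX_gt0 p n : 0 < br n ^+ p.
Proof. exact/exprn_gt0/bracket_gt0. Qed.

Lemma bracketXD_le p n m : br (n + m) ^+ p <= 2 ^+ p * (br n ^+ p + br m ^+ p).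
Proof.
have [n0 m0] := (ltW (bracket_gt0 n), ltW (bracket_gt0 m)).
wlog nm : n m n0 m0 / br n <= br m.
  move=> H; have [|/ltW] := leP (br n) (br m); first exact: H.
  by move=> h; rewrite addrC [X in _ * X]addrC; exact: H.
apply: (@le_trans _ _ ((2 * br m) ^+ p)).
  rewrite lerXn2r ?nnegrE ?(ltW (bracket_gt0 _)) ?mulr_ge0//.
  by apply: le_trans (bracketD_le n m) _; lra.
by rewrite exprMn ler_wpM2l ?exprn_ge0// lerDr exprn_ge0.
Qed.

Lemma zsummable_bracket : zsummable (fun n => br n ^- 2).
Proof.
(* The claim is strengthened so as to telescope: with m = N + 1 the two new terms add 2 / (1 + m^2),
   which is at most 4 / m - 4 / (m + 1). At N = 0 it is an equality. *)
exists 5 => N; apply: (@le_trans _ _ (5 - 4 / N.+1%:R)); last first.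
  by rewrite lerBlDr lerDl divr_ge0.
under eq_fun do rewrite ger0_norm ?invr_ge0 ?exprn_ge0 ?ltW ?bracket_gt0//.
elim: N => [|N IH].
  by rewrite zpart0 sqr_bracket expr0n/= addr0 invr1; lra.
rewrite zpartS bracketN sqr_bracket.
have -> : (N.+1%:Z%:~R : R) = N.+1%:R by [].
have e2 : (N.+2%:R : R) = N.+1%:R + 1 by rewrite -natr1.
rewrite e2; move: IH; set m : R := N.+1%:R.
have m1 : 1 <= m by rewrite /m ler1n.
set z := zpart _ _ => IH.
have : 2 * (1 + m ^+ 2)^-1 <= 4 / m - 4 / (m + 1).
  rewrite (_ : 4 / m - 4 / (m + 1) = 4 / (m * (m + 1))); last by field; apply/andP; split; lra.
  rewrite ler_pdivlMr; last by nra.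
  rewrite mulrAC ler_pdivrMr; last by nra.
  nra.
move: IH; set x := 4 / m; set y := 4 / (m + 1); set v := (_ + _)^-1; lra.
Qed.

Definition bracket_sum : R := zsum (fun n => br n ^- 2).

Lemma bracket_sum_ge1 : 1 <= bracket_sum.
Proof.
have /= := @term_le_zsum R (fun n => br n ^- 2) 0 _ zsummable_bracket.
rewrite sqr_bracket expr0n/= addr0 invr1; apply => n.
by rewrite invr_ge0 ltW ?bracketX_gt0.
Qed.

End bracket.

(** * Pointwise decay of coefficients and convolution *)

Section decay.
Variable R : realType.
Implicit Types (u w : distr R) (p q : nat) (B C : R) (n : int).
Local Notation br := (@bracket R).

(** A weighted sup bound, with the constant explicit so that its dependence on eps can be followed.
    It compares with Sobolev norms in both directions: H^s with s >= p gives [decay p], and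
    [decay q.+1] gives H^s for s <= q, the extra power leaving the summable weight <n>^-2. *)
Definition decay p B u := forall n, normc (u n) * br n ^+ p <= B.

Lemma decay_ge0 p B u : decay p B u -> 0 <= B.
Proof.
by move=> /(_ 0); apply: le_trans; rewrite mulr_ge0 ?normc_ge0 ?ltW ?bracketX_gt0.
Qed.

Lemma decay_leB p B C u : B <= C -> decay p B u -> decay p C u.
Proof. by move=> BC du n; exact: le_trans (du n) BC. Qed.

Lemma decay_le p q B u : (q <= p)%N -> decay p B u -> decay q B u.
Proof.
move=> qp du n; apply: le_trans (du n); rewrite ler_wpM2l ?normc_ge0//.
by rewrite ler_weXn2l ?bracket_ge1.
Qed.

Lemma decay_term p B u n : decay p B u -> normc (u n) <= B * br n ^- p.
Proof. by move=> du; rewrite ler_pdivlMr ?bracketX_gt0. Qed.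

Lemma decay_term2 p B u n : (2 <= p)%N -> decay p B u -> normc (u n) <= B * br n ^- 2.
Proof. by move=> p2 /(decay_le p2) /decay_term. Qed.

Lemma decay_summable p B u : (2 <= p)%N -> decay p B u -> csummable u.
Proof.
move=> p2 du; apply: (csummable_le _ (zsummableZ B (zsummable_bracket R))) => n.
exact: decay_term2 p2 du.
Qed.

Lemma decay_zsum p B u : (2 <= p)%N -> decay p B u ->
  zsum (fun n => normc (u n)) <= B * bracket_sum R.
Proof.
move=> p2 du; rewrite -zsumZ; last exact: zsummable_bracket.
apply: le_zsum; [exact: decay_summable du|exact/zsummableZ/zsummable_bracket|].
by move=> n; exact: decay_term2 du.
Qed.

Lemma decayD p B C u w : decay p B u -> decay p C w ->
  decay p (B + C) (fun n => u n + w n).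
Proof.
move=> du dw n; apply: le_trans (lerD (du n) (dw n)); rewrite -mulrDl.
by rewrite ler_wpM2r ?normcD// ltW ?bracketX_gt0.
Qed.

Lemma decayN p B u : decay p B u -> decay p B (fun n => - u n).
Proof. by move=> du n; rewrite normcN. Qed.

Lemma decay_scaled p B u a : decay p B u -> decay p (normc a * B) (scaled a u).
Proof. by move=> du n; rewrite normcM -mulrA ler_wpM2l ?normc_ge0. Qed.

Lemma decay_multiplier p q K B (m : int -> R[i]) u :
  (forall n, normc (m n) <= K * br n ^+ q) -> decay (p + q) B u ->
  decay p (K * B) (multiplier m u).
Proof.
move=> mK du n; rewrite normcM -mulrA.
have K0 : 0 <= K.
  have := le_trans (normc_ge0 _) (mK n).
  by rewrite pmulr_lge0 // bracketX_gt0.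
apply: (@le_trans _ _ (K * br n ^+ q * (normc (u n) * br n ^+ p))).
  by rewrite ler_wpM2r ?mulr_ge0 ?normc_ge0 ?(ltW (bracketX_gt0 _ _ _)).
rewrite -mulrA ler_wpM2l//; apply: le_trans (du n).
by rewrite mulrCA -exprD addnC.
Qed.

Lemma decay_dx p B u : decay p.+1 B u -> decay p B (dx u).
Proof.
move=> du; rewrite -[B]mul1r; apply: (@decay_multiplier p 1) => [n|]; last by rewrite addn1.
rewrite normcM normc_i !mul1r expr1.
by rewrite intrC normc_real norm_le_bracket.
Qed.

Lemma powR_le_bracket a q n : 0 <= a <= q%:R -> `|n%:~R : R| `^ a <= br n ^+ q.
Proof.
move=> /andP[a0 aq]; rewrite -powR_mulrn; last exact: ltW (bracket_gt0 _ _).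
apply: (@le_trans _ _ (br n `^ a)); last by rewrite ler_powR ?bracket_ge1.
by apply: ge0_ler_powR; rewrite ?nnegrE ?(ltW (bracket_gt0 _ _)) ?norm_le_bracket.
Qed.

Lemma decay_absD p q a B u : 0 <= a <= q%:R -> decay (p + q) B u -> decay p B (absD a u).
Proof.
move=> aq du; rewrite -[B]mul1r; apply: decay_multiplier du => n.
by rewrite mul1r normc_real ger0_norm ?powR_ge0// powR_le_bracket.
Qed.

Definition conv u w : distr R := fun n => csum (fun k => u (n - k) * w k).

(** The weight <n>^p is split between <n-k>^p and <k>^p; in each half one factor absorbs the weight
    and the other remains to be summed in k. *)
Lemma decay_conv_term p B C u w n k : decay p B u -> decay p C w ->
  normc (u (n - k) * w k) * br n ^+ p <=
  2 ^+ p * (B * normc (w k) + C * normc (u (n - k))).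
Proof.
move=> du dw; rewrite normcM.
have := bracketXD_le R p (n - k) k; rewrite subrK => H.
have := du (n - k); have := dw k.
have u0 := normc_ge0 (u (n - k)); have w0 := normc_ge0 (w k).
set x := normc (u _) in u0 *; set y := normc (w _) in w0 *.
move=> dwk dun.
apply: (@le_trans _ _ (x * y * (2 ^+ p * (br (n - k) ^+ p + br k ^+ p)))).
  by rewrite ler_wpM2l ?mulr_ge0.
rewrite mulrCA ler_wpM2l ?exprn_ge0//.
move: dwk dun; set b1 := br _ ^+ p; set b2 := br _ ^+ p => dwk dun.
have : (x * b2) * y <= B * y by rewrite ler_wpM2r.
have : (y * b1) * x <= C * x by rewrite ler_wpM2r.
lra.
Qed.

Lemma subr_inj n : injective (fun k : int => n - k).
Proof. by move=> i j /addrI/oppr_inj. Qed.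

Lemma conv_summable p B C u w n : (2 <= p)%N -> decay p B u -> decay p C w ->
  csummable (fun k => u (n - k) * w k).
Proof.
move=> p2 du dw.
have su := zsummable_inj (@subr_inj n) (decay_summable p2 du).
have sw := decay_summable p2 dw.
apply: (csummable_le _ (zsummableZ (2 ^+ p)
  (zsummableD (zsummableZ B sw) (zsummableZ C su)))) => k.
apply: le_trans (decay_conv_term n k du dw).
by rewrite ler_peMr ?normc_ge0// bracketX_ge1.
Qed.

(** The leading 2 is that of [normc_csum], [2 ^+ p] comes from splitting the weight, and each of the
    two factors contributes one [bracket_sum]. *)
Definition conv_const p : R := 2 * 2 ^+ p * (2 * bracket_sum R).

Lemma conv_const_ge0 p : 0 <= conv_const p.
Proof. by rewrite !mulr_ge0 ?exprn_ge0// (le_trans _ (bracket_sum_ge1 R)). Qed.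

Lemma decay_conv p B C u w : (2 <= p)%N -> decay p B u -> decay p C w ->
  decay p (conv_const p * (B * C)) (conv u w).
Proof.
move=> p2 du dw n.
have suw := conv_summable n p2 du dw.
have su := zsummable_inj (@subr_inj n) (decay_summable p2 du).
have sw := decay_summable p2 dw.
apply: (@le_trans _ _ (2 * zsum (fun k => br n ^+ p * normc (u (n - k) * w k)))).
  by rewrite zsumZ// mulrCA [leRHS]mulrC ler_wpM2r ?normc_csum// ltW ?bracketX_gt0.
rewrite /conv_const -!mulrA ler_wpM2l//.
apply: (@le_trans _ _ (zsum (fun k => 2 ^+ p * (B * normc (w k) + C * normc (u (n - k)))))).
  apply: le_zsum; first exact: zsummableZ.
    exact/zsummableZ/zsummableD/zsummableZ/su/zsummableZ/sw.
  by move=> k; rewrite mulrC; exact: decay_conv_term.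
rewrite zsumZ; last by apply: zsummableD; exact: zsummableZ.
rewrite ler_wpM2l ?exprn_ge0// zsumD ?zsumZ//; [|exact: zsummableZ..].
have h1 := decay_zsum p2 dw.
have h2 : zsum (fun k => normc (u (n - k))) <= B * bracket_sum R.
  apply: le_trans (decay_zsum p2 du).
  apply: (@zsum_inj_le _ (fun k => normc (u k)) (fun k => n - k) (@subr_inj n)) => //.
    by move=> k; exact: normc_ge0.
  exact: decay_summable du.
have := ler_wpM2l (decay_ge0 du) h1; have := ler_wpM2l (decay_ge0 dw) h2.
lra.
Qed.

End decay.

(** * Sobolev norms and the map W *)

Section Sobolev_spaces.
Variable R : realType.
Implicit Types (u w : distr R) (s : R) (p q : nat) (B C : R) (n : int).
Local Notation br := (@bracket R).
Local Notation pi := (@pi R).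

Definition wsq s u n : R := br n `^ (2 * s) * normc (u n) ^+ 2.

Lemma wsq_ge0 s u n : 0 <= wsq s u n.
Proof. by rewrite mulr_ge0 ?powR_ge0 ?sqr_ge0. Qed.

Lemma wsq0 u n : wsq 0 u n = normc (u n) ^+ 2.
Proof. by rewrite /wsq mulr0 powRr0 mul1r. Qed.

Lemma twopi_ge1 : 1 <= 2 * pi.
Proof. by have := pi_ge2 R; lra. Qed.

Lemma twopi_gt0 : 0 < 2 * pi.
Proof. exact: lt_le_trans twopi_ge1. Qed.

Lemma SobolevP s u : Sobolev s u <-> zsummable (wsq s u).
Proof.
have e n : 2 * pi * br n `^ (2 * s) * normc (u n) ^+ 2 = (2 * pi) * wsq s u n.
  by rewrite -mulrA.
have g0 n : 0 <= 2 * pi * wsq s u n by rewrite mulr_ge0 ?wsq_ge0// ltW// twopi_gt0.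
rewrite /Sobolev /= /Sobolev_sqnorm; under eq_esum do rewrite e; split.
  move=> /(esum_lty_zsummable g0) /(zsummableZ (2 * pi)^-1).
  by apply: zsummable_le => n; rewrite mulKf ?gt_eqF ?twopi_gt0// ger0_norm ?wsq_ge0.
by move=> /(zsummableZ (2 * pi)) h; rewrite esum_zsum// ltry.
Qed.

Lemma sqr_Sobolev_norm s u : Sobolev s u ->
  Sobolev_norm s u ^+ 2 = 2 * pi * zsum (wsq s u).
Proof.
have e n : 2 * pi * br n `^ (2 * s) * normc (u n) ^+ 2 = (2 * pi) * wsq s u n.
  by rewrite -mulrA.
have g0 n : 0 <= 2 * pi * wsq s u n by rewrite mulr_ge0 ?wsq_ge0// ltW// twopi_gt0.
move=> /SobolevP su; rewrite /Sobolev_norm /Sobolev_sqnorm.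
under eq_esum do rewrite e; rewrite esum_zsum//; last exact: zsummableZ.
by rewrite /= zsumZ// sqr_sqrtr// mulr_ge0 ?(ltW twopi_gt0)// zsum_ge0// => n; exact: wsq_ge0.
Qed.

Lemma Sobolev_norm_ge0 s u : 0 <= Sobolev_norm s u.
Proof. exact: sqrtr_ge0. Qed.

Lemma Sobolev_normE s u : Sobolev s u ->
  Sobolev_norm s u = Num.sqrt (2 * pi * zsum (wsq s u)).
Proof. by move=> su; rewrite -sqr_Sobolev_norm// sqrtr_sqr ger0_norm ?Sobolev_norm_ge0. Qed.

Lemma wsq_le_Sobolev_norm s u n : Sobolev s u -> wsq s u n <= Sobolev_norm s u ^+ 2.
Proof.
move=> su; rewrite sqr_Sobolev_norm//; move/SobolevP in su.
have h := @term_le_zsum R (wsq s u) n (wsq_ge0 s u) su.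
have h0 := wsq_ge0 s u n.
have := twopi_ge1; nra.
Qed.

Lemma wsq_le s s' u n : s <= s' -> wsq s u n <= wsq s' u n.
Proof.
move=> ss'; rewrite ler_wpM2r ?sqr_ge0// ler_powR//; first exact: bracket_ge1.
by rewrite ler_pM2l.
Qed.

Lemma Sobolev_le s s' u : s <= s' -> Sobolev s' u -> Sobolev s u.
Proof.
move=> ss' /SobolevP h; apply/SobolevP; apply: zsummable_le h => n.
by rewrite ger0_norm ?wsq_ge0 ?wsq_le.
Qed.

Lemma Sobolev_norm_le s s' u : s <= s' -> Sobolev s' u -> Sobolev_norm s u <= Sobolev_norm s' u.
Proof.
move=> ss' su; have su' := Sobolev_le ss' su.
rewrite !Sobolev_normE// ler_wsqrtr// ler_wpM2l ?(ltW twopi_gt0)//.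
by apply: le_zsum => [||n]; [exact/SobolevP..|exact: wsq_le].
Qed.

Lemma sqr_normcD (z1 z2 : R[i]) : normc (z1 + z2) ^+ 2 <= 2 * (normc z1 ^+ 2 + normc z2 ^+ 2).
Proof.
rewrite !sqr_normcE ReD ImD.
have := sqr_ge0 (complex.Re z1 - complex.Re z2).
have := sqr_ge0 (complex.Im z1 - complex.Im z2).
by rewrite !expr2; nra.
Qed.

Lemma wsqD s u w n : wsq s (fun m => u m + w m) n <= 2 * (wsq s u n + wsq s w n).
Proof. by rewrite -mulrDr mulrCA ler_wpM2l ?powR_ge0// sqr_normcD. Qed.

Lemma wsqZ s a u n : wsq s (scaled a u) n = normc a ^+ 2 * wsq s u n.
Proof. by rewrite /wsq /scaled normcM exprMn mulrCA. Qed.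

Lemma wsqN s u n : wsq s (fun m => - u m) n = wsq s u n.
Proof. by rewrite /wsq normcN. Qed.

Lemma SobolevD s u w : Sobolev s u -> Sobolev s w -> Sobolev s (fun n => u n + w n).
Proof.
move=> /SobolevP su /SobolevP sw; apply/SobolevP.
apply: zsummable_le (zsummableZ 2 (zsummableD su sw)) => n.
by rewrite ger0_norm ?wsq_ge0 ?wsqD.
Qed.

Lemma SobolevN s u : Sobolev s u -> Sobolev s (fun n => - u n).
Proof. by move=> /SobolevP su; apply/SobolevP; rewrite (_ : wsq _ _ = wsq s u)//; apply/funext => n; exact: wsqN. Qed.

Lemma SobolevB s u w : Sobolev s u -> Sobolev s w -> Sobolev s (u \- w).
Proof. by move=> su /SobolevN; exact: SobolevD. Qed.

Lemma Sobolev_scaled s a u : Sobolev s u -> Sobolev s (scaled a u).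
Proof.
move=> /SobolevP su; apply/SobolevP; rewrite (_ : wsq _ _ = fun n => normc a ^+ 2 * wsq s u n).
  exact: zsummableZ.
by apply/funext => n; exact: wsqZ.
Qed.

Lemma powR_bracket_le s q n : s <= q%:R -> br n `^ (2 * s) <= (br n ^+ q) ^+ 2.
Proof.
move=> sq; rewrite -exprM -powR_mulrn ?(ltW (bracket_gt0 _ _))// ler_powR ?bracket_ge1//.
by rewrite natrM mulrC ler_wpM2r.
Qed.

Lemma powR_bracket_ge s q n : q%:R <= s -> (br n ^+ q) ^+ 2 <= br n `^ (2 * s).
Proof.
move=> sq; rewrite -exprM -powR_mulrn ?(ltW (bracket_gt0 _ _))// ler_powR ?bracket_ge1//.
by rewrite natrM mulrC ler_pM2l.
Qed.

Lemma sqr_powR_bracket s n : (br n `^ s) ^+ 2 = br n `^ (2 * s).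
Proof. by rewrite -(powR_mulrn 2 (powR_ge0 (br n) s)) -powRrM mulrC. Qed.

Lemma wsq_decay_le s q B u n : s <= q%:R -> decay q.+1 B u ->
  wsq s u n <= B ^+ 2 * br n ^- 2.
Proof.
move=> sq du; have n0 := bracket_gt0 R n.
rewrite ler_pdivlMr ?exprn_gt0//.
apply: (@le_trans _ _ ((normc (u n) * br n ^+ q.+1) ^+ 2)).
  have -> : (normc (u n) * br n ^+ q.+1) ^+ 2 = (br n ^+ q) ^+ 2 * normc (u n) ^+ 2 * br n ^+ 2.
    by rewrite (exprS _ q); ring.
  by rewrite ler_wpM2r ?exprn_ge0 ?(ltW n0)// ler_wpM2r ?sqr_ge0 ?powR_bracket_le.
by rewrite lerXn2r ?nnegrE ?mulr_ge0 ?normc_ge0 ?exprn_ge0 ?(ltW n0) ?(decay_ge0 du)//; exact: du.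
Qed.

Lemma Sobolev_decay s q B u : s <= q%:R -> decay q.+1 B u -> Sobolev s u.
Proof.
move=> sq du; apply/SobolevP; apply: zsummable_le (zsummableZ (B ^+ 2) (zsummable_bracket R)) => n.
by rewrite ger0_norm ?wsq_ge0// (wsq_decay_le _ sq du).
Qed.

Lemma zsum_wsq_decay s q B u : s <= q%:R -> decay q.+1 B u ->
  zsum (wsq s u) <= B ^+ 2 * bracket_sum R.
Proof.
move=> sq du; rewrite -zsumZ; last exact: zsummable_bracket.
apply: le_zsum => [||n]; [exact/SobolevP/(Sobolev_decay sq du)|exact/zsummableZ/zsummable_bracket|].
exact: wsq_decay_le sq du.
Qed.

Lemma decay_wsq s p B u : p%:R <= s -> 0 <= B -> (forall n, wsq s u n <= B ^+ 2) ->
  decay p B u.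
Proof.
move=> ps B0 h n; rewrite -(ler_pXn2r (n := 2)) ?nnegrE ?mulr_ge0 ?normc_ge0 ?(ltW (bracketX_gt0 _ _ _))//.
by apply: le_trans (h n); rewrite exprMn mulrC ler_wpM2r ?sqr_ge0 ?powR_bracket_ge.
Qed.

Lemma decay_Sobolev s p B u : p%:R <= s -> Sobolev s u -> Sobolev_norm s u <= B -> decay p B u.
Proof.
move=> ps su uB; have B0 := le_trans (Sobolev_norm_ge0 s u) uB.
apply: (decay_wsq ps B0) => n; apply: le_trans (wsq_le_Sobolev_norm n su) _.
by rewrite lerXn2r ?nnegrE ?Sobolev_norm_ge0 ?B0.
Qed.

Lemma normc_le_Sobolev_norm u n : Sobolev 0 u -> normc (u n) <= Sobolev_norm 0 u.
Proof.
move=> su; have := @decay_Sobolev 0 0 _ u (lexx _) su (lexx _) n.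
by rewrite expr0 mulr1.
Qed.

(** The 2 is that of [normc_csum]; [4 * bracket_sum R], times the decay bound of the convolver,
    bounds the row and column sums in the Schur test. *)
Definition wsq_conv_const : R := (2 * (4 * (bracket_sum R))) ^+ 2.

(* By Peetre's inequality <n>^s <= 4 <n-k>^2 <k>^s it suffices to bound the
   convolution with the summable sequence 4 <m>^2 |a m| on l^2 (Schur test). *)
Lemma conv_wsq s B C a u : 0 <= s <= 2 -> 0 < B -> decay 4 B a -> decay 4 C u ->
  Sobolev s (conv a u) /\
  zsum (wsq s (conv a u)) <= wsq_conv_const * B ^+ 2 * zsum (wsq s u).
Proof.
move=> /andP[s0 s2] B0 da du.
pose al m := 4 * (br m ^+ 2 * normc (a m)).
pose be k := br k `^ s * normc (u k).
pose A := B * (4 * bracket_sum R).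
have A0 : 0 < A by rewrite !mulr_gt0// (lt_le_trans _ (bracket_sum_ge1 R)).
have al0 m : 0 <= al m by rewrite !mulr_ge0 ?normc_ge0// ltW// bracket_gt0.
(* Of the four powers of decay of [a], two pay for Peetre's inequality and two make the kernel
   summable. *)
have alB m : al m <= 4 * B * br m ^- 2.
  rewrite -mulrA ler_pM2l// ler_pdivlMr ?bracketX_gt0// mulrAC -exprD mulrC.
  exact: da.
have sal : zsummable al.
  by apply: zsummable_le (zsummableZ (4 * B) (zsummable_bracket R)) => m; rewrite ger0_norm.
have alA : zsum al <= A.
  rewrite /A mulrCA mulrA -zsumZ; last exact: zsummable_bracket.
  by apply: le_zsum => //; exact/zsummableZ/zsummable_bracket.
have beE k : be k ^+ 2 = wsq s u k.
  by rewrite /be exprMn sqr_powR_bracket.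
have swu : zsummable (wsq s u).
  by apply/SobolevP; exact: (@Sobolev_decay s 2 C u s2 (decay_le _ du)).
have sbe : zsummable (fun k => be k ^+ 2) by under eq_fun do rewrite beE.
have al_le m : al m <= 4 * B.
  apply: le_trans (alB m) _; rewrite ler_piMr ?mulr_ge0 ?(ltW B0)//.
  by rewrite invf_le1 ?bracketX_ge1 ?bracketX_gt0.
have s2k n : zsummable (fun k => al (n - k) * be k ^+ 2).
  apply: zsummable_le (zsummableZ (4 * B) sbe) => k.
  have b2 := sqr_ge0 (be k).
  rewrite ger0_norm; first exact: ler_wpM2r.
  exact: mulr_ge0.
have sa n : zsummable (fun k => al (n - k)) := zsummable_inj (@subr_inj n) sal.
have saA n : zsum (fun k => al (n - k)) <= A.
  by apply: le_trans alA; exact: zsum_inj_le (@subr_inj n) al0 sal.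
have s1k n : zsummable (fun k => al (n - k) * be k).
  apply: zsummable_le (zsummableD (sa n) (s2k n)) => k.
  have b0 : 0 <= be k by rewrite mulr_ge0 ?powR_ge0 ?normc_ge0.
  rewrite ger0_norm; last exact: mulr_ge0.
  rewrite -{2}[al _]mulr1 -mulrDr ler_wpM2l//.
  have := sqr_ge0 (be k - 1); rewrite sqrrB1; nra.
have key n : wsq s (conv a u) n <= 4 * (A * zsum (fun k => al (n - k) * be k ^+ 2)).
  apply: le_trans (ler_wpM2l _ (zsum_sqr_le (fun k => al0 (n - k)) A0 (sa n) (saA n) (s1k n) (s2k n))) => //.
  have sau := conv_summable n (isT : (2 <= 4)%N) da du.
  have h : br n `^ s * normc (conv a u n) <= 2 * zsum (fun k => al (n - k) * be k).
    apply: (@le_trans _ _ (2 * zsum (fun k => br n `^ s * normc (a (n - k) * u k)))).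
      by rewrite zsumZ// mulrCA ler_wpM2l ?powR_ge0// normc_csum.
    rewrite ler_pM2l//; apply: le_zsum => //; first exact: zsummableZ.
    move=> k; rewrite normcM /al /be.
    have : br n `^ s <= 4 * br (n - k) ^+ 2 * br k `^ s.
      have [n0 [nk0 k0]] := (bracket_gt0 R n, (bracket_gt0 R (n - k), bracket_gt0 R k)).
      apply: (@le_trans _ _ ((2 * (br (n - k) * br k)) `^ s)).
        have H2 := bracketD_leM R (n - k) k; rewrite subrK in H2.
        apply: (ge0_ler_powR s0 _ _ H2); rewrite nnegrE; first exact: ltW.
        by rewrite !mulr_ge0 ?(ltW nk0) ?(ltW k0).
      rewrite mulrA powRM ?mulr_ge0 ?(ltW nk0) ?(ltW k0)// ler_wpM2r ?powR_ge0//.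
      apply: (@le_trans _ _ ((2 * br (n - k)) `^ 2)).
        by rewrite ler_powR//; have := bracket_ge1 R (n - k); lra.
      by rewrite (powR_mulrn 2) ?mulr_ge0 ?(ltW nk0)// exprMn; lra.
    have : 0 <= normc (a (n - k)) * normc (u k) by rewrite mulr_ge0 ?normc_ge0.
    set x := br n `^ s; set y := br k `^ s; set z := br _ ^+ 2.
    move=> nn /(ler_wpM2r nn); lra.
  have h0 : 0 <= br n `^ s * normc (conv a u n) by rewrite mulr_ge0 ?powR_ge0 ?normc_ge0.
  rewrite (_ : wsq s (conv a u) n = (br n `^ s * normc (conv a u n)) ^+ 2).
    rewrite (_ : 4 = 2 ^+ 2) -?exprMn; last by lra.
    by rewrite lerXn2r ?nnegrE// (le_trans h0).
  by rewrite exprMn sqr_powR_bracket.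
have bnd N : zpart (wsq s (conv a u)) N <= wsq_conv_const * B ^+ 2 * zsum (wsq s u).
  apply: le_trans (le_zpart N key) _.
  rewrite zpartZ zpartZ; have [-> sz] := zpart_zsum N s2k.
  rewrite (_ : wsq_conv_const * _ * _ = 4 * (A * (A * zsum (wsq s u)))); last first.
    by rewrite /wsq_conv_const /A; ring.
  rewrite ler_pM2l// ler_pM2l// -zsumZ//.
  apply: le_zsum => //; first exact: zsummableZ.
  (* The other half of the Schur test: once the sums are exchanged, the sum of [al (n - k)] over n
     is again at most [A]. *)
  move=> k; rewrite -beE.
  have -> : zpart (fun n => al (n - k) * be k ^+ 2) N = zpart (fun n => al (n - k)) N * be k ^+ 2.
    by rewrite /zpart mulr_suml.
  rewrite ler_wpM2r ?sqr_ge0//; apply: le_trans alA.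
  by apply: (@zpart_inj_le _ al (fun n => n - k)) => // i j /addIr.
have sm : zsummable (wsq s (conv a u)).
  exists (wsq_conv_const * B ^+ 2 * zsum (wsq s u)) => N; apply: le_trans (bnd N).
  by apply: le_zpart => n; rewrite ger0_norm ?wsq_ge0.
by split; [exact/SobolevP|apply: zsum_le_bound].
Qed.

End Sobolev_spaces.

(** * Bounds for the map W *)

Section admissible.
Variables (R : realType) (N : nat) (W : distr R -> distr R).
Hypothesis hW : admissible_W N W.
Local Notation br := (@bracket R).

Lemma Sobolev_W s (u : distr R) : Sobolev s u -> Sobolev s (W u).
Proof. by move=> su; apply: (W_Sobolev hW); apply: Sobolev_le su; rewrite gerBl. Qed.

Lemma wsq_W s : exists2 K, 0 < K & forall u, Sobolev s u ->
  zsum (wsq s (W u)) <= K * zsum (wsq s u).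
Proof.
(* The given [K0] carries no sign; [K0 ^+ 2 + 1] is positive and dominates the squared constant. *)
have [K0 HK] := W_bounded hW s; exists (K0 ^+ 2 + 1) => [|u su].
  by rewrite ltr_wpDl ?sqr_ge0.
have su' : Sobolev (s - N%:R) u by apply: Sobolev_le su; rewrite gerBl.
have sWu := Sobolev_W su.
have le1 n : wsq s (bracketD (- N%:R) u) n <= wsq s u n.
  rewrite ler_wpM2l ?powR_ge0// lerXn2r ?nnegrE ?normc_ge0// normcM normc_real.
  rewrite ger0_norm ?powR_ge0// ler_piMl ?normc_ge0//.
  by rewrite -[leRHS](powRr0 (br n)) ler_powR ?bracket_ge1// oppr_le0.
have sb : Sobolev s (bracketD (- N%:R) u).
  apply/SobolevP; move/SobolevP: su; apply: zsummable_le => n.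
  by rewrite ger0_norm ?wsq_ge0.
have h : Sobolev_norm s (W u) ^+ 2 <= K0 ^+ 2 * Sobolev_norm s (bracketD (- N%:R) u) ^+ 2.
  have h1 := HK u su'.
  rewrite -exprMn lerXn2r ?nnegrE ?Sobolev_norm_ge0//.
  exact: le_trans (Sobolev_norm_ge0 _ _) h1.
have h2 : zsum (wsq s (bracketD (- N%:R) u)) <= zsum (wsq s u).
  by apply: le_zsum => //; exact/SobolevP.
move: h; rewrite !sqr_Sobolev_norm// mulrCA ler_pM2l ?twopi_gt0// => h.
have u0 : 0 <= zsum (wsq s u) by apply: zsum_ge0 => [|n]; [exact/SobolevP|exact: wsq_ge0].
have k2 := sqr_ge0 K0.
have := ler_wpM2l k2 h2; lra.
Qed.

(** [W] is controlled in Sobolev norms, so the bound passes through H^p; entering H^p costs one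
    power of decay and leaving it costs none. *)
Lemma decay_W p : exists2 K, 0 < K & forall u B, decay p.+1 B u -> decay p (K * B) (W u).
Proof.
have [K K0 HK] := wsq_W p%:R; exists (Num.sqrt (K * bracket_sum R)).
  by rewrite sqrtr_gt0 mulr_gt0// (lt_le_trans _ (bracket_sum_ge1 R)).
move=> u B du; have su := Sobolev_decay (lexx _) du.
apply: (decay_wsq (lexx p%:R)); first by rewrite mulr_ge0 ?sqrtr_ge0 ?(decay_ge0 du).
move=> n; have := term_le_zsum n (wsq_ge0 _ _) (iffLR (SobolevP _ _) (Sobolev_W su)).
move=> /le_trans; apply; apply: le_trans (HK u su) _.
rewrite exprMn sqr_sqrtr; last first.
  by rewrite mulr_ge0 ?ltW// (lt_le_trans _ (bracket_sum_ge1 R)).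
by rewrite -mulrA ler_pM2l// mulrC (zsum_wsq_decay _ du).
Qed.

(** Linear scaling removes eps from the transport coefficient, so that eps survives in the equation
    only as the factor 1/eps of the linear part. *)
Lemma Weps_W s eps (u : distr R) : 0 < eps -> Sobolev s u -> Weps W eps u = W u.
Proof.
move=> e0 su; rewrite /Weps (W_scale hW _ su); apply/funext => n.
rewrite /scaled mulrA (_ : _%:C * _%:C = 1) ?mul1r//.
by rewrite -rmorphM mulVf ?gt_eqF.
Qed.

End admissible.

(** * Integrals of continuous functions *)

Section continuous_functions.
Variable R : realType.
Implicit Types (f g F : R -> R) (a b : R).
Local Notation mu := (@lebesgue_measure R).

Lemma continuous_add f g : continuous f -> continuous g -> continuous (fun x => f x + g x).
Proof. by move=> fc gc x; apply: cvgD; [exact: fc|exact: gc]. Qed.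

Lemma continuous_opp f : continuous f -> continuous (fun x => - f x).
Proof. by move=> fc x; apply: cvgN; exact: fc. Qed.

Lemma continuous_mul f g : continuous f -> continuous g -> continuous (fun x => f x * g x).
Proof. by move=> fc gc x; apply: cvgM; [exact: fc|exact: gc]. Qed.

Lemma continuous_scale (c : R) f : continuous f -> continuous (fun x => c * f x).
Proof. by move=> fc; apply: continuous_mul => //; exact: cst_continuous. Qed.

Lemma continuous_cosZ c : continuous (fun x : R => cos (c * x)).
Proof.
move=> x; apply: (@continuous_comp _ _ _ (fun x => c * x) cos); last exact: continuous_cos.
by apply: continuous_scale => y; exact: cvg_id.
Qed.

Lemma continuous_sinZ c : continuous (fun x : R => sin (c * x)).
Proof.
move=> x; apply: (@continuous_comp _ _ _ (fun x => c * x) sin); last exact: continuous_sin.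
by apply: continuous_scale => y; exact: cvg_id.
Qed.

Lemma derive_continuous f (df : R -> R) : (forall x : R, is_derive x 1 f (df x)) -> continuous f.
Proof.
move=> fd x; apply: differentiable_continuous; apply/derivable1_diffP.
by have [] := fd x.
Qed.

Lemma continuous_bounded f a b : a <= b -> continuous f ->
  exists2 G, 0 <= G & forall x, x \in `[a, b] -> `|f x| <= G.
Proof.
move=> ab fc.
have nc : {within `[a, b], continuous (fun x => `|f x|)}.
  by apply: continuous_subspaceT => x; apply: cvg_norm; exact: fc.
by have [c _ h] := EVT_max ab nc; exists `|f c|.
Qed.

Lemma continuous_integrable f a b : continuous f ->
  mu.-integrable `[a, b] (EFin \o f).
Proof.
move=> fc; apply: continuous_compact_integrable; first exact: segment_compact.
exact: continuous_subspaceT.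
Qed.

Lemma RintD f g a b : continuous f -> continuous g ->
  \int[mu]_(x in `[a, b]) (f x + g x) =
  \int[mu]_(x in `[a, b]) f x + \int[mu]_(x in `[a, b]) g x.
Proof. by move=> fc gc; rewrite RintegralD//; exact: continuous_integrable. Qed.

Lemma RintZ f a b (c : R) : continuous f ->
  \int[mu]_(x in `[a, b]) (c * f x) = c * \int[mu]_(x in `[a, b]) f x.
Proof. by move=> fc; rewrite RintegralZl//; exact: continuous_integrable. Qed.

Lemma RintN f a b : continuous f ->
  \int[mu]_(x in `[a, b]) (- f x) = - \int[mu]_(x in `[a, b]) f x.
Proof.
move=> fc; rewrite -mulN1r -RintZ//; congr (Rintegral _ _ _).
by apply/funext => x; rewrite mulN1r.
Qed.

Lemma RintB f g a b : continuous f -> continuous g ->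
  \int[mu]_(x in `[a, b]) (f x - g x) =
  \int[mu]_(x in `[a, b]) f x - \int[mu]_(x in `[a, b]) g x.
Proof. by move=> fc gc; rewrite RintD ?RintN//; exact: continuous_opp. Qed.

Lemma Rint_cst (c : R) a b : a <= b -> \int[mu]_(x in `[a, b]) c = c * (b - a).
Proof.
move=> ab; rewrite Rintegral_cst//= lebesgue_measure_itv/= lte_fin.
case: ltP => [_|ba]; first by rewrite -EFinB.
by have -> : a = b; [apply/eqP; rewrite eq_le ab|rewrite subrr].
Qed.

Lemma le_Rint f g a b : continuous f -> continuous g ->
  (forall x, x \in `[a, b] -> f x <= g x) ->
  \int[mu]_(x in `[a, b]) f x <= \int[mu]_(x in `[a, b]) g x.
Proof.
move=> fc gc fg.
have If := @continuous_integrable f a b fc; have Ig := @continuous_integrable g a b gc.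
by apply: le_Rintegral.
Qed.

Lemma normr_Rint_le f a b G : a <= b -> continuous f ->
  (forall x, x \in `[a, b] -> `|f x| <= G) ->
  `|\int[mu]_(x in `[a, b]) f x| <= G * (b - a).
Proof.
move=> ab fc fG.
have cc (c : R) : continuous (fun _ : R => c) by exact: cst_continuous.
rewrite ler_norml -mulNr -!Rint_cst//; apply/andP.
by split; apply: le_Rint => // x /fG; rewrite ler_norml => /andP[].
Qed.

Lemma Rint_derive f F a b : a < b -> continuous f ->
  (forall x : R, is_derive x 1 F (f x)) ->
  \int[mu]_(x in `[a, b]) f x = F b - F a.
Proof.
move=> ab fc Ff; rewrite /Rintegral (@continuous_FTC2 _ f F)//.
- exact: continuous_subspaceT.
- have Fc := derive_continuous Ff.
  split; first by move=> x _; have [] := Ff x.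
  + exact: cvg_at_right_filter (Fc a).
  + exact: cvg_at_left_filter (Fc b).
- by move=> x _; rewrite derive1E; have [] := Ff x.
Qed.

Lemma is_derive_Rint f a t : continuous f -> a < t ->
  is_derive t 1 (fun x => \int[mu]_(y in `[a, x]) f y) (f t).
Proof.
move=> fc at_.
have [] := @continuous_FTC1_closed R f a t (t + 1) _ _ at_ (fc t).
- by rewrite ltrDl.
- exact: continuous_integrable.
by move=> d; rewrite derive1E => e; exact: DeriveDef.
Qed.

Lemma is_derive_cosZ (c x : R) : is_derive x 1 (fun x : R => cos (c * x)) (- (c * sin (c * x))).
Proof.
have h : is_derive x 1 (fun x : R => c * x) c.
  have := is_deriveZ c (is_derive_id x (1 : R)).
  by rewrite /GRing.scale/= mulr1.
have := @is_derive1_comp R cos _ x _ _ (is_derive_cos (c * x)) h.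
by rewrite mulNr mulrC.
Qed.

Lemma is_derive_sinZ (c x : R) : is_derive x 1 (fun x : R => sin (c * x)) (c * cos (c * x)).
Proof.
have h : is_derive x 1 (fun x : R => c * x) c.
  have := is_deriveZ c (is_derive_id x (1 : R)).
  by rewrite /GRing.scale/= mulr1.
have := @is_derive1_comp R sin _ x _ _ (is_derive_sin (c * x)) h.
by rewrite mulrC.
Qed.

End continuous_functions.

(** * Fourier coefficients of smooth periodic functions *)

Section smooth_periodic.
Variable R : realType.
Implicit Types (f : R -> R) (n : int).
Local Notation pi := (@pi R).
Local Notation mu := (@lebesgue_measure R).

Lemma smooth_derive1 f : smooth f -> smooth (derive1 f).
Proof. by move=> sf k x; have := sf k.+1 x; rewrite /derive1n iterSr. Qed.

Lemma smooth_is_derive f (x : R) : smooth f -> is_derive x 1 f (derive1 f x).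
Proof. by move=> sf; rewrite derive1E; apply/derivableP; exact: (sf 0%N). Qed.

Lemma smooth_continuous f : smooth f -> continuous f.
Proof. by move=> sf; apply: (@derive_continuous _ _ (derive1 f)) => x; exact: smooth_is_derive. Qed.

Lemma derive1_periodic f p : (forall x, f (x + p) = f x) ->
  forall x, derive1 f (x + p) = derive1 f x.
Proof.
move=> fp x; rewrite /derive1.
rewrite (_ : (fun h => _) = (fun h => h^-1 *: (f (h + x) - f x)))//.
by apply/funext => h; rewrite addrA !fp.
Qed.

Lemma cos2pin n : cos (n%:~R * (2 * pi)) = 1 /\ sin (n%:~R * (2 * pi)) = 0.
Proof.
have H k : cos (k%:R * (2 * pi)) = 1 /\ sin (k%:R * (2 * pi)) = 0.
  elim: k => [|k [c s]]; first by rewrite mul0r cos0 sin0.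
  rewrite -natr1 mulrDl mul1r cosD sinD c s mulr_natl cos2pi sin2pi; split; ring.
case: n => k; first exact: H.
by rewrite NegzE mulrNz mulNr cosN sinN; have [-> ->] := H k.+1; rewrite oppr0.
Qed.

Definition cosint f n : R := \int[mu]_(x in `[0, 2 * pi]) (f x * cos (n%:~R * x)).
Definition sinint f n : R := \int[mu]_(x in `[0, 2 * pi]) (f x * sin (n%:~R * x)).

(** Integration by parts over a period: the boundary terms cancel by periodicity. Cosine and sine
    integrals are exchanged, hence the joint statement. *)
Lemma cosint_derive f (df : R -> R) n : continuous df -> (forall x : R, is_derive x 1 f (df x)) ->
  f (2 * pi) = f 0 ->
  cosint df n = n%:~R * sinint f n /\ sinint df n = - (n%:~R * cosint f n).
Proof.
move=> dfc fdf fper.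
have fc := derive_continuous fdf.
have cc := @continuous_cosZ R n%:~R; have sc := @continuous_sinZ R n%:~R.
have [c2 s2] := cos2pin n.
have D1 (x : R) : is_derive x 1 (fun x => f x * cos (n%:~R * x))
    (df x * cos (n%:~R * x) - n%:~R * (f x * sin (n%:~R * x))).
  have := is_deriveM (fdf x) (is_derive_cosZ n%:~R x).
  by move=> h; apply: is_derive_eq h _; rewrite /GRing.scale/=; ring.
have D2 (x : R) : is_derive x 1 (fun x => f x * sin (n%:~R * x))
    (df x * sin (n%:~R * x) + n%:~R * (f x * cos (n%:~R * x))).
  have := is_deriveM (fdf x) (is_derive_sinZ n%:~R x).
  by move=> h; apply: is_derive_eq h _; rewrite /GRing.scale/=; ring.
have k1 := continuous_mul dfc cc; have k2 := continuous_mul dfc sc.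
have k3 := continuous_mul fc cc; have k4 := continuous_mul fc sc.
have I1 := Rint_derive (twopi_gt0 R) (continuous_add k1 (continuous_opp (continuous_scale (c := n%:~R) k4))) D1.
have I2 := Rint_derive (twopi_gt0 R) (continuous_add k2 (continuous_scale (c := n%:~R) k3)) D2.
move: I1 I2; rewrite RintB//; last exact: continuous_scale.
rewrite RintD//; last exact: continuous_scale.
rewrite !RintZ// c2 s2 !mulr0 cos0 sin0 fper /cosint /sinint.
by move=> I1 I2; split; lra.
Qed.

(** Each integration by parts trades a factor n for a derivative of [f], which is again smooth and
    periodic; for p = 0 boundedness on a period is enough. *)
Lemma cosint_rapid (p : nat) f : smooth f -> (forall x, f (x + 2 * pi) = f x) ->
  exists2 C, 0 <= C & forall n,
    `|n%:~R| ^+ p * `|cosint f n| <= C /\ `|n%:~R| ^+ p * `|sinint f n| <= C.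
Proof.
elim: p f => [|p IH] f sf fper.
  have fc := smooth_continuous sf.
  have [G G0 fG] := continuous_bounded (ltW (twopi_gt0 R)) fc.
  exists (G * (2 * pi - 0)); first by rewrite mulr_ge0// subr0 ltW// twopi_gt0.
  move=> n; rewrite !mul1r; split.
  - apply: normr_Rint_le; [exact: ltW (twopi_gt0 R)|exact: continuous_mul (@continuous_cosZ R _)|].
    move=> x /fG h; rewrite normrM -[G]mulr1; apply: ler_pM => //.
    by rewrite ler_norml cos_geN1 cos_le1.
  - apply: normr_Rint_le; [exact: ltW (twopi_gt0 R)|exact: continuous_mul (@continuous_sinZ R _)|].
    move=> x /fG h; rewrite normrM -[G]mulr1; apply: ler_pM => //.
    by rewrite ler_norml sin_geN1 sin_le1.
have sdf := smooth_derive1 sf.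
have [C C0 HC] := IH _ sdf (derive1_periodic fper); exists C => // n.
have [] := @cosint_derive f (derive1 f) n (smooth_continuous sdf) (fun x => smooth_is_derive x sf).
  by rewrite -[RHS]fper add0r.
move=> e1 e2; have [] := HC n; rewrite e1 e2 normrN !normrM => h1 h2.
by rewrite exprS; split; rewrite -mulrA mulrCA; lra.
Qed.

End smooth_periodic.

(** * Products as convolutions of Fourier coefficients *)

Section complex_integrals.
Variable R : realType.
Implicit Types (f g : R -> R[i]) (a b : R) (u w : distr R) (n : int).
Local Notation pi := (@pi R).
Local Notation mu := (@lebesgue_measure R).

Definition ccontinuous f :=
  continuous (fun x => complex.Re (f x)) /\ continuous (fun x => complex.Im (f x)).

Lemma ccontinuousD f g : ccontinuous f -> ccontinuous g -> ccontinuous (fun x => f x + g x).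
Proof.
move=> [f1 f2] [g1 g2]; split; [under eq_fun do rewrite ReD|under eq_fun do rewrite ImD];
  exact: continuous_add.
Qed.

Lemma ccontinuousM f g : ccontinuous f -> ccontinuous g -> ccontinuous (fun x => f x * g x).
Proof.
move=> [f1 f2] [g1 g2]; split; [under eq_fun do rewrite ReM|under eq_fun do rewrite ImM].
  by apply: continuous_add; [|apply: continuous_opp]; exact: continuous_mul.
by apply: continuous_add; exact: continuous_mul.
Qed.

Lemma ccontinuous_cst (c : R[i]) : ccontinuous (fun _ => c).
Proof. by split; exact: cst_continuous. Qed.

Lemma ccontinuous_real (f : R -> R) : continuous f -> ccontinuous (fun x => (f x)%:C).
Proof. by move=> fc; split => //=; exact: cst_continuous. Qed.

Lemma ccontinuous_expi (c : R) : ccontinuous (fun x => expi (c * x)).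
Proof. by split; [exact: continuous_cosZ|exact: continuous_sinZ]. Qed.

Lemma expiD (x y : R) : expi (x + y) = expi x * expi y.
Proof. by apply: complexP; rewrite /= ?cosD ?sinD//; ring. Qed.

Lemma expi0 : expi 0 = 1 :> R[i].
Proof. by rewrite /expi cos0 sin0. Qed.

Lemma normc_expi (x : R) : normc (expi x) = 1.
Proof. by rewrite /= cos2Dsin2 sqrtr1. Qed.

Lemma CintD f g a b : ccontinuous f -> ccontinuous g ->
  Cintegral a b (fun x => f x + g x) = Cintegral a b f + Cintegral a b g.
Proof.
move=> [f1 f2] [g1 g2]; apply: complexP; rewrite ?ReD ?ImD /=.
  by under eq_Rintegral do rewrite ReD; rewrite RintD.
by under eq_Rintegral do rewrite ImD; rewrite RintD.
Qed.

Lemma CintZ f a b (c : R[i]) : ccontinuous f ->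
  Cintegral a b (fun x => c * f x) = c * Cintegral a b f.
Proof.
move=> [f1 f2]; apply: complexP; rewrite ?ReM ?ImM /=.
  by under eq_Rintegral do rewrite ReM; rewrite RintB ?RintZ//; exact: continuous_scale.
by under eq_Rintegral do rewrite ImM; rewrite RintD ?RintZ//; exact: continuous_scale.
Qed.

Lemma normc_Cint f a b G : a <= b -> ccontinuous f ->
  (forall x, x \in `[a, b] -> normc (f x) <= G) ->
  normc (Cintegral a b f) <= 2 * G * (b - a).
Proof.
move=> ab [f1 f2] fG; apply: le_trans (normc_le_ReIm _) _ => /=.
have h1 : `|\int[mu]_(x in `[a, b]) complex.Re (f x)| <= G * (b - a).
  by apply: normr_Rint_le => // x /fG; apply: le_trans; exact: normr_Re_le.
have h2 : `|\int[mu]_(x in `[a, b]) complex.Im (f x)| <= G * (b - a).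
  by apply: normr_Rint_le => // x /fG; apply: le_trans; exact: normr_Im_le.
lra.
Qed.

Lemma ccontinuous_coef f n : ccontinuous f -> ccontinuous (fun x => f x * expi (- (n%:~R * x))).
Proof.
move=> fc; apply: ccontinuousM => //.
under eq_fun do rewrite -mulNr; exact: ccontinuous_expi.
Qed.

Lemma coefD f g n : ccontinuous f -> ccontinuous g ->
  coef (fun x => f x + g x) n = coef f n + coef g n.
Proof.
move=> fc gc; rewrite /coef -mulrDr -CintD; [|exact: ccontinuous_coef..].
by under eq_fun do rewrite mulrDl.
Qed.

Lemma coefZ f n c : ccontinuous f -> coef (fun x => c * f x) n = c * coef f n.
Proof.
move=> fc; rewrite /coef mulrCA -(CintZ _ _ c (ccontinuous_coef n fc)).
by under eq_fun do rewrite -mulrA.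
Qed.

Lemma normc_coef f n G : ccontinuous f ->
  (forall x, x \in `[0, 2 * pi] -> normc (f x) <= G) -> normc (coef f n) <= 2 * G.
Proof.
move=> fc fG; have p0 := twopi_gt0 R.
have h : normc (Cintegral 0 (2 * pi) (fun x => f x * expi (- (n%:~R * x)))) <= 2 * G * (2 * pi - 0).
  apply: normc_Cint; [exact: ltW|exact: ccontinuous_coef|].
  by move=> x /fG; rewrite normcM normc_expi mulr1.
rewrite normcM normc_real ger0_norm ?invr_ge0 ?(ltW p0)//.
by rewrite mulrC ler_pdivrMr//; rewrite subr0 in h.
Qed.

Lemma coef_expi f n k : coef (fun x => f x * expi (k%:~R * x)) n = coef f (n - k).
Proof.
rewrite /coef; congr (_ * Cintegral _ _ _); apply/funext => x.
by rewrite -mulrA -expiD; congr (_ * expi _); rewrite intrB; ring.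
Qed.

Lemma Re_zpart (F : int -> R[i]) N : complex.Re (zpart F N) = zpart (fun k => complex.Re (F k)) N.
Proof. by elim: N => [|N IH]; rewrite ?zpart0// !zpartS !ReD IH. Qed.

Lemma Im_zpart (F : int -> R[i]) N : complex.Im (zpart F N) = zpart (fun k => complex.Im (F k)) N.
Proof. by elim: N => [|N IH]; rewrite ?zpart0// !zpartS !ImD IH. Qed.

Lemma fourier_sumE u x N : fourier_sum u x N = zpart (fun k => u k * expi (k%:~R * x)) N.
Proof. by []. Qed.

Lemma fun_ofE u x : fun_of u x = csum (fun k => u k * expi (k%:~R * x)).
Proof.
by rewrite /fun_of /csum /zsum; congr (limn _ +i* limn _); apply/funext => N;
  rewrite fourier_sumE ?Re_zpart ?Im_zpart.
Qed.

Lemma normc_term u x k : normc (u k * expi (k%:~R * x)) = normc (u k).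
Proof. by rewrite normcM normc_expi mulr1. Qed.

Lemma fun_of_summable u x : csummable u -> csummable (fun k => u k * expi (k%:~R * x)).
Proof. by rewrite /csummable => su; under eq_fun do rewrite normc_term. Qed.

Lemma normc_fun_of u x : csummable u -> normc (fun_of u x) <= 2 * zsum (fun k => normc (u k)).
Proof.
move=> su; rewrite fun_ofE; apply: le_trans (normc_csum (fun_of_summable x su)) _.
by under eq_fun do rewrite normc_term.
Qed.

Lemma ccontinuous_fun_of u : csummable u -> ccontinuous (fun_of u).
Proof.
move=> su.
have [e1 e2] : (forall k, continuous (fun x : R => complex.Re (u k * expi (k%:~R * x))))
  /\ (forall k, continuous (fun x : R => complex.Im (u k * expi (k%:~R * x)))).
  by split => k; have [] := ccontinuousM (ccontinuous_cst (u k)) (ccontinuous_expi k%:~R).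
split; under eq_fun do rewrite fun_ofE; move=> x;
  (apply: (@zsum_cvg_dominated R R (nbhs (x : R)) _ _ _ _ su); [apply: nearW => y k|move=> k]).
- by rewrite (le_trans (normr_Re_le _))// normc_term.
- exact: e1.
- by rewrite (le_trans (normr_Im_le _))// normc_term.
- exact: e2.
Qed.

Lemma ccontinuous_fourier_sum u N : ccontinuous (fun x => fourier_sum u x N).
Proof.
have h k : ccontinuous (fun x => u k * expi (k%:~R * x)).
  exact: ccontinuousM (ccontinuous_cst (u k)) (ccontinuous_expi k%:~R).
elim: N => [|N IH]; first by under eq_fun do rewrite fourier_sumE zpart0; exact: h.
under eq_fun do rewrite fourier_sumE zpartS.
by do !apply: ccontinuousD.
Qed.

Lemma coef_fourier_sum g u n N : ccontinuous g ->
  coef (fun x => g x * fourier_sum u x N) n = zpart (fun k => coef g (n - k) * u k) N.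
Proof.
move=> gc.
have h k : ccontinuous (fun x => u k * expi (k%:~R * x)).
  exact: ccontinuousM (ccontinuous_cst (u k)) (ccontinuous_expi k%:~R).
have t k : coef (fun x => g x * (u k * expi (k%:~R * x))) n = coef g (n - k) * u k.
  under eq_fun do rewrite mulrCA.
  rewrite coefZ; first by rewrite coef_expi mulrC.
  exact: ccontinuousM gc (ccontinuous_expi k%:~R).
elim: N => [|N IH]; first by rewrite zpart0 -t; under eq_fun do rewrite fourier_sumE zpart0.
have -> : (fun x => g x * fourier_sum u x N.+1) = (fun x =>
    g x * (u (- N.+1%:Z) * expi ((- N.+1%:Z)%:~R * x)) + g x * fourier_sum u x N +
    g x * (u N.+1%:Z * expi (N.+1%:Z%:~R * x))).
  by apply/funext => x; rewrite !fourier_sumE zpartS !mulrDr.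
have sc := ccontinuous_fourier_sum u N.
have c1 := ccontinuousM gc (h (- N.+1%:Z)); have c2 := ccontinuousM gc sc.
have c3 := ccontinuousM gc (h N.+1%:Z).
by rewrite (coefD _ (ccontinuousD c1 c2) c3) (coefD _ c1 c2) zpartS IH !t.
Qed.

(** For a Fourier partial sum the formula is finite and exact. The partial sums converge uniformly,
    with error at most [2 * tail N], and [coef] is continuous for the sup norm, so the formula
    passes to the limit. *)
Lemma coef_mul_fun_of g u G n : ccontinuous g ->
  (forall x, x \in `[0, 2 * pi] -> normc (g x) <= G) -> csummable u ->
  coef (fun x => g x * fun_of u x) n = conv (coef g) u n.
Proof.
move=> gc gG su.
have G0 : 0 <= G.
  by apply: le_trans (normc_ge0 _) (gG 0 _); rewrite in_itv/= lexx ltW ?twopi_gt0.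
pose tail N := zsum (fun k => normc (u k)) - zpart (fun k => normc (u k)) N.
have tail0 : tail N @[N --> \oo] --> 0.
  by rewrite -(subrr (zsum (fun k => normc (u k)))); apply: cvgB; [exact: cvg_cst|exact: zsumP].
have d x N : normc (fun_of u x - fourier_sum u x N) <= 2 * tail N.
  have sx := fun_of_summable x su.
  apply: le_trans (normc_le_ReIm _) _.
  rewrite ReD ImD ReN ImN fun_ofE fourier_sumE Re_zpart Im_zpart /=.
  have h1 : `|zsum (fun k => complex.Re (u k * expi (k%:~R * x))) -
      zpart (fun k => complex.Re (u k * expi (k%:~R * x))) N| <= tail N.
    by apply: zsum_tail => // k; rewrite (le_trans (normr_Re_le _))// normc_term.
  have h2 : `|zsum (fun k => complex.Im (u k * expi (k%:~R * x))) -
      zpart (fun k => complex.Im (u k * expi (k%:~R * x))) N| <= tail N.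
    by apply: zsum_tail => // k; rewrite (le_trans (normr_Im_le _))// normc_term.
  lra.
have fc := ccontinuous_fun_of su.
pose Z := coef (fun x => g x * fun_of u x) n.
have dZ N : normc (Z - zpart (fun k => coef g (n - k) * u k) N) <= 4 * G * tail N.
  have sc := ccontinuous_fourier_sum u N.
  have -> : Z - zpart (fun k => coef g (n - k) * u k) N =
      coef (fun x => g x * fun_of u x + (-1) * (g x * fourier_sum u x N)) n.
    rewrite coefD ?coefZ ?coef_fourier_sum ?mulN1r//; try exact: ccontinuousM.
    by apply: ccontinuousM; [exact: ccontinuous_cst|exact: ccontinuousM].
  rewrite (_ : 4 * G * tail N = 2 * (G * (2 * tail N))); last by ring.
  apply: normc_coef => [|x xI].
    by apply: ccontinuousD; [|apply: ccontinuousM (ccontinuous_cst _) _]; exact: ccontinuousM.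
  rewrite mulN1r -mulrBr normcM; apply: ler_pM; rewrite ?normc_ge0//.
  exact: gG.
have lim0 (f : nat -> R) (l : R) : (forall N, `|l - f N| <= 4 * G * tail N) -> f @ \oo --> l.
  move=> fl; apply/cvgrPdist_le => e e0.
  have c0 : 4 * G * tail N @[N --> \oo] --> 0.
    by rewrite -(mulr0 (4 * G)); apply: cvgM => //; exact: cvg_cst.
  have /cvgrPdist_le/(_ _ e0) H := c0.
  near=> N; apply: le_trans (fl N) _.
  have : `|0 - 4 * G * tail N| <= e by near: N.
  by rewrite sub0r normrN; apply: le_trans; exact: ler_norm.
have cR : zpart (fun k => complex.Re (coef g (n - k) * u k)) @ \oo --> complex.Re Z.
  apply: lim0 => N; rewrite -Re_zpart -ReN -ReD.
  by apply: le_trans (dZ N); exact: normr_Re_le.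
have cI : zpart (fun k => complex.Im (coef g (n - k) * u k)) @ \oo --> complex.Im Z.
  apply: lim0 => N; rewrite -Im_zpart -ImN -ImD.
  by apply: le_trans (dZ N); exact: normr_Im_le.
by rewrite -/Z /conv /csum (zsum_eq cR) (zsum_eq cI); case: (Z).
Unshelve. all: by end_near. Qed.

Lemma zsum_single (f : int -> R) m : (forall n, n != m -> f n = 0) -> zsum f = f m.
Proof.
move=> fm; apply: zsum_eq; apply/cvgrPdist_le => e e0; near=> N.
suff -> : zpart f N = f m by rewrite subrr normr0 ltW.
have mN : m \in zrange N by rewrite mem_zrange; near: N; exists `|m|%N.
rewrite zpartE (bigD1_seq m mN (zrange_uniq N)) big1 => [|k km]; first exact: addr0.
exact: fm.
Unshelve. all: by end_near. Qed.

(** Orthogonality of exponentials from [cosint_derive] applied to a constant: the derivative is 0,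
    so n times each of the two integrals vanishes. *)
Lemma coef_one n : coef (fun _ => 1) n = (n == 0)%:R :> R[i].
Proof.
have c1 : continuous (fun _ : R => 0 : R) by exact: cst_continuous.
have p0 := twopi_gt0 R.
have [e1 e2] := @cosint_derive R (fun _ => 1) (fun _ => 0) n c1 (fun x : R => is_derive_cst (1 : R) x (1 : R)) erefl.
have z1 : cosint (fun _ => 0) n = 0 :> R.
  by rewrite /cosint; under eq_Rintegral do rewrite mul0r; rewrite Rint_cst ?mul0r ?ltW.
have z2 : sinint (fun _ => 0) n = 0 :> R.
  by rewrite /sinint; under eq_Rintegral do rewrite mul0r; rewrite Rint_cst ?mul0r ?ltW.
rewrite /coef /Cintegral.
have -> : \int[mu]_(x in `[0, 2 * pi]) complex.Re (1 * expi (- (n%:~R * x))) = cosint (fun _ => 1) n.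
  by apply: eq_Rintegral => x _; rewrite mul1r /= cosN mul1r.
have -> : \int[mu]_(x in `[0, 2 * pi]) complex.Im (1 * expi (- (n%:~R * x))) = - sinint (fun _ => 1) n.
  rewrite /sinint -RintN; last by apply: continuous_mul; [exact: cst_continuous|exact: continuous_sinZ].
  by apply: eq_Rintegral => x _; rewrite mul1r /= sinN mul1r.
have [->|n0] := eqVneq n 0.
  have -> : cosint (fun _ => 1) 0 = 2 * pi.
    rewrite /cosint; under eq_Rintegral do rewrite mul0r cos0 mulr1.
    by rewrite Rint_cst ?mul1r ?subr0 ?ltW.
  have -> : sinint (fun _ => 1) 0 = 0 :> R.
    by rewrite /sinint; under eq_Rintegral do rewrite mul0r sin0 mulr0; rewrite Rint_cst ?mul0r ?ltW.
  by apply: complexP; rewrite /= ?mul0r ?mulr0 ?subr0 ?oppr0 ?addr0 ?mulr0// mulVf ?gt_eqF.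
have n0' : n%:~R != 0 :> R by rewrite intr_eq0.
move: e1 e2; rewrite z1 z2 => /esym/eqP; rewrite mulf_eq0 (negPf n0')/= => /eqP ->.
move=> /esym/eqP; rewrite oppr_eq0 mulf_eq0 (negPf n0')/= => /eqP ->.
by rewrite oppr0 mulr0.
Qed.

(** The case [g = 1] of [coef_mul_fun_of], the coefficients of 1 being the unit of convolution. *)
Lemma coef_fun_of u : csummable u -> coef (fun_of u) = u.
Proof.
move=> su; apply/funext => n.
have := @coef_mul_fun_of (fun _ => 1) u 1 n (ccontinuous_cst 1) _ su.
under eq_fun do rewrite mul1r; move=> -> ; last first.
  by move=> x _; rewrite (normc_real 1) normr1.
have e k : coef (fun _ => 1) (n - k) * u k = if k == n then u n else 0.
  rewrite coef_one subr_eq0 eq_sym.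
  by case: eqVneq => [->|]; rewrite ?mul1r ?mul0r.
rewrite /conv; apply: complexP; rewrite /csum /= (zsum_single (m := n)) ?e ?eqxx// => k kn;
  by rewrite e (negPf kn).
Qed.

Lemma prodd_conv u w : csummable u -> csummable w -> prodd u w = conv u w.
Proof.
move=> su sw; apply/funext => n; rewrite /prodd.
rewrite (@coef_mul_fun_of _ _ (2 * zsum (fun k => normc (u k))))//; first by rewrite coef_fun_of.
- exact: ccontinuous_fun_of.
- by move=> x _; exact: normc_fun_of.
Qed.

End complex_integrals.

(** * Multiplication by chi: decay of its coefficients and positivity *)

Section multiplication_by_cutoff.
Variables (R : realType) (chi : R -> R).
Hypothesis chi_smooth : smooth chi.
Hypothesis chi_periodic : forall x, chi (x + 2 * pi) = chi x.
Implicit Types (u : distr R) (n : int).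
Local Notation pi := (@pi R).
Local Notation mu := (@lebesgue_measure R).
Local Notation br := (@bracket R).

Definition chihat : distr R := coef (fun x => (chi x)%:C).

(** As <n>^p is at most 2^p (1 + |n|^p), the orders 0 and p of [cosint_rapid] give the bound; the
    final [+ 1] makes it positive. *)
Lemma chihat_decay p : exists2 B, 0 < B & decay p B chihat.
Proof.
have [C0 C00 H0] := cosint_rapid 0 chi_smooth chi_periodic.
have [Cp Cp0 Hp] := cosint_rapid p chi_smooth chi_periodic.
have pc := smooth_continuous chi_smooth.
exists (2 ^+ p * (2 * C0 + 2 * Cp) + 1); first by rewrite ltr_wpDl// mulr_ge0 ?exprn_ge0//; lra.
move=> n.
have [a0 b0] := H0 n; have [ap bp] := Hp n; rewrite !mul1r in a0 b0.
have h : normc (chihat n) <= `|cosint chi n| + `|sinint chi n|.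
  have p1 := twopi_ge1 R; have p0 := twopi_gt0 R.
  rewrite normcM normc_real ger0_norm ?invr_ge0 ?(ltW p0)//.
  rewrite ler_pdivrMl//; apply: (@le_trans _ _ (`|cosint chi n| + `|sinint chi n|)); last first.
    by rewrite ler_peMl ?addr_ge0.
  apply: le_trans (normc_le_ReIm _) _ => /=.
  have -> : \int[mu]_(x in `[0, 2 * pi]) (chi x * cos (- (n%:~R * x)) - 0 * sin (- (n%:~R * x))) = cosint chi n.
    by apply: eq_Rintegral => x _; rewrite mul0r subr0 cosN.
  have -> : \int[mu]_(x in `[0, 2 * pi]) (chi x * sin (- (n%:~R * x)) + 0 * cos (- (n%:~R * x))) = - sinint chi n.
    rewrite /sinint -RintN; last exact: continuous_mul pc (@continuous_sinZ _ _).
    by apply: eq_Rintegral => x _; rewrite mul0r addr0 sinN mulrN.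
  by rewrite normrN.
have brp : br n ^+ p <= 2 ^+ p * (1 + `|n%:~R| ^+ p).
  have nn : 0 <= `|n%:~R : R| by [].
  have b1 := bracket_le1D R n.
  apply: (@le_trans _ _ ((1 + `|n%:~R|) ^+ p)).
    by rewrite lerXn2r ?nnegrE ?(ltW (bracket_gt0 _ _)) ?addr_ge0.
  have [n1|/ltW n1] := leP 1 `|n%:~R : R|.
    apply: (@le_trans _ _ ((2 * `|n%:~R|) ^+ p)).
      by rewrite lerXn2r ?nnegrE ?addr_ge0 ?mulr_ge0//; lra.
    by rewrite exprMn ler_wpM2l ?exprn_ge0// lerDr.
  apply: (@le_trans _ _ (2 ^+ p)); first by rewrite lerXn2r ?nnegrE ?addr_ge0//; lra.
  by rewrite ler_peMr ?exprn_ge0// lerDl exprn_ge0.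
have h0 := normc_ge0 (chihat n).
have np0 : 0 <= `|n%:~R : R| ^+ p by rewrite exprn_ge0.
have h1 : normc (chihat n) <= 2 * C0 by lra.
have h2 : `|n%:~R| ^+ p * normc (chihat n) <= 2 * Cp.
  by apply: le_trans (ler_wpM2l np0 h) _; rewrite mulrDr; lra.
apply: (@le_trans _ _ (normc (chihat n) * (2 ^+ p * (1 + `|n%:~R| ^+ p)))); first by rewrite ler_wpM2l.
rewrite mulrCA ler_wpDr// ler_wpM2l ?exprn_ge0// mulrDr mulr1 [_ * (_ ^+ _)]mulrC; lra.
Qed.

Lemma chi_bounded : exists2 G, 0 <= G &
  forall x, x \in `[0, 2 * pi] -> normc (chi x)%:C <= G.
Proof.
have [G G0 HG] := continuous_bounded (ltW (twopi_gt0 R)) (smooth_continuous chi_smooth).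
by exists G => // x /HG; rewrite normc_real.
Qed.

Lemma ccontinuous_chi : ccontinuous (fun x => (chi x)%:C).
Proof. exact/ccontinuous_real/smooth_continuous. Qed.

Lemma mulchi_conv u : csummable u -> mulchi chi u = conv chihat u.
Proof.
move=> su; apply/funext => n; rewrite /mulchi.
have [G G0 HG] := chi_bounded.
exact: (coef_mul_fun_of n ccontinuous_chi HG su).
Qed.

Lemma fun_of_conjd u x : csummable u -> fun_of (conjd u) x = conjc (fun_of u x).
Proof.
move=> su; rewrite !fun_ofE -csum_opp.
have e k : conjd u (- k) * expi ((- k)%:~R * x) = conjc (u k * expi (k%:~R * x)).
  rewrite /conjd opprK mulrNz mulNr /expi cosN sinN.
  by case: (u k) => a b; apply: complexP; rewrite /=; ring.
apply: complexP; rewrite /csum /=.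
  by congr zsum; apply/funext => k; rewrite e; case: (u k * _).
rewrite -zsumN; last exact/csummable_Im/fun_of_summable.
by congr zsum; apply/funext => k; rewrite e; case: (u k * _).
Qed.

Lemma conjd_summable u : csummable u -> csummable (conjd u).
Proof.
move=> su; rewrite /csummable; under eq_fun do rewrite normc_conj.
by apply: (zsummable_inj _ su) => i j /oppr_inj.
Qed.

Hypothesis chi_ge0 : forall x, 0 <= chi x.

(** Parseval: with f = [fun_of u], the convolution formula identifies the sum with the zeroth
    Fourier coefficient of chi |f|^2, the mean of a nonnegative function. *)
Lemma mulchi_ge0 u : csummable u -> 0 <= complex.Re (csum (fun n => conjc (u n) * mulchi chi u n)).
Proof.
move=> su; have [G G0 HG] := chi_bounded.
have fc := ccontinuous_fun_of su.
have gc := ccontinuousM ccontinuous_chi fc.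
have gB x : x \in `[0, 2 * pi] -> normc ((chi x)%:C * fun_of u x) <=
    G * (2 * zsum (fun k => normc (u k))).
  by move=> xI; rewrite normcM; apply: ler_pM; rewrite ?normc_ge0// ?normc_fun_of//; exact: HG.
have := coef_mul_fun_of 0 gc gB (conjd_summable su).
rewrite /conv -csum_opp; under [X in _ = csum X]eq_fun do rewrite sub0r opprK /conjd opprK mulrC.
move=> <-; rewrite /coef ReM.
rewrite [complex.Im ((2 * pi)^-1)%:C]/= mul0r subr0; apply: mulr_ge0.
  by rewrite invr_ge0 ltW ?twopi_gt0.
apply: Rintegral_ge0 => x _.
rewrite mul0r oppr0 expi0 mulr1 fun_of_conjd// -mulrA.
case: (fun_of u x) => a b /=; rewrite !mul0r subr0.
by rewrite mulr_ge0// mulrN opprK addr_ge0// -expr2 sqr_ge0.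
Qed.

End multiplication_by_cutoff.

(** * The fundamental lemma of the calculus of variations *)

Lemma near_is_derive (R : realType) (f g : R -> R) (x d : R) :
  (\forall y \near x, f y = g y) -> is_derive x 1 f d -> is_derive x 1 g d.
Proof. exact: near_eq_is_derive. Qed.

Lemma is_derive_const (R : realType) (c x : R) : is_derive x 1 (fun _ : R => c) 0.
Proof. exact: is_derive_cst. Qed.

Section flat_functions.
Variable R : realType.
Implicit Types (x a b c t : R) (f g : R -> R).

(** The functions x^-m exp(-1/x), extended by 0. Their linear span is closed under differentiation,
    so all derivatives of a bump stay within explicit functions. *)
Definition flat (m : nat) x : R := if 0 < x then x^-1 ^+ m * expR (- x^-1) else 0.

Lemma flat_ge0 m x : 0 <= flat m x.
Proof.
rewrite /flat; case: ifPn => // x0.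
by rewrite mulr_ge0 ?expR_ge0// exprn_ge0// invr_ge0 ltW.
Qed.

Lemma flat_gt0 x : 0 < x -> 0 < flat 0 x.
Proof. by move=> x0; rewrite /flat x0 mul1r expR_gt0. Qed.

Lemma flat_eq0 m x : x <= 0 -> flat m x = 0.
Proof. by rewrite /flat ltNge => ->. Qed.

(** With y = 1/x this is the exponential series bound y^(m+1) <= (m+1)! exp(y). A bound linear in x
    is what differentiability at 0 requires. *)
Lemma flat_le m x : 0 <= x -> flat m x <= (m.+1)`!%:R * x.
Proof.
rewrite le_eqVlt => /predU1P[<-|x0]; first by rewrite flat_eq0 ?mulr0.
rewrite /flat x0; set y := x^-1; have y0 : 0 < y by rewrite invr_gt0.
have f0 : 0 < (m.+1)`!%:R :> R by rewrite ltr0n fact_gt0.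
have := expR_ge1Dxn m (ltW y0).
have := expR_gt0 y; set e := expR y => e0 he.
have he' : y ^+ m.+1 <= (m.+1)`!%:R * e.
  rewrite mulrC -ler_pdivrMr//; lra.
rewrite expRN -/e ler_pdivrMr// -[x]invrK -/y mulrAC ler_pdivlMr// -exprSr.
exact: he'.
Qed.

Lemma flatS m x : 0 < x -> flat m x / x = flat m.+1 x.
Proof. by move=> x0; rewrite /flat x0 exprS mulrAC [_ * x^-1]mulrC. Qed.

Lemma is_derive_flat m x :
  is_derive x 1 (flat m) (- m%:R * flat m.+1 x + flat m.+2 x).
Proof.
have [x0|x0|x0] := ltgtP 0 x.
- have xn0 : x != 0 by rewrite gt_eqF.
  have dV : is_derive x 1 (fun y : R => y^-1) (- (x^-1 ^+ 2)).
    have := @is_deriveV R (fun y => y) x 1 1 xn0 (is_derive_id x (1 : R)).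
    by move=> h; apply: is_derive_eq h _; rewrite /GRing.scale/= mulr1 exprVn.
  have dX := is_deriveX m dV.
  have dN := is_deriveN dV.
  have dE := @is_derive1_comp R expR _ x _ _ (is_derive_expR _) dN.
  have := is_deriveM dX dE.
  move=> h; apply: (near_is_derive (f := ((fun y : R => y^-1) ^+ m) * (expR \o (- (fun y : R => y^-1))))).
    near=> y; have y0 : 0 < y by near: y; exact: lt_nbhsr.
    by rewrite /flat y0 /GRing.mul/= fctE; congr (_ * _).
  apply: is_derive_eq h _.
  rewrite /GRing.scale/= /flat x0 opprK !fctE.
  set e := expR _; set y := x^-1.
  clearbody y; move: {dX} m => [|m]; first by rewrite /= !expr0 expr1; ring.
  rewrite /= (exprS _ m.+2) (exprS _ m.+1) (exprS _ m); ring.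
- apply: (near_is_derive (f := fun _ => 0)).
    by near=> y; rewrite flat_eq0// ltW//; near: y; exact: lt_nbhsl.
  apply: is_derive_eq (is_derive_const _ _) _.
  by rewrite !flat_eq0 ?ltW// mulr0 addr0.
(* At 0 the right difference quotient of [flat m] is [flat m.+1], which [flat_le] bounds by a
   multiple of h; the left one is 0. *)
- rewrite -x0 !(flat_eq0 _ (lexx 0)) mulr0 addr0.
  have key : h^-1 *: (flat m (h *: 1 + 0) - flat m 0) @[h --> 0^'] --> (0 : R).
    apply/cvgrPdist_le => e e0.
    have f0 : 0 < (m.+2)`!%:R :> R by rewrite ltr0n fact_gt0.
    near=> h.
    rewrite sub0r normrN [h *: 1]mulr1 addr0 (flat_eq0 _ (lexx 0)) subr0 /GRing.scale/= mulrC.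
    have h0 : h != 0 by near: h; exact: nbhs_dnbhs_neq.
    have he : `|h| <= e / (m.+2)`!%:R.
      near: h; apply: dnbhs0_le; exact: divr_gt0.
    have [hp|hn] := ltP 0 h.
      rewrite flatS// ger0_norm ?flat_ge0//; apply: le_trans (flat_le _ (ltW hp)) _.
      by rewrite mulrC -ler_pdivlMr//; apply: le_trans (ler_norm _) he.
    by rewrite flat_eq0// mul0r normr0 ltW.
  by apply: DeriveDef; [exact: cvgP key|exact: cvg_lim key].
Unshelve. all: by end_near. Qed.

Section bump.
Variables a b : R.

(** Linear combinations of products of flat functions at the two endpoints. An inductive class suits
    the smoothness proof, which uses only that differentiation stays inside it. *)
Inductive bumpish : (R -> R) -> Prop :=
| bump_flat c i j : bumpish (fun x => c * (flat i (x - a) * flat j (b - x)))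
| bump_add f g : bumpish f -> bumpish g -> bumpish (fun x => f x + g x).

Lemma bump_derive f : bumpish f ->
  exists2 df, bumpish df & forall x : R, is_derive x 1 f (df x).
Proof.
elim=> [c i j|f1 f2 _ [d1 b1 h1] _ [d2 b2 h2]]; last first.
  exists (fun x => d1 x + d2 x); first exact: bump_add.
  by move=> x; exact: is_deriveD.
exists (fun x => (c * - i%:R * (flat i.+1 (x - a) * flat j (b - x)) +
   c * (flat i.+2 (x - a) * flat j (b - x))) +
  (c * j%:R * (flat i (x - a) * flat j.+1 (b - x)) +
   - c * (flat i (x - a) * flat j.+2 (b - x)))).
  by do !apply: bump_add; exact: bump_flat.
move=> x.
have dl : is_derive x 1 (fun y : R => y - a) 1.
  have := is_deriveB (is_derive_id x (1 : R)) (is_derive_cst a x (1 : R)).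
  by rewrite subr0.
have dr : is_derive x 1 (fun y : R => b - y) (- 1).
  have := is_deriveB (is_derive_cst b x (1 : R)) (is_derive_id x (1 : R)).
  by rewrite sub0r.
have d1 := @is_derive1_comp R (flat i) _ x _ _ (is_derive_flat i (x - a)) dl.
have d2 := @is_derive1_comp R (flat j) _ x _ _ (is_derive_flat j (b - x)) dr.
have := is_deriveZ c (is_deriveM d1 d2).
by move=> h; apply: is_derive_eq h _; rewrite /GRing.scale/=; ring.
Qed.

Lemma bump_smooth f : bumpish f -> smooth f.
Proof.
move=> bf k x; have [g bg ->] : exists2 g, bumpish g & derive1n k f = g.
  elim: k => [|k [g bg IH]]; first by exists f.
  have [dg bdg gdg] := bump_derive bg; exists dg => //.
  rewrite /derive1n/= -/(derive1n k f) IH; apply/funext => y.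
  by rewrite derive1E; have [] := gdg y.
by have [dg _ gdg] := bump_derive bg; have [] := gdg x.
Qed.

Definition bump x := flat 0 (x - a) * flat 0 (b - x).

Lemma bumpishE : bumpish bump.
Proof.
rewrite (_ : bump = fun x => 1 * (flat 0 (x - a) * flat 0 (b - x))); first exact: bump_flat.
by apply/funext => x; rewrite mul1r.
Qed.

Lemma bump_ge0 x : 0 <= bump x.
Proof. by rewrite mulr_ge0 ?flat_ge0. Qed.

Lemma bump_gt0 x : a < x < b -> 0 < bump x.
Proof. by move=> /andP[ax xb]; rewrite mulr_gt0// flat_gt0// subr_gt0. Qed.

Lemma bump_eq0 x : x \notin `]a, b[ -> bump x = 0.
Proof.
rewrite in_itv/= negb_and -!leNgt => /orP[xa|bx].
  by rewrite /bump flat_eq0 ?mul0r ?subr_le0.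
by rewrite /bump [X in _ * X]flat_eq0 ?mulr0 ?subr_le0.
Qed.

End bump.

End flat_functions.

(** * Weak derivatives of continuous functions are classical *)

Section weak_derivative.
Variables (R : realType) (T : R).
Hypothesis T0 : 0 < T.
Implicit Types (f g h : R -> R).
Local Notation mu := (@lebesgue_measure R).

Lemma smoothD f g : smooth f -> smooth g -> smooth (fun x => f x + g x).
Proof.
move=> sf sg k x.
have H j : derive1n j (fun x => f x + g x) = (fun x => derive1n j f x + derive1n j g x).
  elim: j => [//|j IH]; rewrite /derive1n/= -/(derive1n j _) IH; apply/funext => y.
  rewrite !derive1E; apply/derive_val.
  by apply: is_deriveD; apply: derivableP; [exact: sf|exact: sg].
by rewrite H; apply: derivableD; [exact: sf|exact: sg].
Qed.

Lemma smoothZ (c : R) f : smooth f -> smooth (fun x => c * f x).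
Proof.
move=> sf k x.
have H j : derive1n j (fun x => c * f x) = (fun x => c * derive1n j f x).
  elim: j => [//|j IH]; rewrite /derive1n/= -/(derive1n j _) IH; apply/funext => y.
  rewrite !derive1E; apply/derive_val.
  by apply: is_deriveZ; apply: derivableP; exact: sf.
by rewrite H; apply: derivableZ; exact: sf.
Qed.

(** Were the integral not positive, the primitive, which is nonnegative and nondecreasing, would
    vanish on ]0, T[, and so would its derivative [f t]. *)
Lemma Rint_gt0 f t : continuous f -> (forall x, 0 <= f x) -> 0 < t < T -> 0 < f t ->
  0 < \int[mu]_(x in `[0, T]) f x.
Proof.
move=> fc f0 /andP[t0 tT] ft; rewrite ltNge; apply/negP => A0.
pose P x := \int[mu]_(y in `[0, x]) f y.
have dP (x : R) : 0 < x -> is_derive x 1 P (f x) by exact: is_derive_Rint.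
have P0 x : 0 <= P x by exact: Rintegral_ge0.
have PT x : 0 < x < T -> P x = 0.
  move=> /andP[x0 xT]; apply/eqP; rewrite eq_le P0 andbT.
  apply: le_trans A0; rewrite -/(P T) -subr_ge0.
  (* The interval extends beyond T so that T itself is an interior point for [MVT_diff]. *)
  have dom r : r \in `]0, T + 1[ -> is_derive r 1 P (f r).
    by rewrite in_itv/= => /andP[r0 _]; exact: dP.
  have [||c _ ->] := MVT_diff dom (x := T) (y := x).
  - by rewrite in_itv/= T0 ltrDl ltr01.
  - by rewrite in_itv/= x0 (lt_trans xT)// ltrDl ltr01.
  - by rewrite mulr_ge0// subr_ge0 ltW.
have : is_derive t 1 P 0.
  apply: (near_is_derive (f := fun _ => 0)).
  near=> x; rewrite PT//.
  have : x \in `]0, T[ by near: x; apply: near_in_itvoo; rewrite in_itv/= t0.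
  by rewrite in_itv.
have [_ e1] := dP t t0; move=> [_ e2].
by move: ft; rewrite -e1 e2 ltxx.
Unshelve. all: by end_near. Qed.

(** The primitive from 0 vanishes to the left of a and is constant to the right of b; the constant
    is the integral of psi, which is 0. *)
Lemma primitive_test psi a b : 0 < a -> a <= b -> b < T -> smooth psi ->
  (forall x, x \notin `[a, b] -> psi x = 0) ->
  \int[mu]_(x in `[0, T]) psi x = 0 ->
  exists2 theta, time_test_function T theta & derive1 theta = psi.
Proof.
move=> a0 ab bT sp psi0 Ipsi.
have pc := smooth_continuous sp.
pose Th x := \int[mu]_(y in `[0, x]) psi y.
have Th_left x : x < a -> Th x = 0.
  move=> xa; rewrite /Th (@eq_Rintegral _ _ _ _ _ (fun _ => 0)).
    have [x0|x0] := leP 0 x; first by rewrite Rint_cst ?mul0r.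
    by rewrite set_itv_ge ?Rintegral_set0// bnd_simp -ltNge.
  move=> y; rewrite inE/= in_itv/= => /andP[y0 yx]; apply: psi0.
  by rewrite in_itv/= negb_and -ltNge (le_lt_trans yx).
have dTh (x : R) : is_derive x 1 Th (psi x).
  have [x0|x0] := ltP 0 x; first exact: is_derive_Rint.
  have xa : x < a by exact: le_lt_trans x0 a0.
  rewrite psi0; last by rewrite in_itv/= negb_and -ltNge xa.
  apply: (near_is_derive (f := fun _ => 0)).
  by near=> y; rewrite Th_left//; near: y; exact: lt_nbhsl.
have dE : derive1 Th = psi by apply/funext => x; rewrite derive1E; have [] := dTh x.
exists Th => //; split.
  case=> [|k] x; first by have [] := dTh x.
  by rewrite /derive1n iterSr dE; exact: sp.
exists a, b; split=> // x; rewrite in_itv/= negb_and -!ltNge => /orP[|bx]; first exact: Th_left.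
have right y : b <= y -> Th y = Th b.
  rewrite le_eqVlt => /predU1P[->//|by_].
  have dom r : r \in `]b - 1, y + 1[ -> is_derive r 1 Th (psi r) by [].
  have cT : {within `[b, y], continuous Th}.
    by apply: continuous_subspaceT; apply: (derive_continuous dTh).
  have [c] := MVT by_ (fun r _ => dTh r) cT.
  rewrite in_itv/= => /andP[bc _] /eqP; rewrite (psi0 c) ?mul0r ?subr_eq0; first by move=> /eqP.
  by rewrite in_itv/= negb_and -!ltNge bc orbT.
by rewrite right ?(ltW bx)// -(right T) ?(ltW bT)// /Th Ipsi.
Unshelve. all: by end_near. Qed.

(** The du Bois-Reymond lemma. If h(t1) < h(t2), the difference of two bumps at t1 and t2, weighted
    to have mean zero, is the derivative of a test function, yet its integral against h is
    nonzero. *)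
Lemma weakly_constant h : continuous h ->
  (forall theta, time_test_function T theta ->
     \int[mu]_(x in `[0, T]) (derive1 theta x * h x) = 0) ->
  forall t1 t2, t1 \in `]0, T[ -> t2 \in `]0, T[ -> h t1 = h t2.
Proof.
move=> hc hw.
(* Averages at most x + (y - x)/3 and at least y - (y - x)/3 cannot coincide; below, x and y are
   [h t1] and [h t2]. *)
have aux (A1 A2 I1 I2 x y : R) : 0 < A1 -> 0 < A2 -> x < y ->
    I1 <= (x + (y - x) / 3) * A1 -> (y - (y - x) / 3) * A2 <= I2 ->
    A2 * I1 - A1 * I2 <> 0.
  move=> A10 A20 xy h1 h2 E.
  have : 0 < A1 * A2 * (y - x) by rewrite !mulr_gt0// subr_gt0.
  have := ler_wpM2l (ltW A20) h1; have := ler_wpM2l (ltW A10) h2.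
  lra.
have H t1 t2 : t1 \in `]0, T[ -> t2 \in `]0, T[ -> h t2 <= h t1; last first.
  by move=> t1 t2 i1 i2; apply/eqP; rewrite eq_le !H.
rewrite !in_itv/= => /andP[t10 t1T] /andP[t20 t2T].
rewrite leNgt; apply/negP => h12.
pose e := (h t2 - h t1) / 3.
have e0 : 0 < e by rewrite /e divr_gt0// subr_gt0.
have /cvgrPdist_le/(_ _ e0)/nbhs_ballP[d1 /= d10 H1] := hc t1.
have /cvgrPdist_le/(_ _ e0)/nbhs_ballP[d2 /= d20 H2] := hc t2.
pose m := Num.min (Num.min t1 (T - t1)) (Num.min t2 (T - t2)).
(* Halving the minimum puts the supports of both bumps inside [d, T - d] and inside the balls where
   h varies by at most e. *)
pose d := Num.min m (Num.min d1 d2) / 2.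
have m0 : 0 < m by rewrite /m !lt_min t10 t20 !subr_gt0 t1T t2T.
have d0 : 0 < d by rewrite divr_gt0// lt_min m0 lt_min d10.
have [dm [dd1 dd2]] : 2 * d <= m /\ (2 * d <= d1 /\ 2 * d <= d2).
  rewrite /d mulrC divfK//; split; first by rewrite ge_min lexx.
  by rewrite !ge_min !lexx !orbT.
have : 2 * d <= t1 /\ 2 * d <= T - t1.
  by split; apply: le_trans dm _; rewrite /m !ge_min lexx ?orbT.
have : 2 * d <= t2 /\ 2 * d <= T - t2.
  by split; apply: le_trans dm _; rewrite /m !ge_min lexx ?orbT.
move=> [dt2 dT2] [dt1 dT1].
pose b1 := bump (t1 - d) (t1 + d); pose b2 := bump (t2 - d) (t2 + d).
have s1 : smooth b1 by apply/bump_smooth/bumpishE.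
have s2 : smooth b2 by apply/bump_smooth/bumpishE.
have c1 := smooth_continuous s1; have c2 := smooth_continuous s2.
pose A1 := \int[mu]_(x in `[0, T]) b1 x; pose A2 := \int[mu]_(x in `[0, T]) b2 x.
have A10 : 0 < A1.
  by apply: (@Rint_gt0 b1 t1) => //; [exact: bump_ge0|rewrite t10|apply: bump_gt0; apply/andP; split; lra].
have A20 : 0 < A2.
  by apply: (@Rint_gt0 b2 t2) => //; [exact: bump_ge0|rewrite t20|apply: bump_gt0; apply/andP; split; lra].
pose psi x := A2 * b1 x + - A1 * b2 x.
have sp : smooth psi by apply: smoothD; exact: smoothZ.
have Ipsi : \int[mu]_(x in `[0, T]) psi x = 0.
  rewrite RintD; [|exact: continuous_scale..].
  by rewrite !RintZ// -/A1 -/A2; ring.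
have psi0 x : x \notin `[d, T - d] -> psi x = 0.
  rewrite in_itv/= negb_and -!ltNge => xd.
  rewrite /psi /b1 /b2 !bump_eq0 ?mulr0 ?addr0//;
    rewrite in_itv/= negb_and -!leNgt; apply/orP; case/orP: xd => ?; [left|right|left|right]; lra.
have [th tth dth] := @primitive_test psi d (T - d) d0 ltac:(lra) ltac:(lra) sp psi0 Ipsi.
have := hw th tth; rewrite dth.
have -> : \int[mu]_(x in `[0, T]) (psi x * h x) =
    A2 * \int[mu]_(x in `[0, T]) (b1 x * h x) - A1 * \int[mu]_(x in `[0, T]) (b2 x * h x).
  rewrite -mulNr -!RintZ -?RintD; [|by do ?[exact: continuous_mul|apply: continuous_scale]..].
  by apply: eq_Rintegral => x _; rewrite /psi; ring.
have B1 : \int[mu]_(x in `[0, T]) (b1 x * h x) <= (h t1 + e) * A1.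
  rewrite -RintZ//; apply: le_Rint; [exact: continuous_mul|exact: continuous_scale|].
  move=> x _; rewrite mulrC; have [xI|xI] := boolP (x \in `]t1 - d, t1 + d[); last first.
    by rewrite /b1 bump_eq0// !mulr0.
  apply: ler_wpM2r; first exact: bump_ge0.
  have : ball t1 d1 x.
    by move: xI; rewrite in_itv/= /ball/= ltr_norml => /andP[? ?]; apply/andP; split; lra.
  by move=> /H1; rewrite ler_norml => /andP[? ?]; lra.
have B2 : (h t2 - e) * A2 <= \int[mu]_(x in `[0, T]) (b2 x * h x).
  rewrite -RintZ//; apply: le_Rint; [exact: continuous_scale|exact: continuous_mul|].
  move=> x _; rewrite [leRHS]mulrC; have [xI|xI] := boolP (x \in `]t2 - d, t2 + d[); last first.
    by rewrite /b2 bump_eq0// !mulr0.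
  apply: ler_wpM2r; first exact: bump_ge0.
  have : ball t2 d2 x.
    by move: xI; rewrite in_itv/= /ball/= ltr_norml => /andP[? ?]; apply/andP; split; lra.
  by move=> /H2; rewrite ler_norml => /andP[? ?]; lra.
by move/eqP; apply/negP/eqP; exact: (aux _ _ _ _ _ _ A10 A20 h12 B1 B2).
Qed.

(** If G is a primitive of g, then f + G is weakly constant, hence constant on ]0, T[. *)
Lemma weak_derivative f g : continuous f -> continuous g ->
  (forall x, x <= 0 -> g x = g 0) ->
  (forall theta, time_test_function T theta ->
     \int[mu]_(x in `[0, T]) (theta x * g x - derive1 theta x * f x) = 0) ->
  forall t : R, t \in `]0, T[ -> is_derive t 1 f (- g t).
Proof.
move=> fc gc g0 fg.
(* The primitive must be differentiable on the whole line, while an integral from a base point is so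
   only to its right. As g is constant on the negative axis, an affine function continues the
   integral based at -1. *)
pose G x := if -1/2 < x then \int[mu]_(y in `[-1, x]) g y else g 0 * (x + 1).
have G_left x : x < 0 -> G x = g 0 * (x + 1).
  rewrite /G => x0; case: ifPn => // x1.
  rewrite (@eq_Rintegral _ _ _ _ _ (fun _ => g 0)); first by rewrite Rint_cst ?opprK//; lra.
  by move=> y; rewrite inE/= in_itv/= => /andP[_ yx]; apply: g0; lra.
have dG (x : R) : is_derive x 1 G (g x).
  have [x0|x0] := ltP (-1/4) x.
    apply: (near_is_derive (f := fun x => \int[mu]_(y in `[-1, x]) g y)).
      near=> y; rewrite /G ifT//.
      have : -1/4 < y by near: y; exact: lt_nbhsr.
      lra.
    by apply: is_derive_Rint => //; lra.
  rewrite g0; last by lra.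
  apply: (near_is_derive (f := fun x => g 0 * (x + 1))).
    near=> y; rewrite G_left//.
    have : y < 0 by near: y; apply: lt_nbhsl; lra.
    by [].
  have := is_deriveZ (g 0) (is_deriveD (is_derive_id x (1 : R)) (is_derive_cst (1 : R) x (1 : R))).
  by move=> h; apply: is_derive_eq h _; rewrite /GRing.scale/= addr0 mulr1.
have Gc := derive_continuous dG.
have hc : continuous (fun x => f x + G x) by exact: continuous_add.
have hw theta : time_test_function T theta ->
    \int[mu]_(x in `[0, T]) (derive1 theta x * (f x + G x)) = 0.
  move=> tth; have := fg theta tth; have [st [a [b [a0 bT th0]]]] := tth.
  have tc := smooth_continuous st; have dtc := smooth_continuous (smooth_derive1 st).
  rewrite RintB; [|exact: continuous_mul..].
  have DG (x : R) : is_derive x 1 (fun x => theta x * G x) (theta x * g x + derive1 theta x * G x).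
    have := is_deriveM (smooth_is_derive x st) (dG x).
    by move=> h; apply: is_derive_eq h _; rewrite /GRing.scale/=; ring.
  have := Rint_derive T0 (continuous_add (continuous_mul tc gc) (continuous_mul dtc Gc)) DG.
  rewrite !th0; last 2 first.
  - by rewrite in_itv/= negb_and -!ltNge a0.
  - by rewrite in_itv/= negb_and -!ltNge bT orbT.
  rewrite !mul0r subrr RintD; [|exact: continuous_mul..].
  have -> : \int[mu]_(x in `[0, T]) (derive1 theta x * (f x + G x)) =
      \int[mu]_(x in `[0, T]) (derive1 theta x * f x) + \int[mu]_(x in `[0, T]) (derive1 theta x * G x).
    rewrite -RintD; [|exact: continuous_mul..].
    by apply: eq_Rintegral => x _; rewrite mulrDr.
  lra.
move=> t tT.
apply: (near_is_derive (f := fun x => (f t + G t) - G x)).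
  near=> x; have xT : x \in `]0, T[ by near: x; exact: near_in_itvoo.
  by rewrite (weakly_constant hc hw tT xT) addrK.
have := is_deriveB (is_derive_cst (f t + G t) t (1 : R)) (dG t).
by rewrite sub0r.
Unshelve. all: by end_near. Qed.

End weak_derivative.

(** * Continuously differentiable curves of distributions *)

Section complex_derivatives.
Variable R : realType.
Implicit Types (f g : R -> R[i]) (d : R[i]) (t : R).

Definition is_cderive t f d :=
  is_derive t 1 (fun r => complex.Re (f r)) (complex.Re d) /\
  is_derive t 1 (fun r => complex.Im (f r)) (complex.Im d).

Lemma is_derive_add (f g : R -> R) (x df dg : R) : is_derive x 1 f df ->
  is_derive x 1 g dg -> is_derive x 1 (fun r => f r + g r) (df + dg).
Proof. by move=> h1 h2; exact: is_deriveD. Qed.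

Lemma is_derive_opp (f : R -> R) (x df : R) : is_derive x 1 f df ->
  is_derive x 1 (fun r => - f r) (- df).
Proof. by move=> h1; exact: is_deriveN. Qed.

Lemma is_derive_mul (f g : R -> R) (x df dg : R) : is_derive x 1 f df ->
  is_derive x 1 g dg -> is_derive x 1 (fun r => f r * g r) (df * g x + f x * dg).
Proof.
move=> h1 h2; apply: is_derive_eq (is_deriveM h1 h2) _.
by rewrite /GRing.scale/=; ring.
Qed.

Lemma is_cderive_cst t d : is_cderive t (fun _ => d) 0.
Proof. by split; exact: is_derive_const. Qed.

Lemma is_cderiveD t f g df dg : is_cderive t f df -> is_cderive t g dg ->
  is_cderive t (fun r => f r + g r) (df + dg).
Proof.
move=> [f1 f2] [g1 g2]; split; rewrite ?ReD ?ImD;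
  [under eq_fun do rewrite ReD|under eq_fun do rewrite ImD]; exact: is_derive_add.
Qed.

Lemma is_cderiveM t f g df dg : is_cderive t f df -> is_cderive t g dg ->
  is_cderive t (fun r => f r * g r) (df * g t + f t * dg).
Proof.
move=> [f1 f2] [g1 g2]; split; rewrite ?ReD ?ImD ?ReM ?ImM;
  [under eq_fun do rewrite ReM|under eq_fun do rewrite ImM].
  apply: is_derive_eq (is_derive_add (is_derive_mul f1 g1) (is_derive_opp (is_derive_mul f2 g2))) _.
  by ring.
apply: is_derive_eq (is_derive_add (is_derive_mul f1 g2) (is_derive_mul f2 g1)) _.
by ring.
Qed.

Lemma is_cderiveZ t c f df : is_cderive t f df -> is_cderive t (fun r => c * f r) (c * df).
Proof. by move=> h; have := is_cderiveM (is_cderive_cst t c) h; rewrite mul0r add0r. Qed.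

Lemma near_is_cderive t f g d : (\forall r \near t, f r = g r) ->
  is_cderive t f d -> is_cderive t g d.
Proof.
move=> fg [h1 h2]; split.
  by apply: near_is_derive h1; apply: filterS fg => r ->.
by apply: near_is_derive h2; apply: filterS fg => r ->.
Qed.

Lemma is_cderive_Cderive1 t f d : is_cderive t f d -> Cderive1 f t = d.
Proof.
move=> [[_ h1] [_ h2]]; rewrite /Cderive1 !derive1E h1 h2.
by case: d {h1 h2}.
Qed.

Lemma is_cderive_csum a b (f df : R -> int -> R[i]) (M : int -> R) : zsummable M ->
  (forall r, r \in `]a, b[ -> csummable (f r)) ->
  (forall r n, r \in `]a, b[ -> is_cderive r (f^~ n) (df r n)) ->
  (forall r n, r \in `]a, b[ -> normc (df r n) <= M n) ->
  forall t, t \in `]a, b[ -> is_cderive t (fun r => csum (f r)) (csum (df t)).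
Proof.
move=> sM sf fdf dfM t tab; split => /=.
- apply: (@is_derive_zsum R a b (fun r n => complex.Re (f r n))
    (fun r n => complex.Re (df r n)) M) => //.
  + by move=> r /sf; exact: csummable_Re.
  + by move=> r n /(fdf r n)[].
  + by move=> r n /(dfM r n); apply: le_trans; exact: normr_Re_le.
- apply: (@is_derive_zsum R a b (fun r n => complex.Im (f r n))
    (fun r n => complex.Im (df r n)) M) => //.
  + by move=> r /sf; exact: csummable_Im.
  + by move=> r n /(fdf r n)[].
  + by move=> r n /(dfM r n); apply: le_trans; exact: normr_Im_le.
Qed.

Lemma is_derive_quot (f : R -> R) (t d : R) : is_derive t 1 f d ->
  h^-1 * (f (t + h) - f t) @[h --> 0^'] --> d.
Proof.
move=> [c <-]; rewrite (_ : (fun h => _) = (fun h => h^-1 *: (f (h *: 1 + t) - f t))); first exact: c.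
by apply/funext => h; rewrite [h *: 1]mulr1 [h + t]addrC.
Qed.

Lemma quot_is_derive (f : R -> R) (t d : R) :
  h^-1 * (f (t + h) - f t) @[h --> 0^'] --> d -> is_derive t 1 f d.
Proof.
move=> c; have e : (fun h => h^-1 *: (f (h *: 1 + t) - f t)) = (fun h => h^-1 * (f (t + h) - f t)).
  by apply/funext => h; rewrite [h *: 1]mulr1 [h + t]addrC.
rewrite -e in c.
by apply: DeriveDef; [exact: cvgP c|exact: cvg_lim c].
Qed.

End complex_derivatives.

(** * Calculus of continuously differentiable curves *)

Section curves.
Variables (R : realType) (a b : R).
Implicit Types (U dU V dV : R -> distr R) (p q : nat) (t : R) (n : int).
Local Notation br := (@bracket R).

(* C^1 curves on ]a, b[. The bound [B] is existential since here it may depend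
   on eps; the bounds that are uniform in eps are tracked separately. *)
Definition curve p U dU := exists B : R, forall t, t \in `]a, b[ ->
  [/\ decay p B (U t), decay p B (dU t) &
      forall n, is_cderive t (fun r => U r n) (dU t n)].

Lemma curve_le p q U dU : (q <= p)%N -> curve p U dU -> curve q U dU.
Proof.
by move=> qp [B HB]; exists B => t /HB[h1 h2 h3]; split => //; exact: decay_le h1 || exact: decay_le h2.
Qed.

Lemma curve_eq p U V dU dV : (forall t, t \in `]a, b[ -> U t = V t) ->
  (forall t, t \in `]a, b[ -> dU t = dV t) -> curve p U dU -> curve p V dV.
Proof.
move=> UV dUV [B HB]; exists B => t tI; have [h1 h2 h3] := HB t tI.
rewrite -UV// -dUV//; split => // n; apply: near_is_cderive (h3 n).
near=> r; rewrite UV//; near: r; exact: near_in_itvoo.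
Unshelve. all: by end_near. Qed.

Lemma curveD p U dU V dV : curve p U dU -> curve p V dV ->
  curve p (fun r n => U r n + V r n) (fun r n => dU r n + dV r n).
Proof.
move=> [B HB] [C HC]; exists (B + C) => t tI.
have [h1 h2 h3] := HB t tI; have [k1 k2 k3] := HC t tI.
by split => [||n]; [exact: decayD|exact: decayD|exact: is_cderiveD].
Qed.

Lemma curve_multiplier p q K (m : int -> R[i]) U dU :
  (forall n, normc (m n) <= K * br n ^+ q) -> curve (p + q) U dU ->
  curve p (fun r => multiplier m (U r)) (fun r => multiplier m (dU r)).
Proof.
move=> mK [B HB]; exists (K * B) => t /HB[h1 h2 h3].
split => [||n]; [exact: decay_multiplier mK h1|exact: decay_multiplier mK h2|].
exact: is_cderiveZ.
Qed.

Lemma curve_scaled p c U dU : curve p U dU ->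
  curve p (fun r => scaled c (U r)) (fun r => scaled c (dU r)).
Proof.
move=> cU; apply: (@curve_multiplier p 0 (normc c) (fun _ => c)); last by rewrite addn0.
by move=> n; rewrite expr0 mulr1.
Qed.

Lemma curve_conv p U dU V dV : (2 <= p)%N -> curve p U dU -> curve p V dV ->
  curve p (fun r => conv (U r) (V r))
    (fun r n => conv (dU r) (V r) n + conv (U r) (dV r) n).
Proof.
move=> p2 [B HB] [C HC]; exists (conv_const R p * (B * C) + conv_const R p * (B * C)) => t tI.
have Q0 := conv_const_ge0 R p.
have [h1 h2 _] := HB t tI; have [k1 k2 _] := HC t tI.
have BC0 : 0 <= B * C by rewrite mulr_ge0 ?(decay_ge0 h1) ?(decay_ge0 k1).
split.
- by apply: decay_leB (decay_conv p2 h1 k1); rewrite lerDl mulr_ge0.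
- by apply: decayD; exact: decay_conv.
move=> n; rewrite /conv -csumD; [|exact: conv_summable h2 k1|exact: conv_summable h1 k2].
(* Leibniz gives two terms; in each the factor at n - k is bounded by [B] and the factor at k
   decays, whence the majorant. *)
apply: (@is_cderive_csum _ a b (fun r k => U r (n - k) * V r k)
  (fun r k => dU r (n - k) * V r k + U r (n - k) * dV r k) (fun k => 2 * B * C * br k ^- 2)) => //.
- exact/zsummableZ/zsummable_bracket.
- move=> r rI; have [h1' _ _] := HB r rI; have [k1' _ _] := HC r rI.
  exact: conv_summable h1' k1'.
- move=> r k rI; have [_ _ h3'] := HB r rI; have [_ _ k3'] := HC r rI.
  exact: is_cderiveM.
- move=> r k rI; have [h1' h2' _] := HB r rI; have [k1' k2' _] := HC r rI.
  apply: le_trans (normcD _ _) _; rewrite !normcM.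
  have b0 : 0 <= C * br k ^- 2 by rewrite mulr_ge0 ?(decay_ge0 k1)// invr_ge0 ltW ?bracketX_gt0.
  have u1 (w : distr R) : decay p B w -> normc (w (n - k)) <= B.
    by move=> dw; apply: le_trans (dw (n - k)); rewrite ler_peMr ?normc_ge0 ?bracketX_ge1.
  have t1 : normc (dU r (n - k)) * normc (V r k) <= B * (C * br k ^- 2).
    by apply: ler_pM; rewrite ?normc_ge0//; [exact: u1|exact: decay_term2 k1'].
  have t2 : normc (U r (n - k)) * normc (dV r k) <= B * (C * br k ^- 2).
    by apply: ler_pM; rewrite ?normc_ge0//; [exact: u1|exact: decay_term2 k2'].
  lra.
Qed.

(** Upgrades coefficientwise differentiability to the norm differentiability on which [W_dt]
    operates. The mean value theorem bounds the error of the difference quotient by 4 B <n>^-2 (real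
    and imaginary parts, two values of the derivative each), and dominated convergence concludes. *)
Lemma curve_Sobolev_is_derive s U dU t : s <= 0 -> curve 2 U dU -> t \in `]a, b[ ->
  Sobolev_is_derive s U t (dU t).
Proof.
move=> s0 [B HB] tI.
have sob u C : decay 2 C u -> Sobolev s u.
  by move=> du; apply: (@Sobolev_decay _ s 1 C u); [exact: le_trans s0 _|].
have [dt1 dt2 dt3] := HB t tI; have B0 := decay_ge0 dt1.
split; [|exact: sob dt2|].
  near=> r; have rI : r \in `]a, b[ by near: r; exact: near_in_itvoo.
  by have [h _ _] := HB r rI; exact: sob h.
have nI := near_dnbhs_shift (near_in_itvoo tI).
pose d h : distr R := scaled (h^-1)%:C (U (t + h) \- U t) \- dU t.
have Red h n : complex.Re (d h n) =
    h^-1 * (complex.Re (U (t + h) n) - complex.Re (U t n)) - complex.Re (dU t n).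
  by rewrite /d /scaled /= ReD ReN ReM /= mul0r subr0 ReD ReN.
have Imd h n : complex.Im (d h n) =
    h^-1 * (complex.Im (U (t + h) n) - complex.Im (U t n)) - complex.Im (dU t n).
  by rewrite /d /scaled /= ImD ImN ImM /= mul0r addr0 ImD ImN.
have nd : \forall h \near 0^', forall n, normc (d h n) <= 4 * B * br n ^- 2.
  near=> h; have hI : t + h \in `]a, b[ by near: h.
  have h0 : h != 0 by near: h; exact: nbhs_dnbhs_neq.
  move=> n; have bb r : r \in `]a, b[ -> normc (dU r n) <= B * br n ^- 2.
    by move=> /HB[_ h2 _]; exact: decay_term h2.
  have DR r : r \in `]a, b[ -> is_derive r 1 (fun x => complex.Re (U x n)) (complex.Re (dU r n)).
    by move=> /HB[_ _ /(_ n)[]].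
  have DI r : r \in `]a, b[ -> is_derive r 1 (fun x => complex.Im (U x n)) (complex.Im (dU r n)).
    by move=> /HB[_ _ /(_ n)[]].
  have [c1 c1I e1] := MVT_diff DR hI tI; have [c2 c2I e2] := MVT_diff DI hI tI.
  apply: le_trans (normc_le_ReIm _) _; rewrite Red Imd e1 e2 addrAC subrr add0r.
  rewrite ![_ * h]mulrC !mulKf//.
  have := le_trans (normr_Re_le _) (bb c1 c1I); have := le_trans (normr_Im_le _) (bb c2 c2I).
  have := le_trans (normr_Re_le _) (bb t tI); have := le_trans (normr_Im_le _) (bb t tI).
  have := ler_normB (complex.Re (dU c1 n)) (complex.Re (dU t n)).
  have := ler_normB (complex.Im (dU c2 n)) (complex.Im (dU t n)).
  lra.
have lim0 : zsum (wsq s (d h)) @[h --> 0^'] --> 0.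
  have z0 : zsum (fun _ => 0) = 0 :> R by rewrite (@zsum_single _ _ 0).
  rewrite -[X in _ --> X]z0.
  apply: (@zsum_cvg_dominated R R (0 : R)^' _ (fun h => wsq s (d h)) _
    (fun n => (4 * B) ^+ 2 * br n ^- 2)).
  - exact/zsummableZ/zsummable_bracket.
  - near=> h.
    have H : forall n, normc (d h n) <= 4 * B * br n ^- 2 by near: h.
    move=> n; rewrite ger0_norm ?wsq_ge0//; apply: le_trans (wsq_le _ _ s0) _.
    rewrite wsq0; have b1 := bracketX_ge1 R 2 n; have b2 := bracketX_gt0 R 2 n.
    apply: (@le_trans _ _ ((4 * B * br n ^- 2) ^+ 2)).
      by rewrite lerXn2r ?nnegrE ?normc_ge0// (le_trans (normc_ge0 _) (H n)).
    rewrite exprMn ler_wpM2l ?sqr_ge0// expr2 ler_piMr ?invr_ge0 ?(ltW b2)//.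
    by rewrite invf_le1.
  - move=> n; have [D1 D2] := dt3 n.
    have e00 : br n `^ (2 * s) * ((complex.Re (dU t n) - complex.Re (dU t n)) ^+ 2 +
        (complex.Im (dU t n) - complex.Im (dU t n)) ^+ 2) = 0.
      by rewrite !subrr expr0n/= addr0 mulr0.
    rewrite /= -[X in _ --> X]e00 /wsq.
    under eq_fun do rewrite sqr_normcE Red Imd !expr2.
    rewrite !expr2; apply: cvgM; first exact: cvg_cst.
    apply: cvgD; apply: cvgM; apply: cvgB; try exact: cvg_cst;
      exact: is_derive_quot D1 || exact: is_derive_quot D2.
apply/cvgrPdist_le => e e0.
have e1 : 0 < e ^+ 2 / (2 * pi) by rewrite divr_gt0 ?exprn_gt0 ?twopi_gt0.
have /cvgrPdist_le/(_ _ e1) H := lim0.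
near=> h.
have hI : t + h \in `]a, b[ by near: h.
have [k1 _ _] := HB _ hI.
have sd : Sobolev s (d h).
  by apply: SobolevB (sob _ _ dt2); apply: Sobolev_scaled; apply: SobolevB; [exact: sob k1|exact: sob dt1].
rewrite sub0r normrN ger0_norm ?Sobolev_norm_ge0// -/(d h).
rewrite -(ler_pXn2r (n := 2)) ?nnegrE ?Sobolev_norm_ge0 ?(ltW e0)// sqr_Sobolev_norm//.
have : `|0 - zsum (wsq s (d h))| <= e ^+ 2 / (2 * pi) by near: h.
rewrite sub0r normrN => /(le_trans (ler_norm _)).
by rewrite ler_pdivlMr ?twopi_gt0// mulrC.
Unshelve. all: by end_near. Qed.

Lemma Sobolev_is_derive_cderive U t (du : distr R) : Sobolev_is_derive 0 U t du ->
  forall n, is_cderive t (fun r => U r n) (du n).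
Proof.
move=> [nS Sdu lim0] n.
have St : Sobolev 0 (U t) := nbhs_singleton nS.
have nS' := near_dnbhs_shift nS.
pose d h : distr R := scaled (h^-1)%:C (U (t + h) \- U t) \- du.
have nd : \forall h \near 0^', normc (d h n) <= Sobolev_norm 0 (d h).
  near=> h; apply: normc_le_Sobolev_norm; apply: SobolevB => //.
  by apply: Sobolev_scaled; apply: SobolevB => //; near: h.
have Red h : complex.Re (d h n) =
    h^-1 * (complex.Re (U (t + h) n) - complex.Re (U t n)) - complex.Re (du n).
  by rewrite /d /scaled /= ReD ReN ReM /= mul0r subr0 ReD ReN.
have Imd h : complex.Im (d h n) =
    h^-1 * (complex.Im (U (t + h) n) - complex.Im (U t n)) - complex.Im (du n).
  by rewrite /d /scaled /= ImD ImN ImM /= mul0r addr0 ImD ImN.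
split; apply: quot_is_derive; apply/cvgrPdist_le => e e0;
  have /cvgrPdist_le/(_ _ e0) H := lim0; near=> h;
  have : normc (d h n) <= Sobolev_norm 0 (d h) by near: h.
- have : `|0 - Sobolev_norm 0 (d h)| <= e by near: h.
  rewrite sub0r normrN [X in _ -> _ -> X <= _]distrC -Red => h1 h2.
  by apply: le_trans (normr_Re_le _) (le_trans h2 (le_trans (ler_norm _) h1)).
- have : `|0 - Sobolev_norm 0 (d h)| <= e by near: h.
  rewrite sub0r normrN [X in _ -> _ -> X <= _]distrC -Imd => h1 h2.
  by apply: le_trans (normr_Im_le _) (le_trans h2 (le_trans (ler_norm _) h1)).
Unshelve. all: by end_near. Qed.

(** [W_dt] at s = 0: a derivative in H^-N becomes a derivative in L^2, which is read off again on
    each coefficient. *)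
Lemma curve_W (N : nat) (W : distr R -> distr R) p U dU : admissible_W N W -> (0 < p)%N ->
  curve p.+1 U dU -> curve p (fun r => W (U r)) (fun r => W (dU r)).
Proof.
move=> hW p0 cU; have [B HB] := cU.
have [K K0 HK] := decay_W hW p; exists (K * B) => t tI; have [h1 h2 _] := HB t tI.
split; [exact: HK|exact: HK|].
apply: Sobolev_is_derive_cderive; apply: (W_dt hW).
apply: curve_Sobolev_is_derive tI; first by rewrite sub0r oppr_le0.
exact: curve_le cU.
Qed.

End curves.

(** * Regularity in time of weak solutions *)

(** Commutativity is inherited from the pointwise product of functions, which avoids reindexing the
    series. *)
Lemma convC (R : realType) (u w : distr R) : csummable u -> csummable w -> conv u w = conv w u.
Proof.
move=> su sw; rewrite -(prodd_conv su sw) -(prodd_conv sw su) /prodd.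
rewrite (_ : (fun x => fun_of u x * fun_of w x) = (fun x => fun_of w x * fun_of u x))//.
by apply/funext => x; rewrite mulrC.
Qed.

Section operators.
Variables (R : realType) (chi : R -> R).
Hypothesis chi_smooth : smooth chi.
Hypothesis chi_periodic : forall x, chi (x + 2 * pi) = chi x.
Hypothesis chi_ge0 : forall x, 0 <= chi x.
Variables (N : nat) (W : distr R -> distr R).
Hypothesis hW : admissible_W N W.
Variable alpha : R.
Hypothesis alpha02 : 0 <= alpha <= 2.
Implicit Types (u w : distr R) (n : int) (p : nat).
Local Notation pi := (@pi R).
Local Notation mu := (@lebesgue_measure R).
Local Notation br := (@bracket R).
Local Notation chihat := (chihat chi).

(** The operator L of the overview, with multiplication by chi written as a convolution so that no
    evaluation of functions remains. *)
Definition Lop u : distr R := fun n => 'i%C * absD alpha u n + conv chihat u n.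

Definition transport u w : distr R := conv (W u) (dx w).

Lemma decay_Lop p : (2 <= p)%N ->
  exists2 K, 0 < K & forall u B, decay (p + 2) B u -> decay p (K * B) (Lop u).
Proof.
move=> p2; have [C C0 HC] := chihat_decay chi_smooth chi_periodic p.
exists (1 + conv_const R p * C).
  by rewrite ltr_wpDr// mulr_ge0 ?conv_const_ge0 ?ltW.
move=> u B du; rewrite mulrDl -mulrA; apply: decayD; last first.
  by apply: decay_conv => //; apply: decay_le du; rewrite leq_addr.
have := decay_scaled 'i%C (decay_absD alpha02 du).
by rewrite normc_i.
Qed.

Lemma decay_transport p : (2 <= p)%N ->
  exists2 K, 0 < K & forall u w B C, decay p.+1 B u -> decay p.+1 C w ->
    decay p (K * (B * C)) (transport u w).
Proof.
move=> p2; have [K K0 HK] := decay_W hW p.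
exists (conv_const R p * K + 1) => [|u w B C du dw].
  by rewrite ltr_wpDl// mulr_ge0 ?conv_const_ge0 ?ltW.
have BC0 : 0 <= B * C by rewrite mulr_ge0 ?(decay_ge0 du) ?(decay_ge0 dw).
apply: decay_leB (decay_conv p2 (HK u B du) (decay_dx dw)).
rewrite mulrDl; lra.
Qed.

Lemma spatial_partE eps u B : 0 < eps -> decay 4 B u ->
  spatial_part W chi alpha eps u = fun n => transport u u n + (eps^-1)%:C * Lop u n.
Proof.
move=> e0 du; apply/funext => n.
have su : csummable u by exact: decay_summable du.
have Su : Sobolev 0 u by apply: (@Sobolev_decay _ _ 3 B); [exact: ler0n|].
have [K K0 HK] := decay_W hW 3.
rewrite /spatial_part (Weps_W hW e0 Su) prodd_conv; last first.
- exact: (decay_summable _ (decay_dx du)).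
- exact: (decay_summable _ (HK u B du)).
by rewrite (mulchi_conv chi_smooth)// /Lop mulrDr addrA ['i * _]mulrC -mulrA.
Qed.

Lemma damped_opE u B : decay 2 B u ->
  damped_op chi u = fun n => 'i%C * absD (1 / 2) u n + conv chihat u n.
Proof.
move=> du; apply/funext => n; rewrite /damped_op (mulchi_conv chi_smooth)//.
exact: decay_summable du.
Qed.

Lemma conv0l u : conv (fun _ => 0) u = fun _ => 0.
Proof.
apply/funext => n; rewrite /conv /csum; under eq_fun do rewrite mul0r.
by rewrite (@zsum_single R (fun _ => 0) 0)// ; under eq_fun do rewrite mul0r; rewrite (@zsum_single R (fun _ => 0) 0).
Qed.

Lemma curve_Lop a b p U dU : (2 <= p)%N -> @curve R a b (p + 2) U dU ->
  curve a b p (fun t => Lop (U t)) (fun t => Lop (dU t)).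
Proof.
move=> p2 cU; have [B HB] := cU.
have c1 : curve a b p (fun t => absD alpha (U t)) (fun t => absD alpha (dU t)).
  apply: (@curve_multiplier _ _ _ p 2 1) cU => n.
  by rewrite mul1r normc_real ger0_norm ?powR_ge0// powR_le_bracket.
have cc : curve a b p (fun _ => chihat) (fun _ _ => 0).
  have [C C0 HC] := chihat_decay chi_smooth chi_periodic p.
  exists C => t _; split => // [n|n]; last exact: is_cderive_cst.
  by rewrite normc0 mul0r ltW.
have c2 := curve_conv p2 cc (curve_le (leq_addr 2 p) cU).
apply: curve_eq (curveD (curve_scaled 'i%C c1) c2) => // t _.
by apply/funext => n; rewrite conv0l add0r.
Qed.

Lemma curve_transport a b p U dU V dV : (2 <= p)%N ->
  @curve R a b p.+1 U dU -> curve a b p.+1 V dV ->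
  curve a b p (fun t => transport (U t) (V t))
    (fun t n => transport (dU t) (V t) n + transport (U t) (dV t) n).
Proof.
move=> p2 cU cV; apply: (curve_conv p2).
  by apply: (curve_W hW) => //; exact: leq_trans p2.
apply: (@curve_multiplier _ _ _ p 1 1); last by rewrite addn1.
by move=> n; rewrite normcM normc_i !mul1r expr1 intrC normc_real norm_le_bracket.
Qed.

End operators.

(** * Classical differentiability of the coefficients of a solution *)

Section solution_regularity.
Variables (R : realType) (chi : R -> R).
Hypothesis chi_smooth : smooth chi.
Hypothesis chi_periodic : forall x, chi (x + 2 * pi) = chi x.
Variables (N : nat) (W : distr R -> distr R).
Hypothesis hW : admissible_W N W.
Variable alpha : R.
Hypothesis alpha02 : 0 <= alpha <= 2.
Local Notation mu := (@lebesgue_measure R).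
Local Notation br := (@bracket R).
Local Notation chihat := (chihat chi).
Local Notation Lop := (Lop chi alpha).

Lemma ccontinuous_norm (f : R -> R[i]) :
  (forall t : R, normc (f r - f t) @[r --> t] --> (0 : R)) -> ccontinuous f.
Proof.
move=> H; split=> t; apply/cvgrPdist_le => e e0;
  have /cvgrPdist_le/(_ _ e0) H1 := H t; near=> r;
  (have : `|0 - normc (f r - f t)| <= e by near: r);
  rewrite sub0r normrN ger0_norm ?normc_ge0//; apply: le_trans.
  by rewrite distrC -ReN -ReD normr_Re_le.
by rewrite distrC -ImN -ImD normr_Im_le.
Unshelve. all: by end_near. Qed.

Lemma ccontinuous_conv (U V : R -> distr R) B C n :
  (forall t, decay 2 B (U t)) -> (forall t, decay 2 C (V t)) ->
  (forall m, ccontinuous (fun t => U t m)) -> (forall m, ccontinuous (fun t => V t m)) ->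
  ccontinuous (fun t => conv (U t) (V t) n).
Proof.
move=> dU dV cU cV.
have B0 := decay_ge0 (dU 0).
have tb t k : normc (U t (n - k) * V t k) <= B * C * br k ^- 2.
  rewrite normcM -mulrA; apply: ler_pM; rewrite ?normc_ge0//.
    by apply: le_trans (dU t (n - k)); rewrite ler_peMr ?normc_ge0 ?bracketX_ge1.
  exact: decay_term (dV t).
have sm := zsummableZ (B * C) (zsummable_bracket R).
have cc k : ccontinuous (fun t => U t (n - k) * V t k) by exact: ccontinuousM.
split=> t; apply: (@zsum_cvg_dominated R R (nbhs (t : R)) _ _ _ _ sm).
- by apply: nearW => r k; exact: le_trans (normr_Re_le _) (tb r k).
- by move=> k; have [h _] := cc k; exact: h.
- by apply: nearW => r k; exact: le_trans (normr_Im_le _) (tb r k).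
- by move=> k; have [_ h] := cc k; exact: h.
Qed.

Variables (sigma eps T M : R) (v0 : distr R) (v : R -> distr R) (q : nat).
Hypothesis q2 : (2 <= q)%N.
Hypothesis sigma_ge : (q + 2)%:R <= sigma.
Hypothesis eps_gt0 : 0 < eps.
Hypothesis T_gt0 : 0 < T.
Hypothesis v_solution : is_solution W chi alpha sigma eps T v0 v.
Hypothesis v_bounded : forall t, t \in `[0, T] -> Sobolev_norm sigma (v t) <= M.

(** A solution is controlled on [0, T] only, whereas the lemmas on integrals take functions
    continuous on the line. Composition with the projection onto [0, T] provides the extension,
    constant on the negative axis as [weak_derivative] requires. *)
Let clamp (t : R) : R := Num.max 0 (Num.min t T).

Let clamp_itv t : clamp t \in `[0, T].
Proof. by rewrite in_itv/= /clamp le_max lexx/= ge_max ge_min lexx orbT (ltW T_gt0). Qed.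

Let clampK t : t \in `[0, T] -> clamp t = t.
Proof. by rewrite in_itv/= /clamp => /andP[t0 tT]; rewrite min_l// max_r. Qed.

Let clamp_cvg (t : R) : clamp r @[r --> t] --> within `[0, T] (nbhs (clamp t)).
Proof.
have c : clamp r @[r --> t] --> clamp t.
  have le r : `|clamp t - clamp r| <= `|t - r|.
    have h1 := ler_norm (t - r); have h2 := ler_norm (r - t); rewrite distrC in h2.
    rewrite /clamp !maxEle !minEle ler_norml.
    by case: (leP t T); case: (leP r T); rewrite ?(ltW T_gt0); case: (leP 0 t);
      case: (leP 0 r) => *; have T0 := T_gt0; apply/andP; split; lra.
  apply/cvgrPdist_le => e e0.
  have /cvgrPdist_le/(_ _ e0) H : (fun r : R => r) r @[r --> t] --> t by exact: cvg_id.
  near=> r; apply: le_trans (le r) _.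
  by near: r.
move=> P HP; have := c _ HP; rewrite !nbhs_simpl/= => H.
by apply: filterS H => r; apply; exact: clamp_itv.
Unshelve. all: by end_near. Qed.

Let Sv t : Sobolev sigma (v (clamp t)).
Proof. by have [[h _] _ _ _] := v_solution; exact/h/clamp_itv. Qed.

Lemma solution_decay t : t \in `[0, T] -> decay (q + 2) M (v t).
Proof.
move=> tT; apply: (decay_Sobolev sigma_ge) (v_bounded tT).
by have [[h _] _ _ _] := v_solution; exact: h.
Qed.

Let dv t : decay (q + 2) M (v (clamp t)).
Proof. exact/solution_decay/clamp_itv. Qed.

Let sigma_ge0 : 0 <= sigma.
Proof. exact: le_trans (ler0n _ _) sigma_ge. Qed.

Let v_cvg (t : R) : Sobolev_norm sigma (v (clamp r) \- v (clamp t)) @[r --> t] --> (0 : R).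
Proof.
have [[_ h] _ _ _] := v_solution.
move=> P HP; exact: (clamp_cvg (h _ (clamp_itv t) P HP)).
Qed.

Let v_ccontinuous n : ccontinuous (fun t => v (clamp t) n).
Proof.
apply: ccontinuous_norm => t; apply/cvgrPdist_le => e e0.
have /cvgrPdist_le/(_ _ e0) H := v_cvg t; near=> r.
have : `|0 - Sobolev_norm sigma (v (clamp r) \- v (clamp t))| <= e by near: r.
rewrite !sub0r !normrN !ger0_norm ?normc_ge0 ?Sobolev_norm_ge0//; apply: le_trans.
have S1 := SobolevB (Sv r) (Sv t).
apply: le_trans (Sobolev_norm_le sigma_ge0 S1).
exact: (@normc_le_Sobolev_norm _ (v (clamp r) \- v (clamp t)) n (Sobolev_le sigma_ge0 S1)).
Unshelve. all: by end_near. Qed.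

Let W_ccontinuous n : ccontinuous (fun t => W (v (clamp t)) n).
Proof.
have le0 : 0 - N%:R <= sigma by apply: le_trans sigma_ge0; rewrite sub0r oppr_le0.
apply: ccontinuous_norm => t; apply/cvgrPdist_le => e e0.
have [d d0 Hd] := W_continuous hW (Sobolev_le le0 (Sv t)) e0.
have d2 : 0 < d / 2 by rewrite divr_gt0.
have /cvgrPdist_le/(_ _ d2) H := v_cvg t; near=> r.
have : `|0 - Sobolev_norm sigma (v (clamp r) \- v (clamp t))| <= d / 2 by near: r.
rewrite !sub0r !normrN !ger0_norm ?normc_ge0 ?Sobolev_norm_ge0// => h.
have S1 := SobolevB (Sv r) (Sv t).
have S2 : Sobolev 0 (W (v (clamp r)) \- W (v (clamp t))).
  by apply: SobolevB; apply: (Sobolev_W hW); exact: Sobolev_le (Sv _).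
apply: le_trans (@normc_le_Sobolev_norm _ (W (v (clamp r)) \- W (v (clamp t))) n S2) _.
apply/ltW/Hd; first exact: Sobolev_le (Sv r).
apply: le_lt_trans (Sobolev_norm_le le0 S1) _; lra.
Unshelve. all: by end_near. Qed.

Let rhs t : distr R := fun n => transport W (v t) (v t) n + (eps^-1)%:C * Lop (v t) n.

Let rhs_ccontinuous n : ccontinuous (fun t => rhs (clamp t) n).
Proof.
have d3 t : decay 3 M (v (clamp t)) by apply: decay_le (dv t); lia.
have cdx k : ccontinuous (fun t => dx (v (clamp t)) k).
  exact: ccontinuousM (ccontinuous_cst _) (v_ccontinuous k).
have [K K0 HK] := decay_W hW 2.
have [C C0 HC] := chihat_decay chi_smooth chi_periodic 2.
apply: ccontinuousD.
  apply: (@ccontinuous_conv (fun t => W (v (clamp t))) (fun t => dx (v (clamp t))) (K * M) M) => // t.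
    exact: HK.
  exact: decay_dx.
apply: ccontinuousM; first exact: ccontinuous_cst.
apply: ccontinuousD.
  by do !(apply: ccontinuousM; first exact: ccontinuous_cst).
apply: (@ccontinuous_conv (fun _ => chihat) (fun t => v (clamp t)) C M) => // [t|m].
  exact: decay_le (d3 t).
exact: ccontinuous_cst.
Qed.

(** Tested against theta(t) e^(-inx), the equation says that the n-th coefficient has minus the n-th
    coefficient of the spatial part as weak derivative. Both are continuous in time, so the
    derivative is classical. *)
Lemma solution_cderive t n : t \in `]0, T[ ->
  is_cderive t (fun r => v r n) (- spatial_part W chi alpha eps (v t) n).
Proof.
move=> tT.
have rhsE r : spatial_part W chi alpha eps (v (clamp r)) = rhs (clamp r).
  by apply: (spatial_partE chi_smooth hW alpha eps_gt0 (B := M)); apply: decay_le (dv r); lia.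
have oT : t \in `[0, T].
  by move: tT; rewrite !in_itv/= => /andP[t0 t1]; rewrite !ltW.
have weq theta : time_test_function T theta ->
    Cintegral 0 T (fun x => (theta x)%:C * rhs (clamp x) n - (derive1 theta x)%:C * v (clamp x) n) = 0.
  have [_ _ _ h] := v_solution => /h/(_ n) <-.
  by rewrite /Cintegral; congr (_ +i* _); apply: eq_Rintegral => x; rewrite inE => xT;
    rewrite -rhsE clampK.
have [vR vI] := v_ccontinuous n; have [rR rI] := rhs_ccontinuous n.
have cl0 x : x <= 0 -> clamp x = clamp 0.
  move=> x0; rewrite /clamp !min_l ?(ltW T_gt0)//; last exact: le_trans (ltW T_gt0).
  by rewrite max_l// maxxx.
apply: (@near_is_cderive _ _ (fun r => v (clamp r) n)).
  near=> r; rewrite clampK//.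
  have : r \in `]0, T[ by near: r; exact: near_in_itvoo.
  by rewrite !in_itv/= => /andP[? ?]; rewrite !ltW.
rewrite -{2}(clampK oT) rhsE; split; rewrite ?ReN ?ImN.
- apply: (@weak_derivative R T T_gt0 _ (fun r => complex.Re (rhs (clamp r) n)) vR rR) => //.
    by move=> x x0; rewrite (cl0 x).
  move=> theta /weq[h _]; rewrite -[RHS]h; apply: eq_Rintegral => x _.
  by rewrite [RHS]ReD ReN ![in RHS]ReM /= !mul0r !subr0.
- apply: (@weak_derivative R T T_gt0 _ (fun r => complex.Im (rhs (clamp r) n)) vI rI) => //.
    by move=> x x0; rewrite (cl0 x).
  move=> theta /weq[_ h]; rewrite -[RHS]h; apply: eq_Rintegral => x _.
  by rewrite [RHS]ImD ImN ![in RHS]ImM /= !mul0r !addr0.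
Unshelve. all: by end_near. Qed.

End solution_regularity.

(** * The energy inequality *)

Section energy_inequality.
Variables (R : realType) (chi : R -> R).
Hypothesis chi_smooth : smooth chi.
Hypothesis chi_periodic : forall x, chi (x + 2 * pi) = chi x.
Hypothesis chi_ge0 : forall x, 0 <= chi x.
Variable alpha : R.
Implicit Types (u w : distr R) (n : int) (p : nat) (a b t : R).
Local Notation pi := (@pi R).
Local Notation br := (@bracket R).
Local Notation chihat := (chihat chi).
Local Notation Lop := (Lop chi alpha).

Lemma Re_conjM (z w : R[i]) : complex.Re (conjc z * w) =
  complex.Re z * complex.Re w + complex.Im z * complex.Im w.
Proof. by case: z w => [z1 z2] [w1 w2] /=; rewrite mulNr opprK. Qed.

Lemma sqr_L2norm p B u : (0 < p)%N -> decay p B u -> L2norm u ^+ 2 = 2 * pi * zsum (wsq 0 u).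
Proof.
case: p => // p _ du; apply: sqr_Sobolev_norm.
exact: (@Sobolev_decay _ 0 p B u (ler0n _ _) du).
Qed.

Lemma is_derive_sqr_L2norm a b U dU t : @curve R a b 2 U dU -> t \in `]a, b[ ->
  is_derive t 1 (fun r => L2norm (U r) ^+ 2)
    (2 * pi * zsum (fun n => 2 * complex.Re (conjc (U t n) * dU t n))).
Proof.
move=> [B HB] tI.
apply: (near_is_derive (f := fun r => 2 * pi * zsum (wsq 0 (U r)))).
  near=> r; have rI : r \in `]a, b[ by near: r; exact: near_in_itvoo.
  by have [h _ _] := HB r rI; rewrite (sqr_L2norm _ h).
have B0 : 0 <= B by have [h _ _] := HB t tI; exact: decay_ge0 h.
have D : is_derive t 1 (fun r => zsum (wsq 0 (U r)))
    (zsum (fun n => 2 * complex.Re (conjc (U t n) * dU t n))).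
  apply: (@is_derive_zsum R a b (fun r => wsq 0 (U r))
    (fun r n => 2 * complex.Re (conjc (U r n) * dU r n)) (fun n => 2 * B * B * br n ^- 2)) => //.
  - exact/zsummableZ/zsummable_bracket.
  - by move=> r /HB[h _ _]; apply/SobolevP; exact: (@Sobolev_decay _ 0 1 B _ (ler0n _ _) h).
  - move=> r n /HB[_ _ /(_ n)[D1 D2]].
    under eq_fun do rewrite wsq0 sqr_normcE !expr2.
    apply: is_derive_eq (is_derive_add (is_derive_mul D1 D1) (is_derive_mul D2 D2)) _.
    by rewrite Re_conjM; ring.
  - move=> r n /HB[h1 h2 _]; rewrite normrM ger0_norm// -!mulrA ler_pM2l//.
    apply: le_trans (normr_Re_le _) _; rewrite normcM normc_conj.
    apply: ler_pM; rewrite ?normc_ge0//; last exact: decay_term h2.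
    by apply: le_trans (h1 n); rewrite ler_peMr ?normc_ge0 ?bracketX_ge1.
apply: is_derive_eq (is_derive_mul (is_derive_const (2 * pi) t) D) _.
by rewrite mul0r add0r.
Unshelve. all: by end_near. Qed.

(* The dispersive part i|D|^alpha is skew-adjoint and multiplication by chi is
   nonnegative, so only the source term S contributes. *)
Lemma dissipation eps u S B C : 0 <= eps -> decay 4 B u -> decay 2 C S ->
  zsum (fun n => 2 * complex.Re (conjc (u n) * - (eps%:C * S n + Lop u n))) <=
  eps * (zsum (wsq 0 u) + zsum (wsq 0 S)).
Proof.
move=> e0 du dS.
have [Q Q0 HQ] := chihat_decay chi_smooth chi_periodic 2.
have du2 : decay 2 B u by exact: decay_le du.
have B0 := decay_ge0 du.
have dc := decay_conv (leqnn 2) HQ du2.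
have su : csummable u by exact: decay_summable du2.
have cs w D : decay 2 D w -> csummable (fun n => conjc (u n) * w n).
  move=> dw; apply: (csummable_le _ (zsummableZ (B * D) (zsummable_bracket R))) => n.
  rewrite normcM normc_conj -mulrA; apply: ler_pM; rewrite ?normc_ge0//; last exact: decay_term dw.
  by apply: le_trans (du2 n); rewrite ler_peMr ?normc_ge0 ?bracketX_ge1.
have pos : 0 <= zsum (fun n => complex.Re (conjc (u n) * conv chihat u n)).
  by have := mulchi_ge0 chi_smooth chi_ge0 su; rewrite (mulchi_conv chi_smooth su).
have sc := csummable_Re (cs _ _ dc).
have s1 : zsummable (wsq 0 u) by apply/SobolevP; exact: (@Sobolev_decay _ 0 1 B _ (ler0n _ _) du2).
have s2 : zsummable (wsq 0 S) by apply/SobolevP; exact: (@Sobolev_decay _ 0 1 C _ (ler0n _ _) dS).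
(* The dispersive term cancels for each n, but the chi term has a sign only after summation. It is
   therefore added here, and discarded at the end by means of [pos]. *)
have pw n : `|2 * complex.Re (conjc (u n) * - (eps%:C * S n + Lop u n)) +
     2 * complex.Re (conjc (u n) * conv chihat u n)| <= eps * (wsq 0 u n + wsq 0 S n).
  have -> : 2 * complex.Re (conjc (u n) * - (eps%:C * S n + Lop u n)) +
      2 * complex.Re (conjc (u n) * conv chihat u n) = - (eps * (2 * complex.Re (conjc (u n) * S n))).
    rewrite !Re_conjM /Lop /absD /multiplier.
    case: (conv _ _ n) (S n) (u n) => [c1 c2] [z1 z2] [w1 w2] /=; ring.
  rewrite normrN normrM (ger0_norm e0) ler_wpM2l// Re_conjM !wsq0 !sqr_normcE.
  have := sqr_ge0 (complex.Re (u n) - complex.Re (S n)).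
  have := sqr_ge0 (complex.Im (u n) - complex.Im (S n)).
  have := sqr_ge0 (complex.Re (u n) + complex.Re (S n)).
  have := sqr_ge0 (complex.Im (u n) + complex.Im (S n)).
  rewrite ler_norml !expr2 => h1 h2 h3 h4; apply/andP; split; lra.
have s3 : zsummable (fun n => eps * (wsq 0 u n + wsq 0 S n)) by exact/zsummableZ/zsummableD.
have s4 := zsummable_le pw s3.
have s5 : zsummable (fun n => 2 * complex.Re (conjc (u n) * - (eps%:C * S n + Lop u n))).
  apply: zsummable_le (zsummableD (zsummable_norm s4) (zsummable_norm (zsummableZ 2 sc))) => n.
  set y := 2 * complex.Re (_ * conv _ _ _); set x := 2 * _.
  by rewrite -{1}(addrK y x); exact: ler_normB.
apply: (@le_trans _ _ (zsum (fun n => 2 * complex.Re (conjc (u n) * - (eps%:C * S n + Lop u n)) +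
     2 * complex.Re (conjc (u n) * conv chihat u n)))).
  by rewrite (zsumD s5 (zsummableZ 2 sc)) (zsumZ 2 sc) lerDl mulr_ge0.
rewrite -zsumD// -zsumZ; last exact: zsummableD.
by apply: le_zsum => // n; apply: le_trans (ler_norm _) (pw n).
Qed.

(** Common to both energies. By [dissipation] the fast-time derivative of each squared norm is at
    most eps times |U_k|^2 + |S_k|^2, and this eps cancels the 1/eps produced by the change of time.
    Each of the m sources contributes at most [C] times the full sum, whence [1 + m%:R * C]. *)
Lemma energy_estimate (m : nat) (U S : nat -> R -> distr R) (C eps T : R) (E : R -> R) :
  0 <= C -> 0 < eps ->
  (forall k, (k < m)%N -> curve 0 (T / eps) 4 (U k)
     (fun t n => - (eps%:C * S k t n + Lop (U k t) n))) ->
  (forall k t, (k < m)%N -> t \in `]0, T / eps[ -> exists B, decay 2 B (S k t)) ->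
  (forall k t, (k < m)%N -> t \in `]0, T / eps[ ->
     zsum (wsq 0 (S k t)) <= C * \sum_(j < m) zsum (wsq 0 (U j t))) ->
  (forall t, t \in `]0, T[ -> E t = \sum_(k < m) L2norm (U k (t / eps)) ^+ 2) ->
  forall t, t \in `]0, T[ ->
    derivable E t 1 /\ derive1 E t <= (1 + m%:R * C) * E t.
Proof.
move=> C0 e0 cU dS SU EU t tT.
have scal r : r \in `]0, T[ -> r / eps \in `]0, T / eps[.
  by rewrite !in_itv/= => /andP[r0 rT]; rewrite divr_gt0//= ltr_pM2r ?invr_gt0.
have tI := scal t tT; set s := t / eps in tI *.
pose D k := 2 * pi * zsum (fun n => 2 * complex.Re (conjc (U k s n) *
  - (eps%:C * S k s n + Lop (U k s) n))).
have dk (k : 'I_m) : is_derive t 1 (fun r => L2norm (U k (r / eps)) ^+ 2) (eps^-1 * D k).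
  have h : is_derive t 1 (fun r : R => r / eps) eps^-1.
    have := is_derive_mul (is_derive_id t (1 : R)) (is_derive_const eps^-1 t).
    by rewrite mul1r mulr0 addr0.
  have := is_derive_sqr_L2norm (curve_le _ (cU k (ltn_ord k))) tI.
  move=> /(_ isT) h1.
  have := @is_derive1_comp R (fun r => L2norm (U k r) ^+ 2) (fun r => r / eps) t _ _ h1 h.
  by rewrite mulrC.
have dE : is_derive t 1 E (\sum_(k < m) (eps^-1 * D k)).
  apply: (near_is_derive (f := \sum_(k < m) (fun r => L2norm (U k (r / eps)) ^+ 2))).
  near=> r; rewrite EU ?fct_sumE//; near: r; exact: near_in_itvoo.
split; first by case: dE.
rewrite derive1E; have [_ ->] := dE.
rewrite EU// -/s.
have dec k : (k < m)%N -> exists B, decay 4 B (U k s).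
  by move=> /cU[B HB]; have [h _ _] := HB s tI; exists B.
have -> : \sum_(k < m) L2norm (U k s) ^+ 2 = 2 * pi * \sum_(k < m) zsum (wsq 0 (U k s)).
  by rewrite mulr_sumr; apply: eq_bigr => k _; have [B HB] := dec k (ltn_ord k); rewrite (sqr_L2norm _ HB).
set X := \sum_(k < m) zsum _.
have Dle (k : 'I_m) : eps^-1 * D k <= 2 * pi * (zsum (wsq 0 (U k s)) + C * X).
  have [B HB] := dec k (ltn_ord k); have [Q HQ] := dS k s (ltn_ord k) tI.
  rewrite /D mulrCA ler_pM2l ?twopi_gt0//.
  rewrite ler_pdivrMl//; apply: le_trans (dissipation (ltW e0) HB HQ) _.
  by rewrite ler_pM2l// lerD2l SU.
apply: le_trans (ler_sum _ (fun k _ => Dle k)) _.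
rewrite -mulr_sumr big_split /= -/X sumr_const card_ord mulrCA ler_pM2l ?twopi_gt0//.
have -> : C * X *+ m = m%:R * C * X by rewrite -[LHS]mulr_natl mulrA.
by rewrite mulrDl mul1r.
Unshelve. all: by end_near. Qed.

End energy_inequality.

(** * The equation in fast time *)

Section rescaled_solution.
Variables (R : realType) (chi : R -> R).
Hypothesis chi_smooth : smooth chi.
Hypothesis chi_periodic : forall x, chi (x + 2 * pi) = chi x.
Variables (N : nat) (W : distr R -> distr R).
Hypothesis hW : admissible_W N W.
Variable alpha : R.
Hypothesis alpha02 : 0 <= alpha <= 2.
Implicit Types (u w : distr R) (n : int) (p : nat) (t : R).
Local Notation br := (@bracket R).
Local Notation chihat := (chihat chi).
Local Notation Lop := (Lop chi alpha).
Local Notation transport := (transport W).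

(** The right-hand side of du/dtau = - (eps S + L u). Feeding it the successive sources generates
    the fast-time derivatives of the solution. *)
Definition step (eps : R) (S u : distr R) : distr R := fun n => - (eps%:C * S n + Lop u n).

(** Since eps <= 1, the bound [B + C] is free of eps; the bounds on all fast-time derivatives
    inherit this. *)
Lemma decay_step p eps S u B C : 0 <= eps <= 1 -> decay p B S -> decay p C (Lop u) ->
  decay p (B + C) (step eps S u).
Proof.
move=> /andP[e0 e1] dS dL; apply: decayN; apply: decayD => //.
have := decay_scaled eps%:C dS; apply: decay_leB.
by rewrite normc_real ger0_norm// ler_piMl// (decay_ge0 dS).
Qed.

Lemma curve_step a b p eps S dS U dU : (2 <= p)%N -> curve a b p S dS ->
  curve a b (p + 2) U dU ->
  curve a b p (fun t => step eps (S t) (U t)) (fun t => step eps (dS t) (dU t)).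
Proof.
move=> p2 cS cU.
apply: curve_eq (curve_scaled (-1) (curveD (curve_scaled eps%:C cS)
  (curve_Lop chi_smooth chi_periodic alpha02 p2 cU))) => t _;
by apply/funext => n; rewrite /scaled mulN1r.
Qed.

Lemma is_cderive_scale (c t : R) (f : R -> R[i]) d : is_cderive (c * t) f d ->
  is_cderive t (fun r => f (c * r)) (c%:C * d).
Proof.
have h : is_derive t 1 (fun r : R => c * r) c.
  have := is_derive_mul (is_derive_const c t) (is_derive_id t (1 : R)).
  by rewrite mul0r add0r mulr1.
move=> [d1 d2]; split; rewrite ?ReM ?ImM /= mul0r ?subr0 ?addr0 mulrC.
  exact: (@is_derive1_comp R (fun r => complex.Re (f r)) (fun r => c * r) t _ _ d1 h).
exact: (@is_derive1_comp R (fun r => complex.Im (f r)) (fun r => c * r) t _ _ d2 h).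
Qed.

(** Multiplying the equation by eps clears the 1/eps in front of L. The solution keeps [q + 2]
    powers of decay, and its fast-time derivative loses two of them to L. *)
Lemma rescaled_curve sigma eps T M v0 v q : (2 <= q)%N -> (q + 2)%:R <= sigma ->
  0 < eps <= 1 -> 0 < T -> is_solution W chi alpha sigma eps T v0 v ->
  (forall t, t \in `[0, T] -> Sobolev_norm sigma (v t) <= M) ->
  (forall t, t \in `]0, T / eps[ -> decay (q + 2) M (v (eps * t))) /\
  curve 0 (T / eps) q (fun t => v (eps * t))
    (fun t => step eps (transport (v (eps * t)) (v (eps * t))) (v (eps * t))).
Proof.
move=> q2 sq /andP[e0 e1] T0 sol bnd.
have scal t : t \in `]0, T / eps[ -> eps * t \in `]0, T[.
  by rewrite !in_itv/= ltr_pdivlMr// mulrC => /andP[t0 tT]; rewrite mulr_gt0.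
have dv t : t \in `]0, T / eps[ -> decay (q + 2) M (v (eps * t)).
  move=> /scal; rewrite in_itv/= => /andP[? ?].
  by apply: (solution_decay sq sol bnd); rewrite in_itv/= !ltW.
split=> //.
have [K1 K10 H1] := decay_transport hW q2.
have [K2 K20 H2] := decay_Lop chi_smooth chi_periodic alpha02 q2.
exists (M + (K1 * (M * M) + K2 * M)) => t tI; have d := dv t tI; have M0 := decay_ge0 d.
have KM : 0 <= K1 * (M * M) + K2 * M by rewrite addr_ge0 ?mulr_ge0 ?(ltW K10) ?(ltW K20).
split.
- by apply: (@decay_leB _ _ M); [rewrite lerDl|exact: decay_le (leq_addr 2 q) d].
- apply: (@decay_leB _ _ (K1 * (M * M) + K2 * M)); first by rewrite lerDr.
  apply: decay_step; [by rewrite (ltW e0)| |exact: H2].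
  by apply: H1; apply: decay_le d; rewrite addn2.
move=> n.
have := @solution_cderive R chi chi_smooth chi_periodic N W hW alpha alpha02 sigma eps T M v0 v q q2 sq e0 T0 sol bnd (eps * t) n (scal t tI).
move=> /is_cderive_scale; congr is_cderive.
rewrite (spatial_partE chi_smooth hW alpha e0 (decay_le (leq_add q2 (leqnn 2)) d)).
by rewrite /step mulrN mulrDr mulrA -rmorphM mulfV ?gt_eqF// mul1r.
Qed.

(** The product is commuted so that [dx w] becomes the convolver of [conv_wsq]. It costs the
    constant [C ^+ 2], and the estimate stays linear in the squared norm of [u]. *)
Lemma wsq_transport s : 0 <= s <= 2 -> exists2 K, 0 < K &
  forall u w B C, 0 < C -> decay 6 B u -> decay 6 C w ->
    zsum (wsq s (transport u w)) <= K * C ^+ 2 * zsum (wsq s u).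
Proof.
move=> s02; have /andP[s0 s2] := s02.
have [K K0 HK] := wsq_W hW s; have [Q Q0 HQ] := decay_W hW 4.
have c0 : 0 <= wsq_conv_const R by exact: sqr_ge0.
exists (wsq_conv_const R * K + 1) => [|u w B C C0 du dw].
  by rewrite ltr_wpDl// mulr_ge0// ltW.
have Su : Sobolev s u by apply: (@Sobolev_decay _ s 3 B); [lra|exact: decay_le du].
have dWu := HQ u B (decay_le (isT : (5 <= 6)%N) du).
have dxw : decay 4 C (dx w) by apply: decay_dx; exact: decay_le dw.
have Y0 : 0 <= zsum (wsq s u) by apply: zsum_ge0 => [|n]; [exact/SobolevP|exact: wsq_ge0].
rewrite /transport convC; [|exact: (decay_summable _ dWu)|exact: (decay_summable _ dxw)].
have [_ h] := conv_wsq s02 C0 dxw dWu.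
apply: le_trans h _.
have h1 : zsum (wsq s (W u)) <= K * zsum (wsq s u) by exact: HK.
have c1 : 0 <= wsq_conv_const R * C ^+ 2 by rewrite mulr_ge0 ?sqr_ge0.
apply: le_trans (ler_wpM2l c1 h1) _.
have : 0 <= C ^+ 2 * zsum (wsq s u) by rewrite mulr_ge0 ?sqr_ge0.
lra.
Qed.

Lemma zsum_wsqD s q u w B C : s <= q%:R -> decay q.+1 B u -> decay q.+1 C w ->
  zsum (wsq s (fun n => u n + w n)) <= 2 * (zsum (wsq s u) + zsum (wsq s w)).
Proof.
move=> sq du dw.
have su := iffLR (SobolevP _ _) (Sobolev_decay sq du).
have sw := iffLR (SobolevP _ _) (Sobolev_decay sq dw).
rewrite -zsumD// -zsumZ; last exact: zsummableD.
apply: le_zsum => [||n]; last exact: wsqD.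
  by apply/SobolevP; exact: Sobolev_decay sq (decayD du dw).
exact/zsummableZ/zsummableD.
Qed.

End rescaled_solution.

(** * Ellipticity of i|D|^(1/2) + chi *)

Section half_order_ellipticity.
Variables (R : realType) (chi : R -> R).
Hypothesis chi_smooth : smooth chi.
Hypothesis chi_periodic : forall x, chi (x + 2 * pi) = chi x.
Implicit Types (u w : distr R) (n : int) (j p : nat) (s : R).
Local Notation br := (@bracket R).
Local Notation chihat := (chihat chi).
Local Notation L := (Lop chi (1 / 2)).

Lemma half02 : 0 <= (1 / 2 : R) <= 2.
Proof. by apply/andP; split; lra. Qed.

Lemma conv_chihat_wsq s : 0 <= s <= 2 -> exists2 K, 0 < K & forall u B, decay 4 B u ->
  zsum (wsq s (conv chihat u)) <= K * zsum (wsq s u).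
Proof.
move=> s02; have [Q Q0 HQ] := chihat_decay chi_smooth chi_periodic 4.
exists (wsq_conv_const R * Q ^+ 2) => [|u B du]; last by have [] := conv_wsq s02 Q0 HQ du.
by rewrite mulr_gt0 ?exprn_gt0// mulr_gt0// mulr_gt0// (lt_le_trans _ (bracket_sum_ge1 R)).
Qed.

Lemma sqr_normc_absD_half u n : normc (absD (1 / 2) u n) ^+ 2 = `|n%:~R| * normc (u n) ^+ 2.
Proof.
rewrite normcM normc_real exprMn real_normK ?num_real//; congr (_ * _).
rewrite -(powR_mulrn 2 (powR_ge0 _ _)) -powRrM (_ : 1 / 2 * 2%:R = 1); last by lra.
by rewrite powRr1.
Qed.

Lemma wsq_half s u n : wsq (s + 1 / 2) u n = br n * wsq s u n.
Proof.
rewrite /wsq mulrDr (_ : 2 * (1 / 2) = 1); last by lra.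
rewrite powRD ?powRr1 ?(ltW (bracket_gt0 _ _))//; first by ring.
by rewrite (gt_eqF (bracket_gt0 _ _)) implybT.
Qed.

Lemma wsq_absD_half s u n : wsq s (absD (1 / 2) u) n = `|n%:~R| * wsq s u n.
Proof. by rewrite /wsq sqr_normc_absD_half; ring. Qed.

(** Multiplication by chi has order 0, so L and |D|^(1/2) differ by an operator bounded on H^s. The
    lower bound writes i|D|^(1/2) u = L u - chi u and uses <n> <= 1 + |n|. *)
Lemma half_order_bounds s : 0 <= s <= 3 / 2 -> exists2 K, 0 < K &
  forall u B, decay 6 B u ->
    zsum (wsq s (L u)) <= K * zsum (wsq (s + 1 / 2) u) /\
    zsum (wsq (s + 1 / 2) u) <= K * (zsum (wsq s (L u)) + zsum (wsq s u)).
Proof.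
move=> /andP[s0 s32].
have s02 : 0 <= s <= 2 by apply/andP; split; lra.
have [K K0 HK] := conv_chihat_wsq s02.
have [Q Q0 HQ] := decay_Lop chi_smooth chi_periodic half02 (isT : (2 <= 4)%N).
exists (2 + 2 * K) => [|u B du]; first by lra.
have S3 w C : decay 4 C w -> zsummable (wsq s w) /\ zsummable (wsq (s + 1 / 2) w).
  by move=> dw; split; apply/SobolevP; apply: (@Sobolev_decay _ _ 3 C); rewrite //; lra.
have du4 : decay 4 B u by exact: decay_le du.
have dLu := HQ u B du.
have [su shu] := S3 _ _ du4; have [sLu _] := S3 _ _ dLu.
have [C C0 HC] := chihat_decay chi_smooth chi_periodic 4.
have [sc _] := S3 _ _ (decay_conv (isT : (2 <= 4)%N) HC du4).
have cK := HK u B du4.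
have mono : zsum (wsq s u) <= zsum (wsq (s + 1 / 2) u).
  by apply: le_zsum => // n; apply: wsq_le; lra.
have Yu0 : 0 <= zsum (wsq s u) by apply: zsum_ge0 => // n; exact: wsq_ge0.
have YL0 : 0 <= zsum (wsq s (L u)) by apply: zsum_ge0 => // n; exact: wsq_ge0.
have iw n : wsq s (fun m => 'i%C * absD (1 / 2) u m) n = `|n%:~R| * wsq s u n.
  by rewrite -wsq_absD_half /wsq normcM normc_i mul1r.
split.
- apply: (@le_trans _ _ (2 * (zsum (wsq (s + 1 / 2) u) + zsum (wsq s (conv chihat u))))).
    rewrite -zsumD// -zsumZ; last exact: zsummableD.
    apply: le_zsum => // [|n]; first exact/zsummableZ/zsummableD.
    apply: le_trans (wsqD _ _ _ _) _; rewrite ler_pM2l// lerD2r iw wsq_half.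
    by rewrite ler_wpM2r ?wsq_ge0 ?norm_le_bracket.
  by have := ler_wpM2l (ltW K0) mono; lra.
- apply: (@le_trans _ _ (zsum (wsq s u) + 2 * (zsum (wsq s (L u)) + zsum (wsq s (conv chihat u))))).
    have sLc := zsummableD sLu sc.
    rewrite -[zsum (wsq s (L u)) + _]zsumD// -(zsumZ 2 sLc) -zsumD//; last exact: zsummableZ.
    apply: le_zsum => // [|n]; first by apply: zsummableD => //; exact: zsummableZ.
    rewrite wsq_half; apply: (@le_trans _ _ ((1 + `|n%:~R|) * wsq s u n)).
      by rewrite ler_wpM2r ?wsq_ge0 ?bracket_le1D.
    rewrite mulrDl mul1r lerD2l -iw.
    have -> : (fun m => 'i%C * absD (1 / 2) u m) = (fun m => L u m + - conv chihat u m).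
      by apply/funext => m; rewrite /Lop addrK.
    by apply: le_trans (wsqD _ _ _ _) _; rewrite wsqN.
  by have := mulr_ge0 (ltW K0) YL0; lra.
Qed.

Lemma decay_iter_L k p : (2 <= p)%N -> exists2 K, 0 < K & forall u B,
  decay (p + 2 * k) B u -> decay p (K * B) (iter k L u).
Proof.
move=> p2; elim: k => [|k [K K0 HK]].
  by exists 1 => // u B; rewrite muln0 addn0 mul1r.
have p2' : (2 <= p + 2 * k)%N by rewrite (leq_trans p2)// leq_addr.
have [Q Q0 HQ] := decay_Lop chi_smooth chi_periodic half02 p2'.
exists (K * Q) => [|u B du]; first exact: mulr_gt0.
rewrite iterSr -mulrA; apply: HK; apply: HQ.
by move: du; rewrite mulnS [(2 + _)%N]addnC addnA.
Qed.

Lemma iter_L_le j : (j <= 4)%N -> exists2 K, 0 < K & forall u B,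
  decay (6 + 2 * j) B u -> zsum (wsq 0 (iter j L u)) <= K * zsum (wsq (j%:R / 2) u).
Proof.
elim: j => [|j IH] j4.
  by exists 1 => [//|u B _]; rewrite [leRHS]mul1r mul0r.
have [K K0 HK] := IH (ltnW j4).
(* From [j.+1 <= 4], the last use of [half_order_bounds] is at s = 3/2 and reaches H^2. *)
have sj : 0 <= (j%:R / 2 : R) <= 3 / 2.
  by rewrite divr_ge0//= ler_pM2r ?invr_gt0// (ler_nat _ _ 3).
have [Q Q0 HQ] := half_order_bounds sj.
have [P P0 HP] := decay_Lop chi_smooth chi_periodic half02 (isT : (2 <= 6 + 2 * j)%N).
exists (K * Q) => [|u B du]; first exact: mulr_gt0.
have du' : decay (6 + 2 * j + 2) B u by move: du; rewrite mulnS [(2 + _)%N]addnC addnA.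
rewrite iterSr; apply: le_trans (HK _ _ (HP u B du')) _.
rewrite -mulrA ler_pM2l// -[j.+1%:R]natr1 mulrDl.
by have [] := HQ u B (decay_le (leq_trans (leq_addr (2 * j) 6) (leq_addr 2 _)) du').
Qed.

(** Ellipticity trades H^((j+1)/2) of u for H^(j/2) of L u and of u. The induction hypothesis
    applies to both, and the two resulting sums are parts of the sum up to j + 1; hence the factor
    2. *)
Lemma iter_L_ge j : (j <= 4)%N -> exists2 K, 0 < K & forall u B,
  decay (6 + 2 * j) B u ->
  zsum (wsq (j%:R / 2) u) <= K * \sum_(i < j.+1) zsum (wsq 0 (iter i L u)).
Proof.
elim: j => [|j IH] j4.
  by exists 1 => // u B _; rewrite mul0r mul1r big_ord1.
have [K K0 HK] := IH (ltnW j4).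
have sj : 0 <= (j%:R / 2 : R) <= 3 / 2.
  by rewrite divr_ge0//= ler_pM2r ?invr_gt0// (ler_nat _ _ 3).
have [Q Q0 HQ] := half_order_bounds sj.
have [P P0 HP] := decay_Lop chi_smooth chi_periodic half02 (isT : (2 <= 6 + 2 * j)%N).
exists (Q * (2 * K)) => [|u B du]; first by rewrite !mulr_gt0.
have du' : decay (6 + 2 * j + 2) B u by move: du; rewrite mulnS [(2 + _)%N]addnC addnA.
rewrite -[j.+1%:R]natr1 mulrDl.
have [_ h] := HQ u B (decay_le (leq_trans (leq_addr (2 * j) 6) (leq_addr 2 _)) du').
apply: le_trans h _; rewrite -mulrA ler_pM2l//.
have h1 := HK _ _ (HP u B du').
have h2 := HK _ _ (decay_le (leq_addr 2 _) du').
set X := \sum_(i < j.+2) _.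
have nn i : (i <= j.+1)%N -> 0 <= zsum (wsq 0 (iter i L u)).
  move=> ij; have [G G0 HG] := decay_iter_L i (isT : (2 <= 4)%N).
  have dG : decay 4 (G * B) (iter i L u) by apply: HG; apply: decay_le du; lia.
  apply: zsum_ge0 => [|n]; last exact: wsq_ge0.
  by apply/SobolevP; exact: (@Sobolev_decay _ 0 3 _ _ (ler0n _ _) dG).
have e1 : \sum_(i < j.+1) zsum (wsq 0 (iter i L (L u))) <= X.
  rewrite /X [leRHS]big_ord_recl/=.
  under eq_bigr do rewrite -iterSr.
  by rewrite lerDr; exact: (nn 0%N).
have e2 : \sum_(i < j.+1) zsum (wsq 0 (iter i L u)) <= X.
  by rewrite /X [leRHS]big_ord_recr/= lerDl; exact: (nn j.+1).
have := ler_wpM2l (ltW K0) e1; have := ler_wpM2l (ltW K0) e2; lra.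
Qed.

Lemma Lop_linear eps u w B C : decay 2 B u -> decay 2 C w ->
  L (fun n => - (eps * u n + w n)) = fun n => - (eps * L u n + L w n).
Proof.
move=> du dw; apply/funext => n.
have [Q Q0 HQ] := chihat_decay chi_smooth chi_periodic 2.
have cu := conv_summable n (leqnn 2) HQ du; have cw := conv_summable n (leqnn 2) HQ dw.
have -> : L (fun n => - (eps * u n + w n)) n =
    'i%C * absD (1 / 2) (fun n => - (eps * u n + w n)) n
    + csum (fun k => (- eps) * (chihat (n - k) * u k) + (- 1) * (chihat (n - k) * w k)).
  by rewrite /Lop /conv; congr (_ + csum _); apply/funext => k; ring.
rewrite csumD; [|exact: csummableZ..].
by rewrite !csumZ// /Lop /conv /absD /multiplier; ring.
Qed.

Lemma iter_damped_op k u B : decay (2 + 2 * k) B u -> iter k (damped_op chi) u = iter k L u.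
Proof.
elim: k => [//|k IH] du; rewrite !iterS IH; last by apply: decay_le du; lia.
have [K K0 HK] := decay_iter_L k (leqnn 2).
by rewrite (damped_opE chi_smooth (HK u B _))//; apply: decay_le du; lia.
Qed.

End half_order_ellipticity.

(** * The two energies *)

Section capillary.
Variables (R : realType) (chi : R -> R).
Hypothesis chi_smooth : smooth chi.
Hypothesis chi_periodic : forall x, chi (x + 2 * pi) = chi x.
Hypothesis chi_ge0 : forall x, 0 <= chi x.
Variables (N : nat) (W : distr R -> distr R).
Hypothesis hW : admissible_W N W.
Local Notation L := (Lop chi (3 / 2)).
Local Notation transport := (transport W).

(** [dt] depends on nearby times only, so agreement on the open interval suffices, and the
    conclusion has the form of the assumption on [A] for the next derivative. *)
Lemma eps_dt_rescaled (U dU : R -> distr R) (A : R -> distr R) p eps T : 0 < eps ->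
  curve 0 (T / eps) p U dU -> (forall t, t \in `]0, T[ -> A t = U (t / eps)) ->
  forall t, t \in `]0, T[ -> scaled eps%:C (dt A t) = dU (t / eps).
Proof.
move=> e0 [B HB] AU t tT; apply/funext => n.
have tI : t / eps \in `]0, T / eps[.
  by move: tT; rewrite !in_itv/= => /andP[r0 rT]; rewrite divr_gt0//= ltr_pM2r ?invr_gt0.
have e : t / eps = eps^-1 * t by rewrite mulrC.
rewrite e in tI *; have [_ _ /(_ n) h] := HB _ tI.
rewrite /scaled /dt (@is_cderive_Cderive1 _ t (fun r => A r n) ((eps^-1)%:C * dU (eps^-1 * t) n)).
  by rewrite mulrA -rmorphM mulfV ?gt_eqF// mul1r.
apply: near_is_cderive (is_cderive_scale h); near=> r.
rewrite AU; first by rewrite [r / eps]mulrC.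
near: r; exact: near_in_itvoo.
Unshelve. all: by end_near. Qed.

Lemma three_half02 : 0 <= (3 / 2 : R) <= 2.
Proof. by apply/andP; split; lra. Qed.

Lemma capillary_estimate sigma M : 20%:R <= sigma -> 0 < M ->
  exists C : R, forall (eps T : R) v0 v, 0 < eps < 1 -> 0 < T ->
    is_solution W chi (3 / 2) sigma eps T v0 v ->
    (forall t, t \in `[0, T] -> Sobolev_norm sigma (v t) <= M) ->
    forall t, t \in `]0, T[ ->
      derivable (capillary_energy eps v) t 1 /\
      derive1 (capillary_energy eps v) t <= C * capillary_energy eps v t.
Proof.
move=> s20 M0.
(* [ar1] and [ar2] collect the factors 2 of [zsum_wsqD]. The second-order source is a sum of four
   products, the mixed one occurring twice, which gives 4a + 8b + 4c and hence the constant 8. *)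
have ar1 (q a b s x0 x1 x2 : R) : 0 <= q * x0 -> 0 <= q * x1 -> 0 <= q * x2 ->
    a <= q * x1 -> b <= q * x0 -> s <= 2 * (a + b) -> s <= 8 * q * (x0 + x1 + x2).
  by clear; lra.
have ar2 (q a b c s s1 s2 x0 x1 x2 : R) : 0 <= q * x0 -> 0 <= q * x1 -> 0 <= q * x2 ->
    a <= q * x2 -> b <= q * x1 -> c <= q * x0 -> s1 <= 2 * (a + b) -> s2 <= 2 * (b + c) ->
    s <= 2 * (s1 + s2) -> s <= 8 * q * (x0 + x1 + x2).
  by clear; lra.
have a02 := three_half02.
have [K1 K10 H1] := decay_transport hW (isT : (2 <= 16)%N).
have [Q1 Q10 G1] := decay_Lop chi_smooth chi_periodic a02 (isT : (2 <= 16)%N).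
have [K2 K20 H2] := decay_transport hW (isT : (2 <= 12)%N).
have [Q2 Q20 G2] := decay_Lop chi_smooth chi_periodic a02 (isT : (2 <= 12)%N).
have z02 : 0 <= (0 : R) <= 2 by rewrite lexx /=.
have [P P0 HP] := wsq_transport hW z02.
(* [B1] and [B2] bound the first and second fast-time derivatives with 16 and 12 powers of decay,
   uniformly in eps. *)
pose B1 := K1 * (M * M) + Q1 * M.
have B10 : 0 < B1 by rewrite addr_gt0 ?mulr_gt0.
pose B2 := K2 * (B1 * M) + K2 * (M * B1) + Q2 * B1.
have B20 : 0 < B2 by rewrite !addr_gt0 ?mulr_gt0.
(* Dominates the square of whichever bound is absorbed as the second factor of a product. *)
pose D := M ^+ 2 + B1 ^+ 2 + B2 ^+ 2.
exists (1 + 3%:R * (8 * P * D)) => eps T v0 v /andP[e0 e1] T0 sol bnd.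
have e01 : 0 < eps <= 1 by rewrite e0 ltW.
have e01' : 0 <= eps <= 1 by rewrite !ltW.
have [dV cV] := rescaled_curve chi_smooth chi_periodic hW a02 (isT : (2 <= 18)%N) s20 e01 T0 sol bnd.
pose U0 t := v (eps * t).
pose S0 t := transport (U0 t) (U0 t).
pose U1 t := step chi (3 / 2) eps (S0 t) (U0 t).
(* The sources follow from Leibniz' rule, in the exact form that [curve_transport] and [curveD]
   produce: in [S2] the mixed product appears twice. *)
pose S1 t : distr R := fun n => transport (U1 t) (U0 t) n + transport (U0 t) (U1 t) n.
pose U2 t := step chi (3 / 2) eps (S1 t) (U1 t).
pose S2 t : distr R := fun n =>
  (transport (U2 t) (U0 t) n + transport (U1 t) (U1 t) n) +
  (transport (U1 t) (U1 t) n + transport (U0 t) (U2 t) n).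
pose U3 t := step chi (3 / 2) eps (S2 t) (U2 t).
have c0 : curve 0 (T / eps) 18 U0 U1 := cV.
have c1 : curve 0 (T / eps) 14 U1 U2.
  apply: (curve_step chi_smooth chi_periodic a02 _ (isT : (2 <= 14)%N)).
    by apply: (curve_transport hW) => //; exact: curve_le c0.
  exact: curve_le c0.
have c2 : curve 0 (T / eps) 10 U2 U3.
  apply: (curve_step chi_smooth chi_periodic a02 _ (isT : (2 <= 10)%N)); last exact: curve_le c1.
  by apply: curveD; apply: (curve_transport hW) => //;
    solve [exact: curve_le c0|exact: curve_le c1].
have d0 t : t \in `]0, T / eps[ -> decay 20 M (U0 t) := dV t.
have d1 t : t \in `]0, T / eps[ -> decay 16 B1 (U1 t).
  move=> /d0 d; apply: decay_step => //.
    by apply: H1; exact: decay_le d.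
  by apply: G1; exact: decay_le d.
have d2 t : t \in `]0, T / eps[ -> decay 12 B2 (U2 t).
  move=> tI; have dd0 := d0 t tI; have dd1 := d1 t tI; apply: decay_step => //.
    by apply: decayD; apply: H2; solve [exact: decay_le dd0|exact: decay_le dd1].
  by apply: G2; exact: decay_le dd1.
have dS u w B C : decay 12 B u -> decay 12 C w -> exists B, decay 6 B (transport u w).
  move=> du dw; have [K _ H] := decay_transport hW (isT : (2 <= 6)%N).
  by exists (K * (B * C)); apply: H; [exact: decay_le du|exact: decay_le dw].
have low t : t \in `]0, T / eps[ -> [/\ decay 12 M (U0 t), decay 12 B1 (U1 t) & decay 12 B2 (U2 t)].
  by move=> tI; split; [exact: decay_le (d0 t tI)|exact: decay_le (d1 t tI)|exact: d2].
have X2 (u w : distr R) : (exists B, decay 6 B u) -> (exists B, decay 6 B w) ->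
    (exists B, decay 6 B (fun n => u n + w n)) /\
    zsum (wsq 0 (fun n => u n + w n)) <= 2 * (zsum (wsq 0 u) + zsum (wsq 0 w)).
  move=> [B du] [C dw]; split; first by exists (B + C); exact: decayD.
  exact: (@zsum_wsqD R 0 5 u w B C (ler0n _ _) du dw).
pose U k := if k is k'.+1 then if k' is _.+1 then U2 else U1 else U0.
pose S k := if k is k'.+1 then if k' is _.+1 then S2 else S1 else S0.
have P8D : 0 <= 8 * P * D by rewrite !mulr_ge0 ?(ltW P0)// !addr_ge0 ?sqr_ge0.
apply: (@energy_estimate R chi chi_smooth chi_periodic chi_ge0 (3 / 2) 3 U S (8 * P * D) eps T) => //.
- case=> [|[|[|//]]] _; [exact: curve_le c0|exact: curve_le c1|exact: curve_le c2].
- move=> k t k3 tI; have [l0 l1 l2] := low t tI.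
  suff [B HB] : exists B, decay 6 B (S k t) by exists B; exact: decay_le HB.
  case: k k3 => [|[|[|//]]] _; rewrite /S /S0 /S1 /S2.
  + exact: (dS _ _ _ _ l0 l0).
  + by have [] := X2 _ _ (dS _ _ _ _ l1 l0) (dS _ _ _ _ l0 l1).
  + have [h1 _] := X2 _ _ (dS _ _ _ _ l2 l0) (dS _ _ _ _ l1 l1).
    have [h2 _] := X2 _ _ (dS _ _ _ _ l1 l1) (dS _ _ _ _ l0 l2).
    by have [] := X2 _ _ h1 h2.
- move=> k t k3 tI; have [l0 l1 l2] := low t tI.
  rewrite !big_ord_recr big_ord0 /= add0r.
  have nn (u : distr R) B : decay 12 B u -> 0 <= zsum (wsq 0 u).
    move=> du; apply: zsum_ge0 => [|n]; last exact: wsq_ge0.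
    by apply/SobolevP; exact: (@Sobolev_decay _ 0 11 _ _ (ler0n _ _) du).
  have Xt (u w : distr R) B C : 0 < C -> C ^+ 2 <= D -> decay 12 B u -> decay 12 C w ->
      zsum (wsq 0 (transport u w)) <= P * D * zsum (wsq 0 u).
    move=> C0 CD du dw.
    apply: le_trans (HP u w B C C0 (decay_le _ du) (decay_le _ dw)) _ => //.
    by rewrite ler_wpM2r ?(nn _ _ du)// ler_pM2l.
  have D0 : M ^+ 2 <= D by rewrite /D -addrA lerDl addr_ge0 ?sqr_ge0.
  have D1 : B1 ^+ 2 <= D by rewrite /D addrAC lerDr addr_ge0 ?sqr_ge0.
  have D2 : B2 ^+ 2 <= D by rewrite /D lerDr addr_ge0 ?sqr_ge0.
  set x0 := zsum (wsq 0 (U0 t)); set x1 := zsum (wsq 0 (U1 t)); set x2 := zsum (wsq 0 (U2 t)).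
  have PD : 0 <= P * D by rewrite mulr_ge0 ?(ltW P0)// !addr_ge0 ?sqr_ge0.
  have y0 : 0 <= P * D * x0 by rewrite mulr_ge0// (nn _ _ l0).
  have y1 : 0 <= P * D * x1 by rewrite mulr_ge0// (nn _ _ l1).
  have y2 : 0 <= P * D * x2 by rewrite mulr_ge0// (nn _ _ l2).
  rewrite -[8 * P * D]mulrA.
  case: k k3 => [|[|[|//]]] _; rewrite /S /S0 /S1 /S2.
  (* The undifferentiated source is a single product, so [a] is 0 in [ar1]. *)
  + apply: (ar1 _ _ _ _ _ _ _ y0 y1 y2 y1 (Xt _ _ _ _ M0 D0 l0 l0)).
    apply: le_trans (_ : _ <= 2 * zsum (wsq 0 (transport (U0 t) (U0 t)))) _.
      have [B dB] := dS _ _ _ _ l0 l0.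
      have := @Sobolev_decay _ 0 5 B _ (ler0n _ _) dB => /SobolevP sB.
      by rewrite ler_peMl ?ler1n// zsum_ge0// => n; exact: wsq_ge0.
    by rewrite ler_pM2l// lerDr.
  + have [_] := X2 _ _ (dS _ _ _ _ l1 l0) (dS _ _ _ _ l0 l1).
    exact: (ar1 _ _ _ _ _ _ _ y0 y1 y2 (Xt _ _ _ _ M0 D0 l1 l0) (Xt _ _ _ _ B10 D1 l0 l1)).
  + have [h1 k1] := X2 _ _ (dS _ _ _ _ l2 l0) (dS _ _ _ _ l1 l1).
    have [h2 k2] := X2 _ _ (dS _ _ _ _ l1 l1) (dS _ _ _ _ l0 l2).
    have [_ k3] := X2 _ _ h1 h2.
    exact: (ar2 _ _ _ _ _ _ _ _ _ _ y0 y1 y2 (Xt _ _ _ _ M0 D0 l2 l0)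
      (Xt _ _ _ _ B10 D1 l1 l1) (Xt _ _ _ _ B20 D2 l0 l2) k1 k2 k3).
- have A0 t : t \in `]0, T[ -> v t = U0 (t / eps) by rewrite /U0 mulrC divfK ?gt_eqF.
  have A1 := eps_dt_rescaled e0 c0 A0.
  have A2 := eps_dt_rescaled e0 c1 A1.
  move=> t tT; rewrite /capillary_energy !big_ord_recr !big_ord0 /= !add0r.
  by rewrite -A2// -A1// -A0.
Qed.

End capillary.

(** * The case alpha = 1/2: powers of L *)

Section gravity.
Variables (R : realType) (chi : R -> R).
Hypothesis chi_smooth : smooth chi.
Hypothesis chi_periodic : forall x, chi (x + 2 * pi) = chi x.
Hypothesis chi_ge0 : forall x, 0 <= chi x.
Variables (N : nat) (W : distr R -> distr R).
Hypothesis hW : admissible_W N W.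
Local Notation L := (Lop chi (1 / 2)).
Local Notation transport := (transport W).

Lemma gravity_estimate sigma M : 20%:R <= sigma -> 0 < M ->
  exists C : R, forall (eps T : R) v0 v, 0 < eps < 1 -> 0 < T ->
    is_solution W chi (1 / 2) sigma eps T v0 v ->
    (forall t, t \in `[0, T] -> Sobolev_norm sigma (v t) <= M) ->
    forall t, t \in `]0, T[ ->
      derivable (gravity_energy chi v) t 1 /\
      derive1 (gravity_energy chi v) t <= C * gravity_energy chi v t.
Proof.
move=> s20 M0.
have a02 := half02 R.
have [K K0 HK] := decay_transport hW (isT : (2 <= 16)%N).
have t02 : 0 <= (2 : R) <= 2 by rewrite lexx andbT.
have [P P0 HP] := wsq_transport hW t02.
(* One constant serves all five powers; the induction on their number adds a new constant for
   each. *)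
have [A A0 HA] : exists2 A, 0 < A & forall k, (k < 5)%N -> forall u B, decay 16 B u ->
    zsum (wsq 0 (iter k L u)) <= A * zsum (wsq 2 u).
  suff : forall m, (m <= 5)%N -> exists2 A, 0 < A & forall k, (k < m)%N -> forall u B, decay 16 B u ->
      zsum (wsq 0 (iter k L u)) <= A * zsum (wsq 2 u) by apply.
  elim=> [|m IH] m5; first by exists 1.
  have [A A0 HA] := IH (ltnW m5).
  have m4 : (m <= 4)%N by [].
  have [G G0 HG] := iter_L_le chi_smooth chi_periodic m4.
  exists (A + G) => [|k]; first exact: addr_gt0.
  have nn (u : distr R) B : decay 16 B u -> zsummable (wsq 2 u).
    by move=> du; apply/SobolevP; apply: (@Sobolev_decay _ _ 15 _ _ _ du); rewrite ler_nat.
  rewrite ltnS leq_eqVlt => /predU1P[->|km] u B du; last first.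
    apply: le_trans (HA k km u B du) _; rewrite ler_wpM2r ?lerDl ?(ltW G0)//.
    by apply: zsum_ge0 (nn _ _ du) _ => n; exact: wsq_ge0.
  have du' : decay (6 + 2 * m) B u by apply: decay_le du; clear -m4; lia.
  apply: le_trans (HG u B du') _.
  have z0 : 0 <= zsum (wsq 2 u) by apply: zsum_ge0 (nn _ _ du) _ => n; exact: wsq_ge0.
  apply: (@le_trans _ _ (G * zsum (wsq 2 u))); last by rewrite ler_wpM2r// lerDr ltW.
  rewrite ler_pM2l//.
  have ms : (m%:R / 2 : R) <= 2 by rewrite ler_pdivrMr// -natrM ler_nat.
  apply: le_zsum => [||n]; [|exact: nn du|exact: wsq_le].
  apply/SobolevP; apply: Sobolev_le ms _; apply/SobolevP; exact: nn du.
have [G G0 HG] := iter_L_ge chi_smooth chi_periodic (isT : (4 <= 4)%N).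
have E2 : (4%:R / 2 : R) = 2 by lra.
rewrite E2 in HG.
have C0 : 0 <= A * (P * M ^+ 2 * G) by rewrite !mulr_ge0 ?(ltW M0) ?(ltW A0) ?(ltW P0) ?(ltW G0).
exists (1 + 5%:R * (A * (P * M ^+ 2 * G))) => eps T v0 v /andP[e0 e1] T0 sol bnd.
have e01 : 0 < eps <= 1 by rewrite e0 ltW.
have [dV cV] := rescaled_curve chi_smooth chi_periodic hW a02 (isT : (2 <= 18)%N) s20 e01 T0 sol bnd.
pose U k t := iter k L (v (eps * t)).
pose S k t := iter k L (transport (v (eps * t)) (v (eps * t))).
have dS0 t : t \in `]0, T / eps[ -> decay 16 (K * (M * M)) (S 0%N t).
  by move=> /dV d; apply: HK; exact: decay_le d.
have dS k t : (k <= 4)%N -> t \in `]0, T / eps[ -> exists B, decay 8 B (S k t).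
  move=> k4 /dS0 d; have [Q Q0 HQ] := decay_iter_L chi_smooth chi_periodic k (isT : (2 <= 8)%N).
  by exists (Q * (K * (M * M))); apply: HQ; apply: decay_le d; clear -k4; lia.
have dU k t : (k <= 4)%N -> t \in `]0, T / eps[ -> exists B, decay 8 B (U k t).
  move=> k4 /dV d; have [Q Q0 HQ] := decay_iter_L chi_smooth chi_periodic k (isT : (2 <= 8)%N).
  by exists (Q * M); apply: HQ; apply: decay_le d; clear -k4; lia.
(* Applying the linear operator L to the equation of [U k] gives that of [U k.+1], with L applied to
   the source. Each application costs two of the 18 powers, and 10 remain at k = 4. *)
have cU k : (k <= 4)%N -> curve 0 (T / eps) (18 - 2 * k) (U k)
    (fun t n => - (eps%:C * S k t n + L (U k t) n)).
  elim: k => [|k IH] k4; first exact: cV.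
  have e : (18 - 2 * k = (18 - 2 * k.+1) + 2)%N by clear -k4; lia.
  have := IH (ltnW k4); rewrite e => ck.
  have p2 : (2 <= 18 - 2 * k.+1)%N by clear -k4; lia.
  apply: curve_eq (curve_Lop chi_smooth chi_periodic a02 p2 ck) => // t tI.
  have [B hB] := dS k t (ltnW k4) tI; have [B' hB'] := dU k.+1 t k4 tI.
  exact: (Lop_linear chi_smooth chi_periodic eps%:C (decay_le _ hB) (decay_le _ hB')).
apply: (@energy_estimate R chi chi_smooth chi_periodic chi_ge0 (1 / 2) 5 U S _ eps T) => //.
- by move=> k k5; apply: curve_le (cU k k5); clear -k5; lia.
- by move=> k t k5 tI; have [B hB] := dS k t k5 tI; exists B; exact: decay_le hB.
- move=> k t k5 tI; have d := dV t tI.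
  apply: le_trans (HA k k5 _ _ (dS0 t tI)) _.
  rewrite -(mulrA A) ler_pM2l// -(mulrA (P * M ^+ 2)).
  have d6 := decay_le (isT : (6 <= 20)%N) d.
  apply: le_trans (HP _ _ M M M0 d6 d6) _.
  rewrite ler_pM2l; last by rewrite mulr_gt0 ?exprn_gt0.
  by apply: (HG _ M); exact: decay_le d.
- move=> t tT.
  have tI : t / eps \in `]0, T / eps[.
    by move: tT; rewrite !in_itv/= => /andP[r0 rT]; rewrite divr_gt0//= ltr_pM2r ?invr_gt0.
  rewrite /gravity_energy; apply: eq_bigr => k _; congr (L2norm _ ^+ 2).
  have := dV _ tI; rewrite /U mulrC divfK ?gt_eqF// => d.
  apply: (iter_damped_op chi_smooth chi_periodic (B := M)); apply: decay_le d.
  by have := ltn_ord k; clear; lia.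
Qed.

End gravity.

Local Close Scope complex_scope.

Theorem theorem2p1 (R : realType) (alpha : R)
  (halpha : alpha = 3 / 2 \/ alpha = 1 / 2)
  (omega : set R) (chi : R -> R) (hchi : cutoff omega chi)
  (N : nat) (W : distr R -> distr R) (hW : admissible_W N W) :
  exists sigma0 : R, forall sigma : R, sigma0 <= sigma ->
  forall M : R, 0 < M ->
  exists C : R, forall (eps T : R) (v0 : distr R) (v : R -> distr R),
    0 < eps < 1 -> 0 < T ->
    is_solution W chi alpha sigma eps T v0 v ->
    (forall t, t \in `[0, T] -> Sobolev_norm sigma (v t) <= M) ->
    forall t, t \in `]0, T[ ->
      derivable (energy chi alpha eps v) t 1 /\
      derive1 (energy chi alpha eps v) t <= C * energy chi alpha eps v t.
Proof.
have [_ chi_smooth chi_periodic chi_ge0 _] := hchi.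
(* 20 = 18 + 2: [rescaled_curve] is used with q = 18, and the losses of either case leave curves of
   order 10. *)
exists 20%:R => sigma s20 M M0; rewrite /energy.
case: halpha => ->; first by rewrite eqxx; exact: capillary_estimate hW _ _ s20 M0.
have -> : (1 / 2 == 3 / 2 :> R) = false by apply/eqP; lra.
exact: gravity_estimate hW _ _ s20 M0.
Qed.
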